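(* Let $d\ge 1$ and $n\ge 4$ be integers, let $\rho>0$, and put $\phi:=\pi_d\rho^d$, where $\pi_d$ is the volume of the unit ball in $\mathbb{R}^d$. Let $V$ be the volume of the union of the $n$ balls of radius $\rho$ (in the toroidal metric) centered at $n$ independent uniformly distributed points of the torus $C_n=[0,n^{1/d})^d$, and let $\mu_V:=\mathbb{E}[V]$, $\sigma_V:=\sqrt{\operatorname{Var}(V)}$. If $n>6^d\phi$, then $$D_V\;\le\;\frac{\mu_V}{5\sigma_V^2}\left(\sqrt{\frac{11\phi^2}{\sigma_V}+\frac{5\sqrt{\eta_V(n,\rho)}}{\sqrt n}}+\frac{2\phi}{\sqrt{\sigma_V}}\right)^2,$$ where $$\begin{aligned}\eta_V(n,\rho):=\;&2\phi^2\bigl((3^d+1)\phi+1\bigr)^2\left(1+(2^d+1)6^d\phi+\left(\frac{2n-6^d\phi}{n-6^d\phi}\right)6^{2d}\phi^2\right)\\&+2\phi^4\left(3(4^d+2^d)\phi+3(4^d)\phi^2\left(\frac{2n-3(2^d)\phi}{n-3(2^d)\phi}\right)+4+\frac2n\right).\end{aligned}$$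
   Context: $C_n:=[0,n^{1/d})^d$ is equipped with the Euclidean toroidal metric $D$ (periodic boundary conditions), and $B_r(x):=\{y\in C_n: D(x,y)\le r\}$. $U_1,\dots,U_n$ are independent random vectors uniformly distributed over $C_n$, and $$V:=\operatorname{Volume}\Bigl(\bigcup_{i=1}^n B_\rho(U_i)\Bigr),$$ volume being Lebesgue measure on $C_n$. The constant $\pi_d=\pi^{d/2}/\Gamma(1+d/2)$. For a random variable $X$ with $\operatorname{SD}(X):=\sqrt{\operatorname{Var}(X)}\in(0,\infty)$, $$D_X:=\sup_{t\in\mathbb{R}}\left|P\left[\frac{X-\mathbb{E}X}{\operatorname{SD}(X)}\le t\right]-P[Z\le t]\right|,$$ where $Z$ is a standard normal random variable. *)

(* Defs.v *)
From HB Require Import structures.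
From mathcomp Require Import all_boot all_order all_algebra.
From mathcomp Require Import all_classical all_reals all_analysis.

Set Implicit Arguments.
Unset Strict Implicit.
Unset Printing Implicit Defensive.
Import Order.TTheory GRing.Theory Num.Theory.
Import numFieldNormedType.Exports.

Local Open Scope classical_set_scope.
Local Open Scope ring_scope.

(* Lebesgue measure on R^d, points of R^d being d-tuples with the product
   sigma-algebra: the d-fold product of the one-dimensional measure. *)
Definition tcons (R : realType) d (p : R * d.-tuple R) : d.+1.-tuple R :=
  [tuple of p.1 :: p.2].

Fixpoint lebesgue_tuple (R : realType) (d : nat) : set (d.-tuple R) -> \bar R :=
  match d return set (d.-tuple R) -> \bar R with
  | 0 => \d_ [tuple]
  | d'.+1 =>
      pushforward (@lebesgue_measure R \x @lebesgue_tuple R d')%E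
        (@tcons R d')
  end.
Arguments lebesgue_tuple {R} d.

Section lebesgue_tuple.
Variable R : realType.

Lemma measurable_tcons d : measurable_fun [set: R * d.-tuple R] (@tcons R d).
Proof.
by apply: measurable_cons; [exact: measurable_fst | exact: measurable_snd].
Qed.

Let tuncons d (t : d.+1.-tuple R) : R * d.-tuple R :=
  (tnth t ord0, [tuple of behead t]).

Let measurable_tuncons d : measurable_fun [set: d.+1.-tuple R] (@tuncons d).
Proof.
apply: measurable_fun_pair; first exact: measurable_tnth.
exact: measurable_behead.
Qed.

Let tconsK d : cancel (@tcons R d) (@tuncons d).
Proof. by case=> x t; congr pair; apply/val_inj. Qed.

Let measure_ind d : exists m : {sigma_finite_measure set (d.-tuple R) -> \bar R},
  forall A, lebesgue_tuple d A = m A.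
Proof.
elim: d => [|d [m mE]].
  by exists (@dirac _ (0.-tuple R) [tuple] R).
pose mu : {sigma_finite_measure set _ -> \bar R} := @lebesgue_measure R.
have lE : lebesgue_tuple d = m by apply/funext.
pose nu : {measure set _ -> \bar R} :=
  measure_function_pushforward__canonical__measure_function_Measure
    (mu \x m)%E (@measurable_tcons d).
have nuE A : nu A = (mu \x m)%E (@tcons R d @^-1` A) by [].
have nu_sf : sigma_finite setT nu.
  have /sigma_finiteP[F [TF ndF Foo]] := sigma_finiteT mu.
  have /sigma_finiteP[G [TG ndG Goo]] := sigma_finiteT m.
  exists (fun k => @tuncons d @^-1` (F k `*` G k)).
    apply/seteqP; split => // t _.
    have [i _ Fi] : (\bigcup_k F k) (tuncons t).1 by rewrite -TF.
    have [j _ Gj] : (\bigcup_k G k) (tuncons t).2 by rewrite -TG.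
    exists (maxn i j) => //; split.
      by move: Fi; exact/subsetPset/ndF/leq_maxl.
    by move: Gj; exact/subsetPset/ndG/leq_maxr.
  move=> k; have [mFk Fk] := Foo k; have [mGk Gk] := Goo k; split.
    rewrite -[X in measurable X]setTI.
    by apply: measurable_tuncons => //; exact: measurableX.
  rewrite nuE -comp_preimage (_ : _ \o _ = id); last first.
    by apply/funext => x /=; exact: tconsK.
  by rewrite preimage_id product_measure1E// lte_mul_pinfty// ge0_fin_numE.
pose nm := isMeasure.Build _ _ _ (nu : set _ -> \bar R) (measure0 nu)
  (@measure_ge0 _ _ _ nu) (@measure_semi_sigma_additive _ _ _ nu).
pose nM : {measure set _ -> \bar R} := HB.pack (nu : set _ -> \bar R) nm.
pose sf := Measure_isSigmaFinite.Build _ _ _ (nM : set _ -> \bar R) nu_sf.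
pose nu' : {sigma_finite_measure set _ -> \bar R} :=
  HB.pack (nu : set _ -> \bar R) nm sf.
exists nu' => A.
by rewrite /= lE.
Qed.

Let lebesgue_tuple0 d : @lebesgue_tuple R d set0 = 0%E.
Proof. by have [m ->] := measure_ind d; exact: measure0. Qed.

Let lebesgue_tuple_ge0 d A : (0 <= @lebesgue_tuple R d A)%E.
Proof. by have [m ->] := measure_ind d; exact: measure_ge0. Qed.

Let lebesgue_tuple_additive d : semi_sigma_additive (@lebesgue_tuple R d).
Proof.
have [m /funext ->] := measure_ind d; exact: measure_semi_sigma_additive.
Qed.

HB.instance Definition _ d := isMeasure.Build _ _ _ (@lebesgue_tuple R d)
  (@lebesgue_tuple0 d) (@lebesgue_tuple_ge0 d) (@lebesgue_tuple_additive d).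

Let lebesgue_tuple_sigma_finite d : sigma_finite setT (@lebesgue_tuple R d).
Proof. by have [m /funext ->] := measure_ind d; exact: sigma_finiteT. Qed.

HB.instance Definition _ d := Measure_isSigmaFinite.Build _ _ _
  (@lebesgue_tuple R d) (@lebesgue_tuple_sigma_finite d).

Lemma lebesgue_tuple_box d (A : 'I_d -> set R) :
  (forall i, measurable (A i)) ->
  lebesgue_tuple d [set x | forall i, A i (tnth x i)] =
  (\prod_(i < d) lebesgue_measure (A i))%E.
Proof.
elim: d A => [|d ih] A mA.
  rewrite big_ord0 /= diracE mem_set//=; by case.
pose B := [set x : d.-tuple R | forall i, A (lift ord0 i) (tnth x i)].
transitivity (lebesgue_measure (A ord0) * lebesgue_tuple d B)%E; last first.
  rewrite big_ord_recl; congr (_ * _)%E.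
  by apply: (ih (fun i => A (lift ord0 i))) => i; exact: mA.
have -> : lebesgue_tuple d.+1 [set x | forall i, A i (tnth x i)] =
    (@lebesgue_measure R \x lebesgue_tuple d)%E
      (A ord0 `*` B).
  rewrite /= /pushforward; congr product_measure1.
  apply/seteqP; split => [[x t] /= H|[x t] /= [A0 H] i].
    split; first exact: (H ord0).
    by move=> i; have := H (lift ord0 i); rewrite tnthS.
  case: (unliftP ord0 i) => [j|] ->; first by rewrite tnthS.
  exact: A0.
rewrite product_measure1E//; first exact: mA.
have -> : B = \bigcap_(i in [set: 'I_d])
    (fun x : d.-tuple R => tnth x i) @^-1` A (lift ord0 i).
  by apply/seteqP; split => x /= H i; [move=> _; exact: H | exact: (H i I)].
apply: fin_bigcap_measurable => // i _.
by rewrite -[X in measurable X]setTI; exact: measurable_tnth.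
Qed.

End lebesgue_tuple.

Definition euclidean_norm (R : realType) (d : nat) (v : 'I_d -> R) : R :=
  Num.sqrt (\sum_i v i ^+ 2).

Definition unit_ball_volume (R : realType) (d : nat) : R :=
  fine (lebesgue_tuple d
    [set x : d.-tuple R | euclidean_norm (tnth x) <= 1]).

Definition torus_side (R : realType) (d n : nat) : R := n%:R `^ (d%:R^-1).

Definition torus (R : realType) (d n : nat) : set (d.-tuple R) :=
  [set x | forall i, 0 <= tnth x i < torus_side R d n].
Arguments torus {R} d n.

(* The quotient metric of R^d / (n^(1/d) Z)^d: the distance from x to the
   nearest of the translates of y by the period lattice. *)
Definition torus_dist (R : realType) (d n : nat) (x y : d.-tuple R) : R :=
  inf [set euclidean_norm
             (fun i => tnth x i - tnth y i + (k i)%:~R * torus_side R d n)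
      | k in [set: 'I_d -> int]].

Definition torus_ball (R : realType) (d n : nat) (r : R) (x : d.-tuple R) :
    set (d.-tuple R) :=
  [set y | torus d n y /\ torus_dist n x y <= r].

Definition covered_volume (R : realType) (d n : nat) (rho : R)
    (x : 'I_n -> d.-tuple R) : R :=
  fine (lebesgue_tuple d (\bigcup_i torus_ball n rho (x i))).

Section probability.
Context {dT} {T : measurableType dT} {R : realType} (P : probability T R).

Definition uniform_law {dT'} {T' : measurableType dT'}
    (mu : set T' -> \bar R) (D : set T') (X : {RV P >-> T'}) : Prop :=
  forall A, measurable A ->
    distribution P X A = ((fine (mu D))^-1%:E * mu (A `&` D))%E.

Definition independent_RVs {dT'} {T' : measurableType dT'} {I : finType}
    (X : I -> {RV P >-> T'}) : Prop :=
  forall (J : {set I}) (A : I -> set T'),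
    (forall i, i \in J -> measurable (A i)) ->
    fine (P (\bigcap_(i in [set` J]) X i @^-1` A i)) =
    \prod_(i in J) fine (P (X i @^-1` A i)).

Definition mean (X : T -> R) : R := fine ('E_P[X])%E.

Definition std_dev (X : T -> R) : R := Num.sqrt (fine ('V_P[X])%E).

(* Meaningful for 0 < std_dev X < +oo. *)
Definition kolmogorov_dist (X : T -> R) : R :=
  sup [set `| fine (P [set w | (X w - mean X) / std_dev X <= t])
              - fine (normal_prob 0 1 `]-oo, t]) | | t in [set: R]].

End probability.

Definition eta_V (R : realType) (d n : nat) (phi : R) : R :=
  2 * phi ^+ 2 * ((3 ^+ d + 1) * phi + 1) ^+ 2 *
    (1 + (2 ^+ d + 1) * 6 ^+ d * phi
     + (2 * n%:R - 6 ^+ d * phi) / (n%:R - 6 ^+ d * phi)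
       * 6 ^+ (2 * d) * phi ^+ 2)
  + 2 * phi ^+ 4 *
    (3 * (4 ^+ d + 2 ^+ d) * phi
     + 3 * 4 ^+ d * phi ^+ 2
       * ((2 * n%:R - 3 * 2 ^+ d * phi) / (n%:R - 3 * 2 ^+ d * phi))
     + 4 + 2 / n%:R).

(* Main.v *)
Require Import Defs.
From HB Require Import structures.
From mathcomp Require Import all_boot all_order all_algebra.
From mathcomp Require Import all_classical all_reals all_analysis.
From mathcomp Require Import measurable_realfun ring lra.

(* Work with v = V / n, the uniform probability of the covered region, and let
   theta be the probability of one ball and q = 1 - theta. For a point x write
   the indicator that x is vacant as the product of b_i = 1 - 1[U_i covers x] and
   telescope it against the powers of q:
     prod_i b_i - q^n = sum_i q^i (b_i - q) prod_(j > i) b_j.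
   Integrating over x and resampling U_i gives, for every bounded F,
     Cov(v, F) = E sum_i G_i (F - E_i F),
   where E_i averages over the i-th point and G_i = q^i l_i, with l_i the measure
   of the part of the i-th ball left uncovered by the later ones. This is a Stein
   coupling whose increments are at most theta and whose total weight sum_i G_i
   has mean at most E v and is at most v, hence at most 2 E v.

   Stein's equation for a piecewise linear approximation of the indicator of a
   half-line then bounds the Kolmogorov distance D by error terms plus a multiple
   of D itself; the error involves the variance of T = sum_i G_i (v - E_i v).
   Adding one point changes T by at most 3 theta a + 2 n theta^3, where a is the
   part of the new ball already covered by the others, and E a <= n theta^2, so
   the Efron-Stein inequality bounds Var T, well within the allowance eta_V.
   Optimising the smoothing scale gives the theorem.

   The actual volume n theta of a ball in the torus is independent of its centre
   and at most phi; it may be smaller, since balls can wrap around when d is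
   large. All the bounds are monotone in it. *)

Set Implicit Arguments.
Unset Strict Implicit.
Unset Printing Implicit Defensive.
Import Order.TTheory GRing.Theory Num.Theory.
Import numFieldNormedType.Exports.

Local Open Scope classical_set_scope.
Local Open Scope ring_scope.

(** * The normal distribution and Stein's equation *)

(** Telescoping against powers of [q] centres every term: [b_i - q] has mean zero in [U_i] and the
    trailing product involves later points only, so averaging over one point acts on one term. The
    bounds on increments, weights and Var T use only that the covering function is symmetric, has
    values in [0, 1] and has a constant mean in (0, 1); no locality of the balls enters.
    Disjointness of distant balls serves to show that the variance is positive. The obstacle in the
    normal approximation is that the second-order remainder charges the event that the standardized
    variable falls into the window of the ramp. Its probability is controlled only through D itself,
    and it is correlated with the weights, hence a pointwise bound on their sum besides the bound on
    its mean. The right-hand side of the theorem is best read expanded. With K' = mu phi^2 / sigma^3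
    and M = mu sqrt(eta) / (sigma^2 sqrt n) it equals M + 3 K' + r, where the cross term r is at
    least sqrt(2 K' (M + 3 K')), the cost of the best smoothing scale. *)

Lemma ge0_derive_le (R : realType) (f f' : R -> R) (a b : R) :
  (forall x, a <= x <= b -> is_derive x 1 f (f' x)) ->
  (forall x, a < x < b -> 0 <= f' x) -> a <= b -> f a <= f b.
Proof.
move=> fd f'0 ab; apply: (@ger0_derive1_le_cc _ f a b) => //.
- move=> x; rewrite in_itv/= => /andP[ax xb].
  by have := fd x; rewrite (ltW ax) (ltW xb) => /(_ isT)[].
- move=> x; rewrite in_itv/= => /andP[ax xb].
  have := fd x; rewrite (ltW ax) (ltW xb) => /(_ isT) dx.
  by rewrite derive1E derive_val f'0// ax.
- apply: derivable_within_continuous => x; rewrite in_itv/= => axb.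
  by have [] := fd x axb.
- by rewrite in_itv/= lexx.
- by rewrite in_itv/= lexx ab.
Qed.

Section normal_cdf.
Variable R : realType.
Implicit Types (g h : R -> R) (w x : R).
Local Notation mu := (@lebesgue_measure R).
Local Notation pdf := (@normal_pdf R 0 1).

Definition npart h w : R := (\int[mu]_(t in `]-oo, w]) (h t * pdf t))%R.

Definition ncdf w : R := fine (normal_prob 0 1 `]-oo, w]).

Lemma ncdfE : ncdf = npart (fun=> 1).
Proof.
apply/funext => w; rewrite /ncdf /npart /normal_prob /Rintegral.
by congr fine; apply: eq_integral => t _; rewrite mul1r.
Qed.

Lemma pdfE x : pdf x = normal_peak 1 * expR (- (x ^+ 2 / 2)).
Proof.
rewrite /normal_pdf (negbTE (oner_neq0 _)) /normal_fun subr0.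
by congr (_ * expR _); rewrite expr1n mulr2n; field.
Qed.

Lemma pdf_gt0 x : 0 < pdf x.
Proof. by rewrite pdfE mulr_gt0 ?expR_gt0// normal_peak_gt0// oner_neq0. Qed.

Lemma peak_le_half : normal_peak (1 : R) <= 1 / 2.
Proof.
rewrite /normal_peak expr1n mul1r -[leRHS]invrK lef_pV2 ?posrE//; last first.
  by rewrite sqrtr_gt0 pmulrn_lgt0// pi_gt0.
rewrite mul1r invrK -[leLHS]gtr0_norm// -sqrtr_sqr ler_wsqrtr// mulr2n.
by have := pi_ge2 R; nra.
Qed.

Lemma pdf_le_half x : pdf x <= 1 / 2.
Proof.
by apply: le_trans peak_le_half; rewrite normal_pdf_ub// oner_neq0.
Qed.

Lemma is_derive_pdf x : is_derive x 1 pdf (- x * pdf x).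
Proof.
have -> : pdf = (fun x => normal_peak 1 * expR (- (x ^+ 2 / 2))).
  by apply/funext => y; rewrite pdfE.
apply: is_derive_eq.
by rewrite /GRing.scale/=; field.
Qed.

Lemma integrable_mul_pdf h : continuous h -> (forall x, 0 <= h x <= 1) ->
  mu.-integrable setT (EFin \o (fun t => h t * pdf t)).
Proof.
move=> ch h01; apply: (le_integrable _ _ _ (integrable_normal_pdf 0 1)) => //.
  apply/measurable_EFinP/measurable_funM.
    exact: continuous_measurable_fun.
  exact: measurable_normal_pdf.
move=> x _ /=; rewrite lee_fin normrM ler_piMl//.
by have /andP[? ?] := h01 x; rewrite ger0_norm.
Qed.

Lemma is_derive_npart h w : continuous h -> (forall x, 0 <= h x <= 1) ->
  is_derive w 1 (npart h) (h w * pdf w).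
Proof.
move=> ch h01.
have ww : w < w + 1 by rewrite ltrDl.
have [] := @continuous_FTC1 _ (fun t => h t * pdf t) -oo%O w (w + 1) ww.
- exact/(integrableS _ _ _ (integrable_mul_pdf ch h01)).
- by rewrite ltNyr.
- apply: continuousM; first exact: ch.
  by apply: continuous_normal_pdf; rewrite oner_neq0.
- by move=> dF F'; apply: DeriveDef => //; rewrite -derive1E.
Qed.

Lemma is_derive_ncdf w : is_derive w 1 ncdf (pdf w).
Proof.
rewrite ncdfE -[pdf w]mul1r; apply: (@is_derive_npart (fun=> 1)).
  by move=> x; exact: cvg_cst.
by move=> x; rewrite ler01 lexx.
Qed.

End normal_cdf.

Section normal_cdf_bounds.
Variable R : realType.
Implicit Types (g h : R -> R) (w x : R).
Local Notation mu := (@lebesgue_measure R).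
Local Notation pdf := (@normal_pdf R 0 1).

Definition nexp h : R := (\int[mu]_t (h t * pdf t))%R.

Lemma integrable_mul_pdfS (D : set R) h : measurable D -> continuous h ->
  (forall x, 0 <= h x <= 1) ->
  mu.-integrable D (EFin \o (fun t => h t * pdf t)).
Proof. by move=> mD ch h01; apply: integrableS (integrable_mul_pdf ch h01). Qed.

Lemma npart_tail h w : continuous h -> (forall x, 0 <= h x <= 1) ->
  nexp h - npart h w = (\int[mu]_(t in `]w, +oo[) (h t * pdf t))%R.
Proof.
move=> ch h01; rewrite /nexp -(setUv `]-oo, w]) setCitvl Rintegral_setU//=.
- by rewrite /npart addrC addKr.
- apply: integrable_mul_pdfS => //.
  by apply: measurableU.
- rewrite -setCitvl; apply/disj_setPS => x [] //.
Qed.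

Lemma nexp1 : nexp (fun=> 1) = 1.
Proof.
rewrite /nexp /Rintegral; under eq_integral do rewrite mul1r.
by rewrite integral_normal_pdf.
Qed.

Lemma npart_bounds h w : continuous h -> (forall x, 0 <= h x <= 1) ->
  0 <= npart h w <= ncdf w.
Proof.
move=> ch h01; apply/andP; split.
  apply: Rintegral_ge0 => x _; have /andP[h0 _] := h01 x.
  by rewrite mulr_ge0 ?normal_pdf_ge0.
rewrite ncdfE; apply: le_Rintegral => //.
- exact: integrable_mul_pdfS.
- apply: integrable_mul_pdfS => //; first by move=> x; exact: cvg_cst.
  by move=> _; rewrite ler01 lexx.
- move=> x _; have /andP[_ h1] := h01 x.
  by rewrite ler_wpM2r ?normal_pdf_ge0.
Qed.

Lemma nexp_npart_bounds h w : continuous h -> (forall x, 0 <= h x <= 1) ->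
  0 <= nexp h - npart h w <= 1 - ncdf w.
Proof.
move=> ch h01.
have c1 : continuous ((fun=> 1) : R -> R) by move=> x; exact: cvg_cst.
have c01 : forall x : R, 0 <= (1 : R) <= 1 by move=> _; rewrite ler01 lexx.
apply/andP; split.
  rewrite npart_tail//; apply: Rintegral_ge0 => x _; have /andP[h0 _] := h01 x.
  by rewrite mulr_ge0 ?normal_pdf_ge0.
rewrite -nexp1 ncdfE !npart_tail//; apply: le_Rintegral => //.
- exact: integrable_mul_pdfS.
- exact: integrable_mul_pdfS.
- move=> x _; have /andP[_ h1] := h01 x.
  by rewrite ler_wpM2r ?normal_pdf_ge0.
Qed.

Let idR : measurableTypeR R -> R := idfun.
#[local] HB.instance Definition _ :=
  @isMeasurableFun.Build _ _ _ _ idR (@measurable_id _ _ setT).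

Let cdf_idR r : cdf (idR : {RV (normal_prob 0 1 : probability _ R) >-> R}) r =
  (ncdf r)%:E.
Proof. by rewrite /ncdf fineK// fin_num_measure. Qed.

Lemma ncdf_ge0 w : 0 <= ncdf w.
Proof. by rewrite /ncdf fine_ge0. Qed.

Lemma ncdf_le1 w : ncdf w <= 1.
Proof. by rewrite -lee_fin -cdf_idR cdf_le1. Qed.

Lemma ncdf_near_Ny (e : R) : 0 < e -> exists x0, forall x, x <= x0 -> ncdf x < e.
Proof.
move=> e0; have := cvg_cdfNy0 (idR : {RV (normal_prob 0 1 : probability _ R) >-> R}).
have -> : cdf (idR : {RV (normal_prob 0 1 : probability _ R) >-> R}) =
  EFin \o @ncdf R by apply/funext => r; rewrite cdf_idR.
move/fine_cvgP => [_ /=] /cvgrPdist_lt /(_ _ e0)[x0 [_ x0P]].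
exists (x0 - 1) => x xx0.
have /= := x0P x; rewrite sub0r normrN => H.
by rewrite -[ltLHS]ger0_norm ?ncdf_ge0// H// (le_lt_trans xx0)// gtrBl.
Qed.

Lemma ncdf_near_y (e : R) : 0 < e ->
  exists x0, forall x, x0 <= x -> 1 - ncdf x < e.
Proof.
move=> e0; have := cvg_cdfy1 (idR : {RV (normal_prob 0 1 : probability _ R) >-> R}).
have -> : cdf (idR : {RV (normal_prob 0 1 : probability _ R) >-> R}) =
  EFin \o @ncdf R by apply/funext => r; rewrite cdf_idR.
move/fine_cvgP => [_ /=] /cvgrPdist_lt /(_ _ e0)[x0 [_ x0P]].
exists (x0 + 1) => x xx0.
have /= H := x0P x.
by rewrite (le_lt_trans (ler_norm _))// H// (lt_le_trans _ xx0)// ltrDl.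
Qed.

Lemma pdf_sym x : pdf (- x) = pdf x.
Proof. by rewrite !pdfE sqrrN. Qed.

(** The sum of the two tails has zero derivative, and its constant value is read off far out, where
    it is within any [e] of 1. *)
Lemma ncdf_sym w : ncdf (- w) = 1 - ncdf w.
Proof.
pose s x : R := ncdf x + ncdf (- x).
have ds x : is_derive x 1 s 0.
  have d1 := is_derive_ncdf x; have d2 := is_derive_ncdf (- x).
  have d3 : is_derive x 1 (@ncdf R \o -%R) (- pdf x).
    by apply: is_derive_eq; rewrite /GRing.scale/= pdf_sym; ring.
  by rewrite -(subrr (pdf x)); exact: (is_deriveD d1 d3).
have sC x y : x <= y -> s x = s y.
  move=> xy; apply/eqP; rewrite eq_le; apply/andP; split.
    by apply: (@ge0_derive_le _ s (fun=> 0)).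
  rewrite -lerN2; apply: (@ge0_derive_le _ (- s) (fun=> 0)) => // z _.
  by rewrite -oppr0; exact: is_deriveN.
suff s1 : s w = 1 by rewrite -s1 /s addrC addKr.
apply/eqP; rewrite -subr_eq0 -normr_le0; apply/ler_addgt0Pr => e e0; rewrite add0r.
have [x1 x1P] := ncdf_near_y (divr_gt0 e0 (ltr0Sn R 1)).
have [x2 x2P] := ncdf_near_Ny (divr_gt0 e0 (ltr0Sn R 1)).
pose x := Num.max w (Num.max x1 (- x2)).
have wx : w <= x by rewrite le_max lexx.
have x1x : x1 <= x by rewrite !le_max lexx orbT.
have x2x : - x <= x2 by rewrite lerNl !le_max lexx !orbT.
rewrite (sC _ _ wx) /s ler_norml; have := x1P _ x1x; have := x2P _ x2x.
by have := ncdf_ge0 (- x); have := ncdf_le1 x; lra.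
Qed.

Lemma ncdf0 : ncdf (0 : R) = 1 / 2.
Proof. by have := ncdf_sym 0; rewrite oppr0; lra. Qed.

(* The derivative of [ncdf w + pdf w / w] is [- pdf w / w ^+ 2]. *)
Lemma mills_ratio w : - w * ncdf w <= pdf w.
Proof.
have [w0|w0] := leP 0 w.
  by rewrite (le_trans _ (normal_pdf_ge0 _ _ _))// mulNr oppr_le0 mulr_ge0 ?ncdf_ge0.
pose g x : R := - (ncdf x + x^-1 * pdf x).
have dg x : x < 0 -> is_derive x 1 g (x ^- 2 * pdf x).
  move=> x0; have d1 := is_derive_ncdf x; have d2 := is_derive_pdf x.
  have x0' : x != 0 by rewrite lt_eqF.
  have d3 := is_deriveV x0' (is_derive_id x 1).
  have := is_deriveN (is_deriveD d1 (is_deriveM d3 d2)).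
  by move/is_derive_eq; apply; rewrite /GRing.scale/=; field.
suff : ncdf w + w^-1 * pdf w <= 0.
  rewrite -(nmulr_rge0 _ w0) mulrDr mulVKf ?lt_eqF//.
  by lra.
apply/ler_addgt0Pr => e e0; rewrite add0r.
have [x0 x0P] := ncdf_near_Ny e0.
pose x := Num.min x0 w.
have xw : x <= w by rewrite ge_min lexx orbT.
have xx0 : x <= x0 by rewrite ge_min lexx.
have : g x <= g w.
  apply: (@ge0_derive_le _ g (fun x => x ^- 2 * pdf x)) => //.
    by move=> y /andP[_ yw]; apply: dg; rewrite (le_lt_trans yw).
  by move=> y _; rewrite mulr_ge0 ?normal_pdf_ge0// invr_ge0 sqr_ge0.
rewrite /g lerN2 => /le_trans; apply.
rewrite (le_trans _ (ltW (x0P _ xx0)))// gerDl mulr_le0_ge0 ?normal_pdf_ge0//.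
by rewrite invr_le0 (le_trans xw)// ltW.
Qed.

(** By Mills' inequality the ratio of [ncdf] to the density is nondecreasing, so on the negative
    half-line it is at most its value at 0, sqrt(pi / 2), which is below 3 / 2. *)
Lemma ncdf_le_pdf w : w <= 0 -> ncdf w <= 3 / 2 * pdf w.
Proof.
move=> w0.
pose g x : R := ncdf x * (pdf x)^-1.
have dg x : is_derive x 1 g (1 + x * ncdf x / pdf x).
  have d1 := is_derive_ncdf x; have d2 := is_derive_pdf x.
  have p0 : pdf x != 0 by rewrite gt_eqF// pdf_gt0.
  have := is_deriveM d1 (is_deriveV p0 d2).
  by move/is_derive_eq; apply; rewrite /GRing.scale/=; field.
have : g w <= g 0.
  apply: (@ge0_derive_le _ g (fun x => 1 + x * ncdf x / pdf x)) => // x _.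
  have -> : 1 + x * ncdf x / pdf x = (pdf x + x * ncdf x) / pdf x.
    by field; rewrite gt_eqF// pdf_gt0.
  by rewrite divr_ge0 ?normal_pdf_ge0//; have := mills_ratio x; lra.
move=> gw; rewrite -ler_pdivrMr ?pdf_gt0//; apply: le_trans gw _.
rewrite /g ncdf0 pdfE expr0n/= mul0r oppr0 expR0 mulr1 /normal_peak invrK.
rewrite expr1n !mul1r.
have -> : 3 / 2 = 2^-1 * Num.sqrt (3 ^+ 2) :> R.
  by rewrite sqrtr_sqr ger0_norm//; field.
rewrite ler_wpM2l// ler_wsqrtr//.
by have := pihalf_lt2 R; rewrite -mulr_natr; lra.
Qed.

End normal_cdf_bounds.

(** Monotonicity replaces an integral remainder: for both signs [s], [s * (f (w + t) - t * f' w) + C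
    * t ^+ 2 / 2] is nondecreasing in [t] on [0, d]. Negative [d] is handled by reflecting [f]. *)
Lemma taylor1_le (R : realType) (f f' : R -> R) (w d C : R) :
  (forall x : R, is_derive x 1 f (f' x)) ->
  (forall t, `|t| <= `|d| -> `|f' (w + t) - f' w| <= C * `|t|) ->
  `|f (w + d) - f w - d * f' w| <= C * d ^+ 2 / 2.
Proof.
wlog d0 : f f' w d / 0 <= d => [wl fd f'C|fd f'C].
  have [d0|/ltW d0] := leP 0 d; first exact: wl.
  have d0' : 0 <= - d by rewrite oppr_ge0.
  have := wl (f \o -%R) (fun x => - f' (- x)) (- w) (- d) d0'.
  rewrite /= sqrrN -opprD !opprK mulrNN; apply => [x|t td].
    have d1 := fd (- x).
    by apply: is_derive_eq; rewrite /GRing.scale/=; ring.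
  rewrite opprD !opprK addrC distrC -(normrN t).
  by rewrite f'C// normrN (le_trans td)// normrN.
pose lin (s t : R) := s * (f (w + t) - t * f' w) + C * t ^+ 2 / 2.
have dlin (s t : R) : is_derive t 1 (lin s) (s * (f' (w + t) - f' w) + C * t).
  have d1 := fd (w + t).
  have d2 : is_derive t 1 (fun t => f (w + t)) (f' (w + t)).
    by apply: is_derive_eq; rewrite /GRing.scale/=; ring.
  by apply: is_derive_eq; rewrite /GRing.scale/=; field.
have lin_le s : `|s| = 1 -> lin s 0 <= lin s d.
  move=> s1; apply: (@ge0_derive_le _ _ (fun t => s * (f' (w + t) - f' w) + C * t)) => //.
  move=> t /andP[t0 td].
  have := f'C t; rewrite (ger0_norm d0) (ger0_norm (ltW t0)) => /(_ (ltW td)) ft.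
  have /lerNnormlW : `|s * (f' (w + t) - f' w)| <= C * t by rewrite normrM s1 mul1r.
  by lra.
have := lin_le 1 (normr1 _); have := lin_le (-1) (normrN1 _).
rewrite /lin addr0 expr0n/= mul0r mulr0 mul0r subr0 addr0 => h1 h2.
by rewrite ler_norml; apply/andP; split; lra.
Qed.

(** * Piecewise linear approximation of half-line indicators *)

Section ramp.
Variable R : realType.
Implicit Types z al x t A : R.
Local Notation pdf := (@normal_pdf R 0 1).

Definition ramp z al x : R := Num.max 0 (Num.min 1 (1 - (x - z) / al)).

Lemma continuous_ramp z al : continuous (ramp z al).
Proof.
move=> x; rewrite (_ : ramp z al =
  (fun=> 0) \max ((fun=> 1) \min (fun x => 1 - (x - z) / al)))//.
apply: continuous_max; first exact: cvg_cst.
apply: continuous_min; first exact: cvg_cst.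
apply: cvgB; first exact: cvg_cst.
apply: cvgM; last exact: cvg_cst.
by apply: cvgB; [exact: cvg_id | exact: cvg_cst].
Qed.

Lemma ramp01 z al x : 0 <= ramp z al x <= 1.
Proof. by rewrite /ramp le_max lexx/= ge_max ler01 ge_min lexx. Qed.

Lemma ramp1 z al x : 0 < al -> x <= z -> ramp z al x = 1.
Proof.
move=> al0 xz; rewrite /ramp min_l; first by rewrite max_r.
by rewrite lerDl oppr_ge0 pmulr_lle0 ?invr_gt0// subr_le0.
Qed.

Lemma ramp0 z al x : 0 < al -> z + al <= x -> ramp z al x = 0.
Proof.
move=> al0 xz; rewrite /ramp max_l// ge_min; apply/orP; right.
by rewrite subr_le0 ler_pdivlMr// mul1r lerBrDl.
Qed.

Lemma ramp_mid z al x : 0 < al -> z <= x <= z + al ->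
  ramp z al x = 1 - (x - z) / al.
Proof.
move=> al0 /andP[zx xz]; rewrite /ramp min_r ?max_r//.
  by rewrite subr_ge0 ler_pdivrMr// mul1r lerBlDl.
by rewrite gerBl divr_ge0 ?subr_ge0// ltW.
Qed.

Lemma ramp_lipschitz z al x y : 0 < al ->
  `|ramp z al x - ramp z al y| <= `|x - y| / al.
Proof.
move=> al0.
wlog xy : x y / x <= y => [wl|].
  have [xy|/ltW yx] := leP x y; first exact: wl.
  by rewrite distrC (distrC x) wl.
rewrite (distrC x) [in leRHS]ger0_norm ?subr_ge0//.
have -> : (y - x) / al = (1 - (x - z) / al) - (1 - (y - z) / al).
  by field; rewrite gt_eqF.
have : (1 - (y - z) / al) <= (1 - (x - z) / al).
  by rewrite lerB// ler_pM2r ?invr_gt0// lerB.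
rewrite /ramp; move: (1 - (x - z) / al) (1 - (y - z) / al) => a b ba.
have clamp (c u v : R) : (u <= v -> Num.min c u <= Num.min c v <= Num.min c u + (v - u)) *
    (u <= v -> Num.max c u <= Num.max c v <= Num.max c u + (v - u)).
  by split=> uv; case: (leP c u) => cu; case: (leP c v) => cv; apply/andP; split; lra.
have /andP[m1 m2] := (clamp 1 _ _).1 ba.
have /andP[M1 M2] := (clamp 0 _ _).2 m1.
by rewrite (ger0_norm (_ : 0 <= _)) ?subr_ge0//; lra.
Qed.

(** Outside the enlarged window both arguments lie on the same flat piece of the ramp; inside it the
    Lipschitz bound applies. *)
Lemma ramp_diff z al A x t : 0 < al -> `|t| <= A ->
  `|ramp z al (x + t) - ramp z al x| <=
  al^-1 * (z - A < x <= z + al + A)%R%:R * `|t|.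
Proof.
move=> al0 tA.
have := tA; rewrite ler_norml => /andP[tA1 tA2].
have [xzA|xzA] := boolP (z - A < x <= z + al + A).
  by rewrite mulr1 mulrC (le_trans (ramp_lipschitz _ _ _ _))// addrC addKr.
have A0 : 0 <= A by rewrite (le_trans _ tA).
move: xzA; rewrite negb_and -!real_leNgt ?num_real// -real_ltNge ?num_real//.
rewrite mulr0 mul0r => /orP[xzA|xzA].
  by rewrite !ramp1 ?subrr ?normr0//; lra.
by rewrite !ramp0 ?subrr ?normr0//; lra.
Qed.

(** The triangle between the ramp and a half-line indicator has area [al / 2] and the density is at
    most 1 / 2, whence [al / 4]. [g] and [g'] are the excess of the constant density 1 / 2 over the
    normal one, integrated up to [t] against the ramp and against its complement. *)
Lemma nexp_ramp z al : 0 < al ->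
  ncdf (z + al) - al / 4 <= nexp (ramp z al) <= ncdf z + al / 4.
Proof.
move=> al0.
have ch := @continuous_ramp z al; have h01 := @ramp01 z al.
have alN0 : al != 0 by rewrite gt_eqF.
have hz : npart (ramp z al) z = ncdf z.
  rewrite ncdfE; apply: eq_Rintegral => x; rewrite inE/= in_itv/= => xz.
  by rewrite ramp1.
have hza : nexp (ramp z al) = npart (ramp z al) (z + al).
  apply/eqP; rewrite -subr_eq0 npart_tail//; apply/eqP.
  rewrite -(Rintegral_set0 lebesgue_measure (fun x => x)) Rintegral_mkcond.
  rewrite [RHS]Rintegral_mkcond; apply: eq_Rintegral => x _.
  rewrite !patchE in_set0; case: ifPn => //; rewrite inE/= in_itv/= andbT => xz.
  by rewrite ramp0 ?mul0r// ltW.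
have zza : z <= z + al by rewrite lerDl ltW.
pose g t := 2^-1 * ((t - z) - (t - z) ^+ 2 / (2 * al)) - npart (ramp z al) t.
pose g' t := 2^-1 * ((t - z) ^+ 2 / (2 * al)) - (ncdf t - npart (ramp z al) t).
have dr t : z <= t <= z + al -> is_derive t 1 (npart (ramp z al))
    ((1 - (t - z) / al) * pdf t).
  by move=> tz; rewrite -ramp_mid//; exact: is_derive_npart.
have g1 : g z <= g (z + al).
  apply: (@ge0_derive_le _ g (fun t => (1 - (t - z) / al) * (2^-1 - pdf t))); last exact: zza.
    move=> t /dr d1; apply: is_derive_eq; rewrite /GRing.scale/=.
    by field.
  move=> t /andP[zt tz]; rewrite mulr_ge0//.
    by rewrite subr_ge0 ler_pdivrMr// mul1r lerBlDl ltW.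
  by have := pdf_le_half t; lra.
have g2 : g' z <= g' (z + al).
  apply: (@ge0_derive_le _ g' (fun t => (t - z) / al * (2^-1 - pdf t))); last exact: zza.
    move=> t /dr d1; have d2 := is_derive_ncdf t.
    apply: is_derive_eq; rewrite /GRing.scale/=.
    by field.
  move=> t /andP[zt tz]; rewrite mulr_ge0//.
    by rewrite divr_ge0 ?subr_ge0 ?(ltW zt) ?(ltW al0).
  by have := pdf_le_half t; lra.
have e : (z + al - z) ^+ 2 / (2 * al) = al / 2 by field.
move: g1 g2; rewrite /g /g' e -hza hz !subrr expr0n/= !mul0r.
by move=> g1 g2; apply/andP; split; lra.
Qed.

End ramp.

(** * Bounds on the solution of Stein's equation *)

Section stein_solution.
Variables (R : realType) (h : R -> R).
Hypothesis ch : continuous h.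
Hypothesis h01 : forall x, 0 <= h x <= 1.
Implicit Types w t x : R.
Local Notation pdf := (@normal_pdf R 0 1).

(* The bounded solution of [f' w - w * f w = h w - nexp h]. *)
Definition stein_sol w : R := (npart h w - nexp h * ncdf w) / pdf w.

(** Read off from the equation, and identified with the derivative by [is_derive_stein_sol]. In this
    form its increments can be bounded without differentiating [h]. *)
Definition stein_sol' w : R := w * stein_sol w + h w - nexp h.

Lemma nexp01 : 0 <= nexp h <= 1.
Proof.
have := npart_bounds 0 ch h01; have := nexp_npart_bounds 0 ch h01.
by move=> /andP[? ?] /andP[? ?]; apply/andP; split; lra.
Qed.

Lemma is_derive_stein_sol w : is_derive w 1 stein_sol (stein_sol' w).
Proof.
have d1 := is_derive_npart w ch h01; have d2 := is_derive_ncdf w.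
have p0 : pdf w != 0 by rewrite gt_eqF// pdf_gt0.
have d3 := is_deriveV p0 (is_derive_pdf w).
rewrite /stein_sol' /stein_sol; apply: is_derive_eq; rewrite /GRing.scale/=.
by field.
Qed.

(** On this side the numerator is rewritten through the right tail, as [nexp h * ncdf (- w) - (nexp
    h - npart h w)], so that the bounds decay together with the density. *)
Lemma stein_sol_ge0 w : 0 <= w ->
  - (1 - nexp h) * ncdf (- w) <= stein_sol w * pdf w <= nexp h * ncdf (- w).
Proof.
move=> w0; rewrite /stein_sol divfK ?gt_eqF ?pdf_gt0//.
have /andP[? ?] := nexp_npart_bounds w ch h01.
by rewrite ncdf_sym; apply/andP; split; lra.
Qed.

Lemma stein_sol_le0 w : w <= 0 ->
  - nexp h * ncdf w <= stein_sol w * pdf w <= (1 - nexp h) * ncdf w.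
Proof.
move=> w0; rewrite /stein_sol divfK ?gt_eqF ?pdf_gt0//.
have /andP[? ?] := npart_bounds w ch h01.
by apply/andP; split; lra.
Qed.

Lemma stein_sol_bound w : `|stein_sol w| <= 3 / 2.
Proof.
have p0 := pdf_gt0 w; have /andP[N0 N1] := nexp01.
rewrite -(ler_pM2r p0) -{1}(gtr0_norm p0) -normrM ler_norml.
have [w0|/ltW w0] := leP 0 w.
  have := @ncdf_le_pdf R (- w); rewrite oppr_le0 pdf_sym => /(_ w0) c.
  have c0 := ncdf_ge0 (- w).
  by have /andP[a b] := stein_sol_ge0 w0; apply/andP; split; nra.
have c := ncdf_le_pdf w0; have c0 := ncdf_ge0 w.
by have /andP[a b] := stein_sol_le0 w0; apply/andP; split; nra.
Qed.

(* For [w >= 0] Mills' inequality puts [w * stein_sol w] between [nexp h - 1]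
   and [nexp h], so that [stein_sol' w] lies between [h w - 1] and [h w]. *)
Lemma stein_sol'_bound w : `|stein_sol' w| <= 1.
Proof.
have p0 := pdf_gt0 w; have /andP[N0 N1] := nexp01; have /andP[h0 h1] := h01 w.
have [w0|/ltW w0] := leP 0 w.
  have := @mills_ratio R (- w); rewrite opprK pdf_sym => c.
  have c0 : 0 <= w * ncdf (- w) by rewrite mulr_ge0 ?ncdf_ge0.
  have /andP[a b] := stein_sol_ge0 w0.
  have a' : - (1 - nexp h) <= w * stein_sol w.
    by rewrite -(ler_pM2r p0) -mulrA; nra.
  have b' : w * stein_sol w <= nexp h.
    by rewrite -(ler_pM2r p0) -mulrA; nra.
  by rewrite /stein_sol' ler_norml; apply/andP; split; lra.
have c := mills_ratio w.
have c0 : 0 <= - w * ncdf w by rewrite mulr_ge0 ?ncdf_ge0 ?oppr_ge0.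
have /andP[a b] := stein_sol_le0 w0.
have a' : - (1 - nexp h) <= w * stein_sol w.
  by rewrite -(ler_pM2r p0) -mulrA; nra.
have b' : w * stein_sol w <= nexp h.
  by rewrite -(ler_pM2r p0) -mulrA; nra.
by rewrite /stein_sol' ler_norml; apply/andP; split; lra.
Qed.

Lemma stein_sol_lipschitz w t : `|stein_sol (w + t) - stein_sol w| <= `|t|.
Proof.
wlog t0 : w t / 0 <= t => [wl|].
  have [t0|/ltW t0] := leP 0 t; first exact: wl.
  by have := wl (w + t) (- t); rewrite oppr_ge0 addrK distrC normrN; exact.
have wt : w <= w + t by rewrite lerDl.
rewrite (ger0_norm t0) ler_norml; apply/andP; split.
  have : stein_sol w + w <= stein_sol (w + t) + (w + t); last by lra.
  apply: (@ge0_derive_le _ (fun x => stein_sol x + x) (fun x => stein_sol' x + 1)) => // x _.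
    by have d := is_derive_stein_sol x; apply: is_derive_eq.
  by rewrite -lerBlDr sub0r lerNnormlW// stein_sol'_bound.
have : w - stein_sol w <= (w + t) - stein_sol (w + t); last by lra.
apply: (@ge0_derive_le _ (fun x => x - stein_sol x) (fun x => 1 - stein_sol' x)) => // x _.
  by have d := is_derive_stein_sol x; apply: is_derive_eq.
by rewrite subr_ge0 ler_normlW// stein_sol'_bound.
Qed.

(** Product rule for the differences of [w * stein_sol w]. The factor growing with [w] is paid later
    by the second moment of the standardized variable. *)
Lemma stein_sol'_diff w t :
  `|stein_sol' (w + t) - stein_sol' w| <=
  (`|w| + 3 / 2) * `|t| + `|h (w + t) - h w|.
Proof.
have -> : stein_sol' (w + t) - stein_sol' w =
    (w * (stein_sol (w + t) - stein_sol w) + t * stein_sol (w + t)) +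
    (h (w + t) - h w) by rewrite /stein_sol'; ring.
rewrite (le_trans (ler_normD _ _))// lerD2r (le_trans (ler_normD _ _))//.
rewrite mulrDl (normrM w) (normrM t) lerD//.
  by rewrite ler_wpM2l// stein_sol_lipschitz.
by rewrite [leLHS]mulrC ler_wpM2r// stein_sol_bound.
Qed.

End stein_solution.

Lemma stein_taylor (R : realType) (z al A w d : R) : 0 < al -> `|d| <= A ->
  `|stein_sol (ramp z al) (w + d) - stein_sol (ramp z al) w -
    d * stein_sol' (ramp z al) w| <=
  (`|w| + 3 / 2 + al^-1 * (z - A < w <= z + al + A)%R%:R) * d ^+ 2 / 2.
Proof.
move=> al0 dA.
have ch := @continuous_ramp R z al; have h01 := @ramp01 R z al.
apply: taylor1_le; first exact: is_derive_stein_sol.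
move=> t td; rewrite [leRHS]mulrDl (le_trans (stein_sol'_diff _ _ _ _))//.
by rewrite lerD2l ramp_diff// (le_trans td).
Qed.

(** * Bounded random variables *)

Section bounded_random_variables.
Context d (T : measurableType d) (R : realType).
Implicit Types f g : T -> R.

(** Everything averaged below is bounded, and this class is closed under the operations used and
    integrable for every probability, which settles all integrability conditions uniformly. *)
Definition bmf f := measurable_fun setT f /\ exists M, forall x, `|f x| <= M.

Lemma bmf_cst (c : R) : bmf (fun=> c).
Proof. by split; [exact: measurable_cst | exists `|c|]. Qed.

Lemma bmfD f g : bmf f -> bmf g -> bmf (fun x => f x + g x).
Proof.
move=> [mf [M fM]] [mg [N gN]]; split; first exact: measurable_funD.
by exists (M + N) => x; rewrite (le_trans (ler_normD _ _))// lerD.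
Qed.

Lemma bmfN f : bmf f -> bmf (fun x => - f x).
Proof.
move=> [mf [M fM]]; split; first exact: measurable_funN.
by exists M => x; rewrite normrN.
Qed.

Lemma bmfB f g : bmf f -> bmf g -> bmf (fun x => f x - g x).
Proof. by move=> bf bg; apply: bmfD => //; exact: bmfN. Qed.

Lemma bmfM f g : bmf f -> bmf g -> bmf (fun x => f x * g x).
Proof.
move=> [mf [M fM]] [mg [N gN]]; split; first exact: measurable_funM.
by exists (M * N) => x; rewrite normrM ler_pM.
Qed.

Lemma bmfX f n : bmf f -> bmf (fun x => f x ^+ n).
Proof.
move=> bf; elim: n => [|n ih].
  by under eq_fun do rewrite expr0; exact: bmf_cst.
by under eq_fun do rewrite exprS; exact: bmfM.
Qed.

Lemma bmf_norm f : bmf f -> bmf (fun x => `|f x|).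
Proof.
move=> [mf [M fM]]; split; first exact: measurableT_comp.
by exists M => x; rewrite normr_id.
Qed.

Lemma bmf_sum (I : Type) (s : seq I) (Q : pred I) (F : I -> T -> R) :
  (forall i, bmf (F i)) -> bmf (fun x => \sum_(i <- s | Q i) F i x).
Proof.
move=> bF; elim: s => [|i s ih].
  by under eq_fun do rewrite big_nil; exact: bmf_cst.
under eq_fun do rewrite big_cons; by case: (Q i) => //; exact: bmfD.
Qed.

Lemma bmf_indic (A : set T) : measurable A -> bmf (\1_A : T -> R).
Proof.
move=> mA; split; first exact: measurable_indic.
by exists 1 => x; rewrite indicE normr_nat; case: (_ \in _).
Qed.

Lemma bmf_comp d' (T' : measurableType d') (f : T' -> R) (g : T -> T') :
  measurable_fun setT g -> measurable_fun setT f ->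
  (exists M : R, forall x, `|f x| <= M) -> bmf (f \o g).
Proof.
move=> mg mf [M fM]; split; first exact: measurableT_comp.
by exists M => x; exact: fM.
Qed.

Variable P : probability T R.

Lemma bmf_integrable f : bmf f -> P.-integrable setT (EFin \o f).
Proof.
move=> [mf [M fM]]; apply: measurable_bounded_integrable => //.
  by apply: (le_lt_trans (probability_le1 P measurableT)); exact: ltry.
exists M; split; first exact: num_real.
by move=> y My x _; rewrite /= (le_trans (fM x))// ltW.
Qed.

Lemma meanE f : mean P f = (\int[P]_x f x)%R.
Proof. by rewrite /mean unlock. Qed.

Lemma EFin_mean f : bmf f -> (mean P f)%:E = (\int[P]_x (f x)%:E)%E.
Proof.
move=> bf; rewrite meanE /Rintegral fineK//.
by apply: integrable_fin_num => //; exact: bmf_integrable.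
Qed.

Lemma eq_mean f g : f =1 g -> mean P f = mean P g.
Proof. by move=> fg; congr (mean P _); apply/funext. Qed.

Lemma mean_cst (c : R) : mean P (fun=> c) = c.
Proof. by rewrite /mean expectation_cst. Qed.

Lemma meanD f g : bmf f -> bmf g ->
  mean P (fun x => f x + g x) = mean P f + mean P g.
Proof. by move=> /bmf_integrable ? /bmf_integrable ?; rewrite !meanE RintegralD. Qed.

Lemma meanB f g : bmf f -> bmf g ->
  mean P (fun x => f x - g x) = mean P f - mean P g.
Proof. by move=> /bmf_integrable ? /bmf_integrable ?; rewrite !meanE RintegralB. Qed.

Lemma meanZl (c : R) f : bmf f -> mean P (fun x => c * f x) = c * mean P f.
Proof. by move=> /bmf_integrable ?; rewrite !meanE RintegralZl. Qed.

Lemma meanZr f (c : R) : bmf f -> mean P (fun x => f x * c) = mean P f * c.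
Proof. by move=> /bmf_integrable ?; rewrite !meanE RintegralZr. Qed.

Lemma le_mean f g : bmf f -> bmf g -> (forall x, f x <= g x) ->
  mean P f <= mean P g.
Proof.
by move=> /bmf_integrable ? /bmf_integrable ? fg; rewrite !meanE le_Rintegral.
Qed.

Lemma mean_ge0 f : (forall x, 0 <= f x) -> 0 <= mean P f.
Proof. by move=> f0; rewrite meanE; exact: Rintegral_ge0. Qed.

Lemma le_mean_norm f : bmf f -> `|mean P f| <= mean P (fun x => `|f x|).
Proof. by move=> /bmf_integrable ?; rewrite !meanE le_normr_Rintegral. Qed.

Lemma mean_sum (I : Type) (s : seq I) (F : I -> T -> R) :
  (forall i, bmf (F i)) ->
  mean P (fun x => \sum_(i <- s) F i x) = \sum_(i <- s) mean P (F i).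
Proof.
move=> bF; elim: s => [|i s ih].
  by rewrite big_nil; under eq_fun do rewrite big_nil; exact: mean_cst.
rewrite big_cons; under eq_fun do rewrite big_cons.
by rewrite meanD// ?ih//; exact: bmf_sum.
Qed.

Lemma mean_indic (A : set T) : measurable A -> mean P \1_A = fine (P A).
Proof. by move=> mA; rewrite /mean expectation_indic. Qed.

Lemma mean_sq_ge f : bmf f -> mean P f ^+ 2 <= mean P (fun x => f x ^+ 2).
Proof.
move=> bf; set m := mean P f.
have b2 : bmf (fun x => f x ^+ 2) by exact: bmfX.
have bm : bmf (fun x => 2 * m * f x) by apply: bmfM => //; exact: bmf_cst.
have bm2 : bmf (fun=> m ^+ 2 : R) by exact: bmf_cst.
have bmm : bmf (fun x => 2 * m * f x - m ^+ 2) by exact: bmfB.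
rewrite -subr_ge0.
have -> : mean P (fun x => f x ^+ 2) - m ^+ 2 = mean P (fun x => (f x - m) ^+ 2).
  transitivity (mean P (fun x => f x ^+ 2 - (2 * m * f x - m ^+ 2))).
    by rewrite meanB// meanB// meanZl// mean_cst -/m; ring.
  by apply: eq_mean => x; ring.
by apply: mean_ge0 => x; exact: sqr_ge0.
Qed.

Lemma mean_norm_le f (c : R) : bmf f -> 0 <= c ->
  mean P (fun x => f x ^+ 2) <= c ^+ 2 -> mean P (fun x => `|f x|) <= c.
Proof.
move=> bf c0 fc.
suff : mean P (fun x => `|f x|) ^+ 2 <= c ^+ 2.
  by rewrite ler_sqr// nnegrE; exact: mean_ge0.
apply: le_trans (mean_sq_ge (bmf_norm bf)) _; apply: le_trans fc.
by rewrite le_eqVlt; apply/orP; left; apply/eqP; apply: eq_mean => x;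
  rewrite real_normK ?num_real.
Qed.

Lemma std_dev_sq f : bmf f ->
  std_dev P f ^+ 2 = mean P (fun x => (f x - mean P f) ^+ 2).
Proof.
move=> bf; have V0 : 0 <= fine ('V_P[f])%E by rewrite fine_ge0// variance_ge0.
rewrite /std_dev sqr_sqrtr// /variance unlock /mean; by congr (fine 'E_P[_])%E.
Qed.

Lemma std_dev_ge0 f : 0 <= std_dev P f.
Proof. exact: sqrtr_ge0. Qed.

End bounded_random_variables.

Ltac bmf_tac := repeat first
  [ assumption | exact: bmf_cst | apply: bmfB | apply: bmfD | apply: bmfN
  | apply: bmfM | apply: bmfX | apply: bmf_norm | apply: bmf_sum => ? ].

(** * Kolmogorov bound for bounded Stein couplings *)

Lemma ncdf_increment (R : realType) (a b : R) : a <= b ->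
  0 <= ncdf b - ncdf a <= (b - a) / 2.
Proof.
move=> ab; apply/andP; split.
  rewrite subr_ge0; apply: (ge0_derive_le (f' := normal_pdf 0 1)) ab => x _.
    exact: is_derive_ncdf.
  exact: normal_pdf_ge0.
suff : b / 2 - ncdf b >= a / 2 - ncdf a by lra.
apply: (ge0_derive_le (f := fun x => x / 2 - ncdf x)
  (f' := fun x => 2^-1 - normal_pdf 0 1 x)) ab => x _.
  have d := is_derive_ncdf x.
  by apply: is_derive_eq; rewrite /GRing.scale/=; ring.
by have := pdf_le_half x; lra.
Qed.

Section kolmogorov.
Context d (T : measurableType d) (R : realType) (P : probability T R).
Variable X : T -> R.
Hypothesis mX : measurable_fun setT X.

Lemma measurable_standardized_le t :
  measurable [set w | (X w - mean P X) / std_dev P X <= t].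
Proof.
have mW : measurable_fun setT (fun w => (X w - mean P X) / std_dev P X).
  apply: measurable_funM; last exact: measurable_cst.
  by apply: measurable_funB => //; exact: measurable_cst.
rewrite (_ : [set w | _] =
  (fun w => (X w - mean P X) / std_dev P X) @^-1` `]-oo, t]).
  by rewrite -[X in measurable X]setTI; exact: mW.
by apply/seteqP; split => w /=; rewrite in_itv.
Qed.

Lemma kolmogorov_dist_ub t :
  `|fine (P [set w | (X w - mean P X) / std_dev P X <= t]) - ncdf t| <=
  kolmogorov_dist P X.
Proof.
apply: ub_le_sup; last by exists t.
exists 2 => _ [s _ <-]; rewrite (le_trans (ler_normB _ _))// -[2]/(1 + 1) lerD//.
  rewrite ger0_norm ?fine_ge0// -lee_fin fineK ?fin_num_measure//.
    by apply: probability_le1; exact: measurable_standardized_le.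
  exact: measurable_standardized_le.
by rewrite ger0_norm ?ncdf_ge0 ?ncdf_le1.
Qed.

Lemma kolmogorov_dist_le (B : R) :
  (forall t, `|fine (P [set w | (X w - mean P X) / std_dev P X <= t]) - ncdf t|
    <= B) ->
  kolmogorov_dist P X <= B.
Proof.
move=> XB; apply: ge_sup => [|_ [t _ <-]]; last exact: XB.
by eexists; exists 0.
Qed.

End kolmogorov.

(* The pairs [(V' i, G i)] form a Stein coupling of [V], by [covE]; [S] is a
   version of the conditional expectation of [\sum_i G i * (V - V' i)], by
   [condE]. The weights are only controlled by [Gle] and [EG], not constant. *)
Section stein_bound.
Context d (T : measurableType d) (R : realType) (P : probability T R) (n : nat).
Variables (V : T -> R) (G V' : 'I_n -> T -> R) (S : T -> R) (B tau : R).
Local Notation mu := (mean P V).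
Local Notation sigma := (std_dev P V).
Hypotheses (bV : bmf V) (bG : forall i, bmf (G i)) (bV' : forall i, bmf (V' i)).
Hypothesis bS : bmf S.
Hypothesis G0 : forall i x, 0 <= G i x.
Hypothesis Gle : forall x, \sum_i G i x <= 2 * mu.
Hypothesis EG : mean P (fun x => \sum_i G i x) <= mu.
Hypothesis VB : forall i x, `|V' i x - V x| <= B.
Hypothesis covE : forall f : R -> R, measurable_fun setT f ->
  (exists M : R, forall x, `|f x| <= M) ->
  mean P (fun x => (V x - mu) * f (V x)) =
  mean P (fun x => \sum_i G i x * (f (V x) - f (V' i x))).
Hypothesis condE : forall g : R -> R, measurable_fun setT g ->
  (exists M : R, forall x, `|g x| <= M) ->
  mean P (fun x => \sum_i G i x * (V x - V' i x) * g (V x)) =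
  mean P (fun x => S x * g (V x)).
Hypothesis tau0 : 0 <= tau.
Hypothesis varS : mean P (fun x => (S x - sigma ^+ 2) ^+ 2) <= tau ^+ 2.
Hypothesis sigma0 : 0 < sigma.
Hypothesis sigmaB : sigma ^+ 2 <= mu * B.

Let W x := (V x - mu) / sigma.
Let D := kolmogorov_dist P V.
Let M := tau / sigma ^+ 2.
Let K := mu * B ^+ 2 / sigma ^+ 3.
Let A := B / sigma.

Let bW : bmf W.
Proof. by rewrite /W; bmf_tac. Qed.

Let sN0 : sigma != 0. Proof. by rewrite gt_eqF. Qed.

Let EW2 : mean P (fun x => W x ^+ 2) = 1.
Proof.
transitivity (mean P (fun x => (V x - mu) ^+ 2 * (sigma ^- 2))).
  by apply: eq_mean => x; rewrite /W exprMn exprVn.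
rewrite meanZr -?std_dev_sq ?divff ?expf_neq0//; bmf_tac.
Qed.

Let mW_le t : measurable [set w | W w <= t].
Proof. exact: (measurable_standardized_le P bV.1). Qed.

Let B0 : 0 <= B.
Proof.
have mu0 : 0 <= mu.
  apply: le_trans EG; apply: mean_ge0 => x; exact: sumr_ge0.
have p := lt_le_trans (exprn_gt0 2 sigma0) sigmaB.
by rewrite leNgt; apply/negP => b0; nra.
Qed.

Let mu0 : 0 < mu.
Proof.
have p := lt_le_trans (exprn_gt0 2 sigma0) sigmaB; have b0 := B0.
by rewrite ltNge; apply/negP => m0; nra.
Qed.

Let A0 : 0 <= A. Proof. by rewrite divr_ge0// ltW. Qed.

(** As the variance is at most [mu * B], the standardized increment is absorbed into [K], and only
    the error scales [M] and [K] remain. *)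
Let A_le_K : A <= K.
Proof.
rewrite /A /K -subr_ge0.
have -> : mu * B ^+ 2 / sigma ^+ 3 - B / sigma =
    B / sigma ^+ 3 * (mu * B - sigma ^+ 2) by field.
by rewrite mulr_ge0 ?subr_ge0// divr_ge0// exprn_ge0// ltW.
Qed.

(** The normal probability of the interval costs half its length, and each endpoint costs one [D].
    This is how [D] enters its own bound. *)
Let itv_prob a b : a <= b ->
  mean P (fun x => (a < W x <= b)%R%:R) <= 2 * D + (b - a) / 2.
Proof.
move=> ab.
have -> : mean P (fun x => (a < W x <= b)%R%:R) =
    fine (P [set w | W w <= b]) - fine (P [set w | W w <= a]).
  rewrite -!mean_indic// -meanB; [|exact: bmf_indic..].
  apply: eq_mean => x; rewrite !indicE.
  have memE t : (x \in [set w | W w <= t]) = (W x <= t).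
    by apply/idP/idP; rewrite inE.
  rewrite !memE ltNge; have [xa/=|xa/=] := leP (W x) a; last by rewrite subr0.
  by rewrite (le_trans xa ab) subrr.
have := kolmogorov_dist_ub P bV.1 b; have := kolmogorov_dist_ub P bV.1 a.
rewrite -/D -/W !ler_norml => /andP[a1 a2] /andP[b1 b2].
by have /andP[] := ncdf_increment ab; lra.
Qed.

Section fixed_ramp.
Variables (z al : R).
Hypothesis al0 : 0 < al.
Let h := ramp z al.
Let f := stein_sol h.
Let f' := stein_sol' h.
Let ch : continuous h := @continuous_ramp R z al.
Let h01 : forall x, 0 <= h x <= 1 := @ramp01 R z al.

Let mf : measurable_fun setT f.
Proof.
apply: continuous_measurable_fun => x.
have [d1 _] := is_derive_stein_sol ch h01 x.
by apply: differentiable_continuous; apply/derivable1_diffP.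
Qed.

Let mh : measurable_fun setT h.
Proof. exact: continuous_measurable_fun. Qed.

Let mf' : measurable_fun setT f'.
Proof.
apply: measurable_funB; last exact: measurable_cst.
by apply: measurable_funD => //; apply: measurable_funM.
Qed.

Let bhW : bmf (fun x => h (W x)).
Proof.
apply: (bmf_comp bW.1 mh); exists 1 => x.
by have /andP[? ?] := h01 x; rewrite ger0_norm.
Qed.

Let Waff : measurable_fun setT (fun v : R => (v - mu) / sigma).
Proof.
apply: measurable_funM; last exact: measurable_cst.
by apply: measurable_funB; [exact: measurable_id | exact: measurable_cst].
Qed.

Let ItvW x : R := (z - A < W x <= z + al + A)%R%:R.

Let bItvW : bmf ItvW.
Proof.
have -> : ItvW = \1_(W @^-1` `]z - A, z + al + A]%classic).
  apply/funext => x; rewrite indicE /ItvW; congr (nat_of_bool _)%:R.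
  by apply/idP/idP; rewrite inE/= in_itv.
apply: bmf_indic; rewrite -[X in measurable X]setTI.
by have [mW _] := bW; exact: mW.
Qed.

(* The term [(\sum_i G i x) * `|W x|] is split by AM-GM, with the ratio [3 / 2]
   chosen so that its mean is at most [17 / 12 * mu]. *)
Lemma stein_remainder x :
  \sum_i G i x * `|f ((V' i x - mu) / sigma) - f (W x) -
     ((V' i x - V x) / sigma) * f' (W x)| <=
  A ^+ 2 / 2 * ((2 / 3 + 3 / 2) * (\sum_i G i x) + 3 / 4 * mu * W x ^+ 2
    + 2 * mu * al^-1 * ItvW x).
Proof.
pose C := (`|W x| + 3 / 2 + al^-1 * ItvW x) * A ^+ 2 / 2.
apply: (@le_trans _ _ (\sum_i G i x * C)).
  apply: ler_sum => i _; rewrite ler_wpM2l//.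
  have -> : (V' i x - mu) / sigma = W x + (V' i x - V x) / sigma.
    by rewrite /W; field.
  have dA : `|(V' i x - V x) / sigma| <= A.
    by rewrite normrM (gtr0_norm (_ : 0 < _^-1)) ?invr_gt0// ler_pM2r ?invr_gt0.
  rewrite (le_trans (stein_taylor z (W x) al0 dA))//.
  rewrite ler_pM2r ?invr_gt0// ler_wpM2l//.
    by rewrite !addr_ge0// ?divr_ge0// mulr_ge0// invr_ge0 ltW.
  by rewrite -(real_normK (num_real ((V' i x - V x) / sigma))) ler_sqr ?nnegrE.
rewrite -mulr_suml; have := Gle x.
have : 0 <= \sum_i G i x by rewrite sumr_ge0.
move: (\sum_i G i x) => g g0 gmu.
have gW : g * `|W x| <= 2 / 3 * g + 3 / 4 * mu * W x ^+ 2.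
  rewrite -(real_normK (num_real (W x))).
  move: `|W x| => w.
  have : 0 <= (g - 3 / 2 * mu * w) ^+ 2 by exact: sqr_ge0.
  move=> sq; rewrite -(ler_pM2l mu0); nra.
have gI : g * (al^-1 * ItvW x) <= 2 * mu * al^-1 * ItvW x.
  rewrite -!mulrA mulrA ler_wpM2r//.
  by rewrite mulr_ge0// invr_ge0 ltW.
have -> : g * C = A ^+ 2 / 2 * (g * `|W x| + 3 / 2 * g + g * (al^-1 * ItvW x)).
  by rewrite /C; field; rewrite gt_eqF.
rewrite ler_wpM2l ?divr_ge0 ?sqr_ge0//.
lra.
Qed.

Let bf'W : bmf (fun x => f' (W x)).
Proof.
by apply: (bmf_comp bW.1 mf'); exists 1 => x; exact: stein_sol'_bound.
Qed.

Let F v := f ((v - mu) / sigma).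

Let mF : measurable_fun setT F.
Proof. exact: (measurableT_comp mf Waff). Qed.

Let F_le : exists M : R, forall x, `|F x| <= M.
Proof. by exists (3 / 2) => x; exact: stein_sol_bound. Qed.

Let bFV (X : T -> R) : bmf X -> bmf (fun x => F (X x)).
Proof. by move=> [mX _]; exact: (bmf_comp mX mF F_le). Qed.

Let r i x := F (V' i x) - F (V x) - ((V' i x - V x) / sigma) * f' (W x).

Let br i : bmf (r i).
Proof. by apply: bmfB; [apply: bmfB; exact: bFV | bmf_tac]. Qed.

(** The coupling identity is expanded to first order; in the linear part [condE] replaces the
    increments by [S], and [r] collects the Taylor remainders. *)
Let mean_Wf : mean P (fun x => W x * f (W x)) =
  mean P (fun x => S x * f' (W x)) / sigma ^+ 2 -
  mean P (fun x => \sum_i G i x * r i x) / sigma.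
Proof.
have bFV0 := bFV bV.
have -> : mean P (fun x => W x * f (W x)) =
    mean P (fun x => (V x - mu) * F (V x)) / sigma.
  rewrite -meanZr; last by bmf_tac.
  by apply: eq_mean => x; rewrite /F -/(W x) [in LHS]/W mulrAC.
rewrite (covE mF F_le).
have mf'aff : measurable_fun setT (fun v : R => f' ((v - mu) / sigma)).
  exact: (measurableT_comp mf' Waff).
rewrite -(condE mf'aff); last by exists 1 => x; exact: stein_sol'_bound.
have bGf' : bmf (fun x => \sum_i G i x * (V x - V' i x) * f' (W x)).
  by bmf_tac.
have bGr : bmf (fun x => \sum_i G i x * r i x).
  by apply: bmf_sum => i; exact: bmfM.
have -> : mean P (fun x => \sum_i G i x * (F (V x) - F (V' i x))) =
    mean P (fun x => (\sum_i G i x * (V x - V' i x) * f' (W x)) / sigma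
      - \sum_i G i x * r i x).
  apply: eq_mean => x; rewrite mulr_suml -sumrB; apply: eq_bigr => i _.
  by rewrite /r; field.
rewrite meanB//; last by apply: bmfM => //; exact: bmf_cst.
by rewrite meanZr//; field.
Qed.

(** The mean of the pointwise bound: 35 / 12 is 17 / 12 + 3 / 2, and the last term is [itv_prob] on
    the window of length [al + 2 * A]. *)
Let mean_Gr : `|mean P (fun x => \sum_i G i x * r i x)| <=
  A ^+ 2 / 2 * (35 / 12 * mu + 2 * mu / al * (2 * D + al / 2 + A)).
Proof.
have bGr : bmf (fun x => \sum_i G i x * r i x).
  by apply: bmf_sum => i; exact: bmfM.
have bsG : bmf (fun x => \sum_i G i x) by bmf_tac.
apply: (le_trans (le_mean_norm P bGr)).
pose bnd x := A ^+ 2 / 2 * ((2 / 3 + 3 / 2) * (\sum_i G i x) +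
  3 / 4 * mu * W x ^+ 2 + 2 * mu * al^-1 * ItvW x).
have bbnd : bmf bnd by rewrite /bnd; bmf_tac.
apply: (@le_trans _ _ (mean P bnd)).
  apply: le_mean => //; first exact: bmf_norm.
  move=> x; apply: le_trans (stein_remainder x).
  apply: (le_trans (ler_norm_sum _ _ _)); apply: ler_sum => i _.
  by rewrite normrM ger0_norm.
have -> : mean P bnd = A ^+ 2 / 2 * ((2 / 3 + 3 / 2) *
    mean P (fun x => \sum_i G i x) + 3 / 4 * mu + 2 * mu * al^-1 * mean P ItvW).
  rewrite meanZl; last by bmf_tac.
  rewrite meanD; [|by bmf_tac..]; rewrite meanD; [|by bmf_tac..].
  by rewrite !meanZl ?EW2 ?mulr1//; bmf_tac.
rewrite ler_wpM2l ?divr_ge0 ?sqr_ge0//.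
have zz : z - A <= z + al + A.
  by rewrite lerBlDr -!addrA lerDl !addr_ge0// ltW.
have := itv_prob zz; rewrite -/ItvW => pI.
have mual : 0 <= 2 * mu * al^-1 by rewrite !mulr_ge0 ?invr_ge0// ltW.
have := ler_wpM2l mual pI.
have -> : 2 * D + (z + al + A - (z - A)) / 2 = 2 * D + al / 2 + A by field.
move: (2 * mu * al^-1 * _) (2 * mu * al^-1 * _) EG => a b g; lra.
Qed.

(** By Stein's equation the left side is the mean of [f' (W x) - W x * f (W x)], which splits into
    the fluctuation of [S] about the variance, costing [M] because [f'] is at most 1 in absolute
    value, and the Taylor remainder. *)
Lemma stein_ramp :
  `|mean P (fun x => h (W x)) - nexp h| <= M + 2 * K + K / al * (2 * D + K).
Proof.
have bFV0 := bFV bV.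
have bfW : bmf (fun x => f (W x)) := bFV0.
have -> : mean P (fun x => h (W x)) - nexp h =
    mean P (fun x => f' (W x) * (sigma ^+ 2 - S x)) / sigma ^+ 2 +
    mean P (fun x => \sum_i G i x * r i x) / sigma.
  have -> : mean P (fun x => h (W x)) =
      mean P (fun x => f' (W x) - W x * f (W x) + nexp h).
    by apply: eq_mean => x; rewrite /f' /stein_sol' -/f; ring.
  have -> : mean P (fun x => f' (W x) * (sigma ^+ 2 - S x)) =
      mean P (fun x => f' (W x) * sigma ^+ 2 - S x * f' (W x)).
    by apply: eq_mean => x; ring.
  rewrite meanD; [|by bmf_tac..]; rewrite mean_cst.
  rewrite [in LHS]meanB; [|by bmf_tac..]; rewrite [in RHS]meanB; [|by bmf_tac..].
  rewrite meanZr// mean_Wf.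
  by field.
apply: (le_trans (ler_normD _ _)).
have -> : M + 2 * K + K / al * (2 * D + K) =
  M + (2 * K + K / al * (2 * D + K)) by ring.
apply: lerD.
  rewrite normrM [in leLHS](ger0_norm (_ : 0 <= (_ ^+ 2)^-1)); last first.
    by rewrite invr_ge0 sqr_ge0.
  rewrite /M ler_pM2r ?invr_gt0 ?exprn_gt0//.
  apply: (le_trans (le_mean_norm P _)); first by bmf_tac.
  apply: (@le_trans _ _ (mean P (fun x => `|S x - sigma ^+ 2|))).
    apply: le_mean; [by bmf_tac..|] => x.
    by rewrite normrM (distrC (sigma ^+ 2)) ler_piMl// stein_sol'_bound.
  by apply: mean_norm_le => //; bmf_tac.
rewrite normrM (gtr0_norm (_ : 0 < sigma^-1)) ?invr_gt0//.
rewrite -[leRHS](mulfK sN0) ler_pM2r ?invr_gt0//.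
apply: (le_trans mean_Gr).
have -> : (2 * K + K / al * (2 * D + K)) * sigma =
    A ^+ 2 / 2 * (4 * mu + 2 * mu / al * (2 * D + K)).
  by rewrite /K /A; field; rewrite sN0 gt_eqF.
rewrite ler_wpM2l ?divr_ge0 ?sqr_ge0//.
(* The part [al / 2] of the window contributes one more [mu], and 35 / 12 + 1 is below 4, whence the
   coefficient 2 of [K]. *)
have -> : 2 * mu / al * (2 * D + al / 2 + A) = 2 * mu / al * (2 * D + A) + mu.
  by field; rewrite gt_eqF.
have : 2 * mu / al * (2 * D + A) <= 2 * mu / al * (2 * D + K).
  by rewrite ler_wpM2l ?lerD2l// divr_ge0 ?mulr_ge0// ltW.
move: (2 * mu / al * _) (2 * mu / al * _) mu0 => a b m; lra.
Qed.

End fixed_ramp.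

(* Smoothing the indicators of half-lines at scale [2 * K * (1 + y)] bounds [D]
   by a multiple of itself plus error terms. *)
Lemma kolmogorov_dist_stein (y : R) : 0 < y ->
  D * y <= K * y ^+ 2 / 2 + (M + 3 * K) * (y + 1).
Proof.
move=> y0.
have K0 : 0 < K.
  rewrite /K divr_gt0 ?exprn_gt0// mulr_gt0// exprn_gt0//.
  have p := lt_le_trans (exprn_gt0 2 sigma0) sigmaB.
  by move: p; rewrite pmulr_rgt0.
pose al := 2 * K * (1 + y).
have y1 : 0 < 1 + y by rewrite addr_gt0.
have al0 : 0 < al by rewrite mulr_gt0// mulr_gt0.
pose err := M + 2 * K + K / al * (2 * D + K).
have W_le (t : R) : fine (P [set w | W w <= t]) = mean P \1_[set w | W w <= t].
  by rewrite mean_indic.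
have memE (x : T) (t : R) : \1_[set w | W w <= t] x = (W x <= t)%R%:R :> R.
  by rewrite indicE; congr (nat_of_bool _)%:R; apply/idP/idP; rewrite inE.
have bh z : bmf (fun x => ramp z al (W x)).
  apply: (bmf_comp bW.1 (continuous_measurable_fun (@continuous_ramp R z al))).
  by exists 1 => x; have /andP[? ?] := ramp01 z al x; rewrite ger0_norm.
have DE : D <= al / 4 + err.
  (* The indicator of the half-line up to [t] lies between the ramp that ends at [t] and the ramp
     that starts at [t]. *)
  apply: kolmogorov_dist_le => t; rewrite -/W W_le ler_norml.
  apply/andP; split.
    have := stein_ramp (t - al) al0; rewrite -/err ler_norml => /andP[e1 _].
    have /andP[+ _] := nexp_ramp (t - al) al0; rewrite subrK => e2.
    have : mean P (fun x => ramp (t - al) al (W x)) <= mean P \1_[set w | W w <= t].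
      apply: le_mean => //; first exact: bmf_indic.
      move=> x; rewrite memE; have [xt|xt] := leP (W x) t.
        by have /andP[] := ramp01 (t - al) al (W x).
      by rewrite ramp0// subrK ltW.
    by lra.
  have := stein_ramp t al0; rewrite -/err ler_norml => /andP[_ e1].
  have /andP[_ e2] := nexp_ramp t al0.
  have : mean P \1_[set w | W w <= t] <= mean P (fun x => ramp t al (W x)).
    apply: le_mean => //; first exact: bmf_indic.
    move=> x; rewrite memE; have [xt|xt] := leP (W x) t; first by rewrite ramp1.
    by have /andP[] := ramp01 t al (W x).
  by lra.
(* With this [al] the error contains [D] with coefficient [2 * K / al = (1 + y)^-1], so that
   clearing denominators leaves [2 * D * y] on the left. *)
have : D * (2 * (1 + y)) <= (al / 4 + err) * (2 * (1 + y)).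
  by rewrite ler_pM2r// mulr_gt0.
have -> : (al / 4 + err) * (2 * (1 + y)) =
    K * (1 + y) ^+ 2 + (M + 2 * K) * (2 * (1 + y)) + (2 * D + K).
  by rewrite /err /al; field; rewrite !gt_eqF.
by lra.
Qed.

End stein_bound.

(** * Fubini's theorem for bounded functions *)

Section bounded_fubini.
Context d1 d2 (T1 : measurableType d1) (T2 : measurableType d2) (R : realType).
Variables (P1 : probability T1 R) (P2 : probability T2 R).
Implicit Type F : T1 * T2 -> R.

Definition prod_prob : probability (T1 * T2)%type R := (P1 \x P2)%E.

Lemma bmf_pair1 F x : bmf F -> bmf (fun y => F (x, y)).
Proof.
by move=> [mF FM]; apply: (bmf_comp _ mF FM); exact: measurable_pair1.
Qed.

Lemma bmf_pair2 F y : bmf F -> bmf (fun x => F (x, y)).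
Proof.
by move=> [mF FM]; apply: (bmf_comp _ mF FM); exact: measurable_pair2.
Qed.

Let integrableF F : bmf F -> (P1 \x P2)%E.-integrable setT (EFin \o F).
Proof. exact: (@bmf_integrable _ _ _ prod_prob). Qed.

Lemma bmf_mean_snd F : bmf F -> bmf (fun x => mean P2 (fun y => F (x, y))).
Proof.
move=> bF; split.
  apply/measurable_EFinP.
  apply: eq_measurable_fun (measurable_fubini_F (integrableF bF)) => x _ /=.
  by rewrite EFin_mean//; exact: bmf_pair1.
have [_ [M FM]] := bF; exists M => x.
rewrite (le_trans (le_mean_norm _ (bmf_pair1 x bF)))//.
rewrite -[leRHS](mean_cst P2); apply: le_mean => //.
  by apply: bmf_norm; exact: bmf_pair1.
exact: bmf_cst.
Qed.

Lemma mean_prod12 F : bmf F ->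
  mean prod_prob F = mean P1 (fun x => mean P2 (fun y => F (x, y))).
Proof.
move=> bF; apply: EFin_inj; rewrite !EFin_mean//; last exact: bmf_mean_snd.
rewrite -(integral12_prod_meas1 (integrableF bF)).
by apply: eq_integral => x _; rewrite EFin_mean//; exact: bmf_pair1.
Qed.

End bounded_fubini.

Lemma bmf_mean_fst d1 d2 (T1 : measurableType d1) (T2 : measurableType d2)
    (R : realType) (P1 : probability T1 R) (P2 : probability T2 R)
    (F : T1 * T2 -> R) :
  bmf F -> bmf (fun y => mean P1 (fun x => F (x, y))).
Proof.
move=> [mF [M FM]].
have := @bmf_mean_snd _ _ _ _ R P2 P1 (fun z : T2 * T1 => F (z.2, z.1)).
apply; apply: (@bmf_comp _ _ _ _ _ F (fun z : T2 * T1 => (z.2, z.1))) => //.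
  exact: measurable_swap.
by exists M.
Qed.

Lemma bounded_fubini d1 d2 (T1 : measurableType d1) (T2 : measurableType d2)
    (R : realType) (P1 : probability T1 R) (P2 : probability T2 R)
    (F : T1 * T2 -> R) : bmf F ->
  mean P1 (fun x => mean P2 (fun y => F (x, y))) =
  mean P2 (fun y => mean P1 (fun x => F (x, y))).
Proof.
move=> bF; have bi := @bmf_integrable _ _ _ (prod_prob P1 P2) _ bF.
apply: EFin_inj; rewrite !EFin_mean; 
  [|exact: (bmf_mean_fst P1 P2)|exact: (bmf_mean_snd P1)].
under eq_integral => x _ do rewrite (EFin_mean P2 (bmf_pair1 x bF)).
under [RHS]eq_integral => y _ do rewrite (EFin_mean P1 (bmf_pair2 y bF)).
exact: (Fubini bi).
Qed.

(** * Resampling one coordinate and the Efron-Stein inequality *)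

Section transfer.
Context d1 d2 (T1 : measurableType d1) (T2 : measurableType d2) (R : realType).
Variables (P1 : probability T1 R) (P2 : probability T2 R) (g : T2 -> T1).
Hypothesis mg : measurable_fun setT g.
Hypothesis meang : forall F : T1 -> R, bmf F -> mean P2 (F \o g) = mean P1 F.
Variable V : T1 -> R.
Hypothesis bV : bmf V.

Let bVg : bmf (V \o g).
Proof. by have [mV VM] := bV; exact: bmf_comp. Qed.

Lemma std_dev_transfer : std_dev P2 (V \o g) = std_dev P1 V.
Proof.
apply/eqP; rewrite -(@eqrXn2 _ 2) ?std_dev_ge0// !std_dev_sq// meang//.
by rewrite -(meang (F := fun x => (V x - mean P1 V) ^+ 2)); bmf_tac.
Qed.

(** Applied twice: to pass from the sample space to the law of the configuration, and to adjoin an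
    extra point to a configuration. *)
Lemma kolmogorov_dist_transfer :
  kolmogorov_dist P2 (V \o g) = kolmogorov_dist P1 V.
Proof.
have pE t : fine (P2 [set w | (V (g w) - mean P2 (V \o g)) /
      std_dev P2 (V \o g) <= t]) =
    fine (P1 [set w | (V w - mean P1 V) / std_dev P1 V <= t]).
  have m1 := measurable_standardized_le P1 bV.1 t.
  have m2 := measurable_standardized_le P2 bVg.1 t.
  rewrite -!mean_indic// -(meang (bmf_indic R m1)); apply: eq_mean => x.
  by rewrite /= !indicE std_dev_transfer meang.
rewrite /kolmogorov_dist; congr sup; apply/seteqP; split => _ [t _ <-].
  by exists t; rewrite ?pE.
by exists t; rewrite ?pE.
Qed.

End transfer.

Section resampling.
Context dX (X : measurableType dX) (R : realType) (n : nat).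
Variables (nu : probability X R) (Pi : probability (n.-tuple X)%type R).
Local Notation conf := (n.-tuple X)%type.
Implicit Types (u : conf) (i j k : 'I_n) (F H : conf -> R).

Definition upd u i (y : X) : conf :=
  [tuple if j == i then y else tnth u j | j < n].

Lemma tnth_upd u i y j : tnth (upd u i y) j = if j == i then y else tnth u j.
Proof. by rewrite tnth_mktuple. Qed.

Lemma upd_upd u i y z : upd (upd u i y) i z = upd u i z.
Proof. by apply: eq_from_tnth => j; rewrite !tnth_upd; case: eqP. Qed.

Lemma updC u i j y z : i != j -> upd (upd u i y) j z = upd (upd u j z) i y.
Proof.
move=> ij; apply: eq_from_tnth => k; rewrite !tnth_upd.
by have [->|//] := eqVneq k j; rewrite eq_sym (negbTE ij).
Qed.

Lemma measurable_upd i :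
  measurable_fun setT (fun z : conf * X => upd z.1 i z.2).
Proof.
apply/measurable_fun_tnthP => j.
rewrite (_ : _ \o _ = fun z : conf * X => if j == i then z.2 else tnth z.1 j).
  have [ji|ji] := eqVneq j i; first exact: measurable_snd.
  apply: (@measurableT_comp _ _ _ _ _ _ (fun u : conf => tnth u j)) => //.
  exact: measurable_tnth.
by apply/funext => z /=; rewrite tnth_upd.
Qed.

Definition resample i F u : R := mean nu (fun y => F (upd u i y)).

(** Functional independence of the [i]-th coordinate, at every configuration; it is not a stochastic
    notion. *)
Definition indep i F := forall u y, F (upd u i y) = F u.

Lemma bmf_upd i F : bmf F -> bmf (fun z : conf * X => F (upd z.1 i z.2)).
Proof. by move=> [mF FM]; exact: (bmf_comp (@measurable_upd i) mF FM). Qed.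

Lemma bmf_upd1 i F u : bmf F -> bmf (fun y => F (upd u i y)).
Proof. by move=> bF; exact: (bmf_pair1 u (bmf_upd i bF)). Qed.

Lemma bmf_resample i F : bmf F -> bmf (resample i F).
Proof. by move=> bF; exact: (bmf_mean_snd Pi nu (bmf_upd i bF)). Qed.

Lemma indep_resample_id i F : indep i F -> resample i F = F.
Proof.
move=> iF; apply/funext => u; rewrite /resample -[RHS](mean_cst nu).
by apply: eq_mean => y; exact: iF.
Qed.

Lemma indep_resample i F : indep i (resample i F).
Proof. by move=> u y; apply: eq_mean => z; rewrite upd_upd. Qed.

Lemma indep_resampleC i j F : indep j F -> indep j (resample i F).
Proof.
have [->|ij] := eqVneq i j; first by move=> _; exact: indep_resample.
by move=> jF u y; apply: eq_mean => z; rewrite updC 1?eq_sym// jF.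
Qed.

Lemma resampleB i F H u : bmf F -> bmf H ->
  resample i (fun u => F u - H u) u = resample i F u - resample i H u.
Proof. by move=> bF bH; apply: meanB; exact: bmf_upd1. Qed.

Lemma resampleM i F H u : bmf F -> indep i H ->
  resample i (fun u => F u * H u) u = resample i F u * H u.
Proof.
move=> bF iH; rewrite /resample -meanZr; last exact: bmf_upd1.
by apply: eq_mean => y; rewrite iH.
Qed.

(** This invariance is the form in which independence of the points enters all that follows, so no
    [n]-fold product measure has to be built. *)
Hypothesis resampleE : forall i F, bmf F -> mean Pi (resample i F) = mean Pi F.

(** Resampling once more turns both sides into the mean of the product of the two averages. *)
Lemma resample_adjoint i F H : bmf F -> bmf H ->
  mean Pi (fun u => resample i F u * H u) =
  mean Pi (fun u => F u * resample i H u).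
Proof.
move=> bF bH.
have bEF := bmf_resample i bF; have bEH := bmf_resample i bH.
rewrite -(resampleE i); last by bmf_tac.
rewrite -[RHS](resampleE i); last by bmf_tac.
apply: eq_mean => u.
rewrite (resampleM u bF (@indep_resample i H)).
rewrite (_ : (fun u => resample i F u * H u) = (fun u => H u * resample i F u)).
  by rewrite (resampleM u bH (@indep_resample i F)) mulrC.
by apply/funext => v; rewrite mulrC.
Qed.

(** The cross term vanishes on resampling: its second factor is free of coordinate [i], and its
    first averages to zero. *)
Lemma resample_pythagoras i F H : bmf F -> bmf H -> indep i H ->
  mean Pi (fun u => (F u - H u) ^+ 2) =
  mean Pi (fun u => (F u - resample i F u) ^+ 2) +
  mean Pi (fun u => (resample i F u - H u) ^+ 2).
Proof.
move=> bF bH iH; have bEF := bmf_resample i bF.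
rewrite -meanD; [|by bmf_tac..].
apply/eqP; rewrite -subr_eq0 -meanB; [|by bmf_tac..]; apply/eqP.
transitivity (mean Pi (fun u => (F u - resample i F u) *
    (2 * (resample i F u - H u)))).
  by apply: eq_mean => u; ring.
rewrite -(resampleE i); last by bmf_tac.
rewrite -[RHS](mean_cst Pi); apply: eq_mean => u.
rewrite (resampleM (F := fun u => F u - resample i F u)); last 2 first.
- by bmf_tac.
- by move=> v y; rewrite (indep_resample i F) iH.
rewrite resampleB// (indep_resample_id (@indep_resample i F)) subrr mul0r.
by [].
Qed.

Lemma indep_all_const F : (forall i, indep i F) -> forall u v, F u = F v.
Proof.
move=> iF u v.
pose w s := foldr (fun i acc => upd acc i (tnth v i)) u s.
have wE s : F (w s) = F u by elim: s => //= i s <-; exact: iF.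
rewrite -(wE (enum 'I_n)); congr F; apply: eq_from_tnth => j.
have tw s : tnth (w s) j = if j \in s then tnth v j else tnth u j.
  elim: s => //= i s ih; rewrite tnth_upd in_cons.
  by have [->|ji] := eqVneq j i.
by rewrite tw mem_enum.
Qed.

(** Induction on a list containing the coordinates that matter to [F]. Averaging over the head [k]
    splits the variance: the first part is at most the distance to [G k], since the average is the
    best approximation free of [k]; the second is the variance of the average, treated by induction
    with the averaged [G j], and Jensen's inequality removes the averaging. *)
Lemma efron_stein F (G : 'I_n -> conf -> R) (s : seq 'I_n) :
  bmf F -> (forall k, bmf (G k)) -> (forall k, indep k (G k)) ->
  (forall k, k \notin s -> indep k F) ->
  mean Pi (fun u => (F u - mean Pi F) ^+ 2) <=
  \sum_(k <- s) mean Pi (fun u => (F u - G k u) ^+ 2).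
Proof.
elim: s F G => [|k s ih] F G bF bG iG iF.
  rewrite big_nil -[leRHS](mean_cst Pi).
  apply: le_mean; [by bmf_tac|exact: bmf_cst|] => u.
  have -> : mean Pi F = F u.
    rewrite -[RHS](mean_cst Pi); apply: eq_mean => v.
    by apply: indep_all_const => i; exact: iF.
  by rewrite subrr expr0n.
have bEF := bmf_resample k bF.
rewrite big_cons (resample_pythagoras (i := k) bF); [|exact: bmf_cst|by []].
rewrite lerD//.
  rewrite [leRHS](resample_pythagoras bF (bG k) (iG k)) lerDl.
  by apply: mean_ge0 => u; exact: sqr_ge0.
rewrite -(resampleE k bF).
have bEG j : bmf (resample k (G j)) by exact: bmf_resample.
have iEG j : indep j (resample k (G j)) by exact: indep_resampleC.
apply: le_trans (ih _ _ bEF bEG iEG _) _.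
  move=> j js; have [->|jk] := eqVneq j k; first exact: indep_resample.
  by apply: indep_resampleC; apply: iF; rewrite in_cons negb_or jk.
apply: ler_sum => j _.
rewrite -[leRHS](resampleE k); last by bmf_tac.
apply: le_mean; [by bmf_tac|by apply: bmf_resample; bmf_tac|] => u.
rewrite -resampleB//; apply: mean_sq_ge.
have bd : bmf (fun u => F u - G j u) by bmf_tac.
exact: (bmf_upd1 k u bd).
Qed.

End resampling.

(** * The coverage functional *)

Lemma bmf_prod d (T : measurableType d) (R : realType) (I : Type) (s : seq I)
    (A : pred I) (F : I -> T -> R) :
  (forall i, bmf (F i)) -> bmf (fun x => \prod_(i <- s | A i) F i x).
Proof.
move=> bF; elim: s => [|i s ih].
  by under eq_fun do rewrite big_nil; exact: bmf_cst.
under eq_fun do rewrite big_cons.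
by case: (A i) => //; exact: bmfM.
Qed.

(* [c (x, y)] is meant to be the indicator of the event that the set centred at
   [y] covers [x], although only [0 <= c <= 1] is used. For a configuration [u],
   [vac J u] is then the measure of the points covered by no [tnth u j],
   [j \in J], and [excl k J u] that of the points covered by [tnth u k] and by no
   [tnth u j], [j \in J]. *)
Section coverage.
Context dX (X : measurableType dX) (R : realType) (n : nat).
Variables (nu : probability X R) (Pi : probability (n.-tuple X)%type R).
Local Notation conf := (n.-tuple X)%type.
Implicit Types (u : conf) (i j k : 'I_n) (J A : {set 'I_n}) (x y : X).
Hypothesis resampleE : forall i (F : conf -> R), bmf F ->
  mean Pi (resample nu i F) = mean Pi F.
Variables (c : X * X -> R) (th : R).
Hypothesis mc : measurable_fun setT c.
Hypothesis c01 : forall z, 0 <= c z <= 1.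
Hypothesis csym : forall x y, c (x, y) = c (y, x).
Hypothesis mean_c : forall x, mean nu (fun y => c (x, y)) = th.
Local Notation q := (1 - th).

Definition prodb J u x : R := \prod_(j in J) (1 - c (x, tnth u j)).

Definition vac J u : R := mean nu (prodb J u).

Definition excl k J u : R := mean nu (fun x => c (x, tnth u k) * prodb J u x).

Let bc : bmf c.
Proof.
split=> //; exists 1 => z; have /andP[? ?] := c01 z.
by rewrite ger0_norm.
Qed.

Lemma bmf_cov j : bmf (fun z : conf * X => c (z.2, tnth z.1 j)).
Proof.
have [_ cM] := bc.
apply: (@bmf_comp _ _ _ _ _ c (fun z : conf * X => (z.2, tnth z.1 j))) => //.
apply: measurable_fun_pair => //.
apply: (@measurableT_comp _ _ _ _ _ _ (fun u : conf => tnth u j)) => //.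
exact: measurable_tnth.
Qed.

Lemma bmf_prodb2 J : bmf (fun z : conf * X => prodb J z.1 z.2).
Proof.
apply: bmf_prod => j; apply: bmfB; first exact: bmf_cst.
exact: bmf_cov.
Qed.

Let bcu j u : bmf (fun x => c (x, tnth u j)).
Proof. exact: (bmf_pair1 u (bmf_cov j)). Qed.

Let bpu J u : bmf (prodb J u).
Proof. exact: (bmf_pair1 u (bmf_prodb2 J)). Qed.

Let bcpu k J u : bmf (fun x => c (x, tnth u k) * prodb J u x).
Proof. exact: bmfM. Qed.

Lemma bmf_vac J : bmf (vac J).
Proof. exact: (bmf_mean_snd Pi nu (bmf_prodb2 J)). Qed.

Lemma bmf_excl k J : bmf (excl k J).
Proof.
apply: (@bmf_mean_snd _ _ _ _ _ Pi nu
  (fun z : conf * X => c (z.2, tnth z.1 k) * prodb J z.1 z.2)).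
by apply: bmfM; [exact: bmf_cov | exact: bmf_prodb2].
Qed.

Lemma mean_cov k u : mean nu (fun x => c (x, tnth u k)) = th.
Proof. by rewrite -(mean_c (tnth u k)); apply: eq_mean => x; rewrite csym. Qed.

(** The configuration and the index supply a point of [X], at which [th] is the measure of an actual
    covering set. *)
Lemma th_ge0 : conf -> 'I_n -> 0 <= th.
Proof.
move=> u k; rewrite -(mean_cov k u); apply: mean_ge0 => x.
by have /andP[] := c01 (x, tnth u k).
Qed.

Lemma prodb_ge0 J u x : 0 <= prodb J u x.
Proof.
apply: prodr_ge0 => j _; rewrite subr_ge0.
by have /andP[] := c01 (x, tnth u j).
Qed.

Lemma prodbU1 k J u x : k \notin J ->
  prodb (k |: J) u x = (1 - c (x, tnth u k)) * prodb J u x.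
Proof. by move=> kJ; rewrite /prodb big_setU1. Qed.

Lemma prodb_anti J A u x : J \subset A -> prodb A u x <= prodb J u x.
Proof.
move=> JA; rewrite /prodb (big_setID J)/= (finset.setIidPr JA) ler_piMr//.
  exact: prodb_ge0.
apply: prodr_ile1 => j _; have /andP[? ?] := c01 (x, tnth u j).
by apply/andP; split; lra.
Qed.

Lemma prodb0 u x : prodb finset.set0 u x = 1.
Proof. by rewrite /prodb big_set0. Qed.

Lemma vac0 u : vac finset.set0 u = 1.
Proof.
by rewrite -[RHS](mean_cst nu); apply: eq_mean => x; rewrite prodb0.
Qed.

Lemma excl0 k u : excl k finset.set0 u = th.
Proof.
rewrite -(mean_cov k u); apply: eq_mean => x; rewrite prodb0.
by rewrite mulr1.
Qed.

Lemma vacU1 k J u : k \notin J -> vac (k |: J) u = vac J u - excl k J u.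
Proof.
move=> kJ; rewrite /vac /excl -meanB//; apply: eq_mean => x.
by rewrite prodbU1//; ring.
Qed.

Lemma vac_anti J A u : J \subset A -> vac A u <= vac J u.
Proof. by move=> JA; apply: le_mean => // x; exact: prodb_anti. Qed.

Lemma vac_ge0 J u : 0 <= vac J u.
Proof. by apply: mean_ge0 => x; exact: prodb_ge0. Qed.

Lemma vac_le1 J u : vac J u <= 1.
Proof. by rewrite -(vac0 u) vac_anti// finset.sub0set. Qed.

Lemma excl_ge0 k J u : 0 <= excl k J u.
Proof.
apply: mean_ge0 => x; rewrite mulr_ge0 ?prodb_ge0//.
by have /andP[] := c01 (x, tnth u k).
Qed.

Lemma excl_anti k J A u : J \subset A -> excl k A u <= excl k J u.
Proof.
move=> JA; apply: le_mean => // x; rewrite ler_wpM2l ?prodb_anti//.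
by have /andP[] := c01 (x, tnth u k).
Qed.

Lemma excl_le k J u : excl k J u <= th.
Proof. by rewrite -(excl0 k u) excl_anti// finset.sub0set. Qed.

(** Each difference measures what [i] and [k] both cover and the remaining set leaves vacant, so it
    shrinks as that set grows. *)
Lemma excl_diff_anti i k J A u : J \subset A -> i \notin A ->
  excl k A u - excl k (i |: A) u <= excl k J u - excl k (i |: J) u.
Proof.
move=> JA iA; have iJ : i \notin J by apply: contra iA => /(fintype.subsetP JA).
have E (B : {set 'I_n}) : i \notin B -> excl k B u - excl k (i |: B) u =
    mean nu (fun x => c (x, tnth u i) * (c (x, tnth u k) * prodb B u x)).
  move=> iB; rewrite /excl -meanB//; apply: eq_mean => x.
  by rewrite prodbU1//; ring.
rewrite !E//; apply: le_mean; [exact: bmfM..|] => x.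
have /andP[ci _] := c01 (x, tnth u i); have /andP[ck _] := c01 (x, tnth u k).
by rewrite !ler_wpM2l// prodb_anti.
Qed.

Lemma indep_prodb J i x : i \notin J -> indep i (fun u => prodb J u x).
Proof.
move=> iJ u y; apply: eq_bigr => j jJ; rewrite tnth_upd.
by have [ji|//] := eqVneq j i; move: iJ; rewrite -ji jJ.
Qed.

Lemma indep_vac J i : i \notin J -> indep i (vac J).
Proof. by move=> iJ u y; apply: eq_mean => x; exact: indep_prodb. Qed.

Lemma indep_excl k J i : i \notin J -> i != k -> indep i (excl k J).
Proof.
move=> iJ ik u y; apply: eq_mean => x.
by rewrite (indep_prodb x iJ) tnth_upd eq_sym (negbTE ik).
Qed.

(** After exchanging the two integrations, each vacant point escapes the new set with probability
    [q]. *)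
Lemma resample_vacU1 k J u : k \notin J ->
  resample nu k (vac (k |: J)) u = q * vac J u.
Proof.
move=> kJ.
have -> : resample nu k (vac (k |: J)) u =
    mean nu (fun y => mean nu (fun x => (1 - c (x, y)) * prodb J u x)).
  apply: eq_mean => y; apply: eq_mean => x.
  by rewrite prodbU1// tnth_upd eqxx (indep_prodb x kJ).
have b2 : bmf (fun z : X * X => (1 - c (z.2, z.1)) * prodb J u z.2).
  apply: bmfM.
    apply: bmfB; first exact: bmf_cst.
    have [mc' cM] := bc.
    exact: (@bmf_comp _ _ _ _ _ c (fun z : X * X => (z.2, z.1)) (@measurable_swap _ _ _ _)).
  have [mp pM] := bpu J u.
  by apply: (bmf_comp _ mp pM).
rewrite (bounded_fubini nu nu b2)/= mulrC -meanZr//; apply: eq_mean => x.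
have bcx : bmf (fun y => c (x, y)) by exact: (bmf_pair1 x bc).
rewrite meanZr; last by bmf_tac.
rewrite meanB; [|exact: bmf_cst|by []].
by rewrite mean_cst mean_c mulrC.
Qed.

Lemma mean_vac J : mean Pi (vac J) = q ^+ #|J|.
Proof.
elim: {J}_.+1 {-2}J (ltnSn #|J|) => // m ih J Jm.
have [->|/finset.set0Pn[k kJ]] := eqVneq J finset.set0.
  by rewrite cards0 expr0 -[RHS](mean_cst Pi); apply: eq_mean => u; exact: vac0.
have kJ' : k \notin J :\ k by rewrite setD11.
rewrite -(finset.setD1K kJ) -(resampleE k); last exact: bmf_vac.
rewrite (eq_mean Pi (fun u => resample_vacU1 u kJ')) meanZl; last exact: bmf_vac.
rewrite ih; first by rewrite cardsU1 kJ' exprS.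
by move: Jm; rewrite (cardsD1 k) kJ add1n ltnS.
Qed.

(** The cut is a natural number and not an element of ['I_n], so that [m = n] gives the empty set,
    where the telescoping sums end. *)
Definition tail A (m : nat) : {set 'I_n} := A :&: [set j : 'I_n | (m <= j)%N]%SET.

Lemma tail_recl A k : k \in A -> tail A k = k |: tail A k.+1.
Proof.
move=> kA; apply/setP => j; rewrite !inE leq_eqVlt eq_sym.
have [/val_inj <-|jk] := eqVneq (k : nat) j; first by rewrite eqxx kA.
by rewrite [j == k]eq_sym -val_eqE (negbTE jk).
Qed.

Lemma tail_notin A k : k \notin A -> tail A k = tail A k.+1.
Proof.
move=> kA; apply/setP => j; rewrite !inE leq_eqVlt.
have [/val_inj <-|//] := eqVneq (k : nat) j; by rewrite (negbTE kA).
Qed.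

Lemma notin_tail A k : k \notin tail A k.+1.
Proof. by rewrite !inE ltnn andbF. Qed.

Lemma tail0 A : tail A 0 = A.
Proof. by apply/setP => j; rewrite !inE andbT. Qed.

Lemma tailn A : tail A n = finset.set0.
Proof. by apply/setP => j; rewrite !inE leqNgt ltn_ord andbF. Qed.

Lemma sum_tail A (g : {set 'I_n} -> R) :
  \sum_(i in A) (g (tail A i.+1) - g (tail A i)) = g finset.set0 - g A.
Proof.
transitivity (\sum_(0 <= m < n) (g (tail A m.+1) - g (tail A m))).
  rewrite big_mkord big_mkcond/=; apply: eq_bigr => i _.
  by case: ifPn => // iA; rewrite (tail_notin iA) subrr.
by rewrite (telescope_sumr (fun m => g (tail A m)))// tailn tail0.
Qed.

(* [fresh A i] is the part of the set centred at the [i]-th point which the later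
   points of [A] leave uncovered; [gain A i] is the excess of the covered measure
   over its average when the [i]-th point is resampled, cf. [resample_vac]. *)
Definition fresh A i u : R := excl i (tail A i.+1) u.

Definition gain A i u : R := q * vac (A :\ i) u - vac A u.

(** The weights keep the original index [i] instead of its rank in [A], so deleting a point leaves
    the weights of the others unchanged. *)
Definition wsum A u : R := \sum_(i in A) q ^+ i * fresh A i u * gain A i u.

Lemma freshE A i u : i \in A ->
  fresh A i u = vac (tail A i.+1) u - vac (tail A i) u.
Proof.
by move=> iA; rewrite (tail_recl iA) vacU1 ?notin_tail// opprB addrC subrK.
Qed.

Lemma vacD1 A i u : i \in A -> vac A u = vac (A :\ i) u - excl i (A :\ i) u.
Proof. by move=> iA; rewrite -{1}(finset.setD1K iA) vacU1// setD11. Qed.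

Lemma gainE A i u : i \in A ->
  gain A i u = excl i (A :\ i) u - th * vac (A :\ i) u.
Proof. by move=> iA; rewrite /gain (vacD1 _ iA); ring. Qed.

Lemma resample_vac i A u : i \in A -> resample nu i (vac A) u - vac A u = gain A i u.
Proof.
by move=> iA; rewrite -{1}(finset.setD1K iA) resample_vacU1// setD11.
Qed.

Lemma sum_fresh A u : \sum_(i in A) fresh A i u = 1 - vac A u.
Proof.
rewrite -(vac0 u) -(sum_tail A (fun J => vac J u)); apply: eq_bigr => i iA.
exact: freshE.
Qed.

Lemma fresh_ge0 A i u : 0 <= fresh A i u.
Proof. exact: excl_ge0. Qed.

Lemma fresh_le A i u : fresh A i u <= th.
Proof. exact: excl_le. Qed.

(** * Effect of deleting one point *)

Section removal.
Variables (k : 'I_n) (u : conf).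
Let A : {set 'I_n} := finset.setT.
Let A' : {set 'I_n} := A :\ k.
Let a := th - excl k A' u.

Let th0 : 0 <= th. Proof. exact: th_ge0 u k. Qed.

Let th1 : th <= 1.
Proof.
rewrite -(mean_cov k u) -[leRHS](mean_cst nu); apply: le_mean => //.
  exact: bmf_cst.
by move=> x; have /andP[] := c01 (x, tnth u k).
Qed.

Let a0 : 0 <= a. Proof. by rewrite subr_ge0 excl_le. Qed.

Let inA i : i \in A. Proof. by rewrite inE. Qed.

Lemma vac_ge B : 1 - vac B u <= n%:R * th.
Proof.
rewrite -sum_fresh; apply: (@le_trans _ _ (\sum_(i in B) th)).
  by apply: ler_sum => i _; exact: fresh_le.
rewrite sumr_const -[leLHS]mulr_natl ler_wpM2r// ler_nat.
by rewrite -[leqRHS]card_ord max_card.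
Qed.

Lemma gain_norm (B : {set 'I_n}) i : i \in B -> `|gain B i u| <= th.
Proof.
move=> iB; rewrite gainE// ler_norml.
have := excl_ge0 i (B :\ i) u; have := excl_le i (B :\ i) u.
have := vac_ge0 (B :\ i) u; have := vac_le1 (B :\ i) u.
by move=> *; apply/andP; split; nra.
Qed.

(** The gain equals [th * (1 - vac A' u) - a], and the covered measure is at most [n%:R * th]. *)
Lemma gain_removed : `|gain A k u| <= a + n%:R * th ^+ 2.
Proof.
rewrite gainE// -/A' ler_norml.
have vn := ler_wpM2l th0 (vac_ge A').
have v0 : 0 <= th * (1 - vac A' u) by rewrite mulr_ge0 ?subr_ge0 ?vac_le1.
have := a0; rewrite /a => a_ge0.
have -> : n%:R * th ^+ 2 = th * (n%:R * th) by ring.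
by apply/andP; split; lra.
Qed.

(** Deleting [k] can only enlarge the other fresh parts, so the absolute values drop out and the sum
    is [fresh A k u - excl k A' u]. *)
Lemma sum_fresh_diff :
  \sum_(i in A') `|fresh A i u - fresh A' i u| <= a.
Proof.
have -> : \sum_(i in A') `|fresh A i u - fresh A' i u| =
    \sum_(i in A') fresh A' i u - \sum_(i in A') fresh A i u.
  rewrite -sumrB; apply: eq_bigr => i _.
  rewrite distrC ger0_norm// subr_ge0; apply: excl_anti.
  by apply: finset.setSI; exact: finset.subsetDl.
have : \sum_(i in A) fresh A i u = fresh A k u + \sum_(i in A') fresh A i u.
  by rewrite (bigD1 k)//=; congr (_ + _); apply: eq_bigl => i; rewrite !inE andbC.
rewrite !sum_fresh (vacD1 u (inA k)) -/A' => e.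
have := fresh_le A k u; rewrite /a; lra.
Qed.

(** The change of the gain of [i] is, up to [th ^+ 2], the region covered by [i] and [k] alone.
    Bounding the overlaps of [i] and [k] one by one would count multiply covered points repeatedly;
    comparison with the later points only gives terms [t i] that telescope to [a]. *)
Lemma sum_gain_diff :
  \sum_(i in A') `|gain A i u - gain A' i u| <= a + n%:R * th ^+ 2.
Proof.
pose t i := excl k (tail A' i.+1) u - excl k (tail A' i) u.
apply: (@le_trans _ _ (\sum_(i in A') (t i + th ^+ 2))).
  apply: ler_sum => i iA'.
  have ik : i != k by move: iA'; rewrite !inE => /andP[].
  pose B := A :\ i :\ k.
  have kAi : k \notin B by rewrite setD11.
  have AiE : A :\ i = k |: (B).
    by rewrite finset.setD1K// !inE eq_sym ik.
  have A'iE : A' :\ i = B by apply/setP => j; rewrite !inE andbCA.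
  have A'E : A' = i |: (B).
    by rewrite -A'iE finset.setD1K.
  have iAi : i \notin B by rewrite !inE eqxx andbF.
  have -> : gain A i u - gain A' i u =
      - (excl k (B) u - excl k A' u) + th * excl k (B) u.
    rewrite /gain A'iE (vacD1 u (inA k)) -/A' AiE vacU1//.
    by ring.
  have := excl_ge0 k (B) u; have := excl_le k (B) u.
  (* Keeping only the later points enlarges the doubly covered region, by [excl_diff_anti], and
     produces the telescoping difference [t i]. *)
  have s1 : tail A' i.+1 \subset B.
    apply/fintype.subsetP => j; rewrite !inE => /andP[/andP[-> _] ij].
    by rewrite -val_eqE gtn_eqF.
  have := excl_diff_anti k u s1 iAi; rewrite -A'E -tail_recl// -/(t i).
  have : excl k A' u <= excl k (B) u.
    by apply: excl_anti; rewrite A'E finset.subsetUr.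
  move: (excl k A' u) (excl k _ u) (t i) => e1 e2 e3 ? ? ? ?.
  by rewrite ler_norml; apply/andP; split; nra.
rewrite big_split/= (sum_tail A' (fun J => excl k J u)) excl0 lerD//.
rewrite sumr_const -[leLHS]mulr_natl ler_wpM2r ?sqr_ge0// ler_nat.
by rewrite -[leqRHS]card_ord max_card.
Qed.

(** Three contributions, each with a factor [th]: the lost term gives [a + n%:R * th ^+ 2], the
    changes of the fresh parts give [a], and those of the gains give [a + n%:R * th ^+ 2] again. *)
Lemma wsum_removal :
  `|wsum A u - wsum A' u| <= 3 * th * a + 2 * n%:R * th ^+ 3.
Proof.
have q01 i : 0 <= q ^+ i <= 1.
  have q1 : q <= 1 by rewrite gerBl.
  by rewrite exprn_ge0 ?subr_ge0//= exprn_ile1// subr_ge0.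
pose w (i : 'I_n) := q ^+ i.
have -> : wsum A u - wsum A' u = w k * fresh A k u * gain A k u +
    \sum_(i in A') (w i * (fresh A i u - fresh A' i u) * gain A i u +
      w i * fresh A' i u * (gain A i u - gain A' i u)).
  rewrite /wsum (bigD1 k)//= -addrA; congr (_ + _).
  rewrite (eq_bigl (mem A')); last by move=> i; rewrite !inE andbC.
  by rewrite -sumrB; apply: eq_bigr => i _; rewrite /w; ring.
have -> : 3 * th * a + 2 * n%:R * th ^+ 3 =
  th * (a + n%:R * th ^+ 2) + (th * a + th * (a + n%:R * th ^+ 2)) by ring.
apply: le_trans (ler_normD _ _) _; apply: lerD.
  rewrite !normrM ler_pM ?gain_removed//.
  rewrite ger0_norm ?(ger0_norm (fresh_ge0 _ _ _)); last by have /andP[] := q01 k.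
  rewrite -[leRHS]mul1r ler_pM ?fresh_le ?fresh_ge0//; have /andP[]// := q01 k.
rewrite (le_trans (ler_norm_sum _ _ _))//.
apply: (@le_trans _ _ (\sum_(i in A') (th * `|fresh A i u - fresh A' i u| +
    th * `|gain A i u - gain A' i u|))).
  apply: ler_sum => i iA'; rewrite (le_trans (ler_normD _ _))//.
  have /andP[w0 w1] := q01 i.
  rewrite !normrM (ger0_norm w0) (ger0_norm (fresh_ge0 _ _ _)) lerD//.
    rewrite mulrC ler_pM ?mulr_ge0 ?gain_norm//.
    by rewrite ler_piMl.
  rewrite ler_wpM2r// -[leRHS]mul1r ler_pM ?fresh_le ?fresh_ge0//.
rewrite big_split/= -!mulr_sumr lerD// ler_wpM2l//.
  exact: sum_fresh_diff.
exact: sum_gain_diff.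
Qed.

End removal.

(** * Moments and covariances of the covered measure *)

Section fluctuations.
Hypothesis th_gt0 : 0 < th.
Hypothesis th_lt1 : th < 1.
Local Notation full := ([set: 'I_n]%SET : {set 'I_n}).

Definition covered u : R := 1 - vac full u.

Let th0 : 0 <= th := ltW th_gt0.
Let q0 : 0 < q. Proof. by rewrite subr_gt0. Qed.
Let q1 : q <= 1. Proof. by rewrite gerBl. Qed.

Lemma bernoulli_ge m : 1 - q ^+ m <= m%:R * th.
Proof.
elim: m => [|m ih]; first by rewrite expr0 mul0r subrr.
rewrite exprS -natr1.
have : 0 <= q ^+ m <= 1 by rewrite exprn_ge0 ?(ltW q0)//= exprn_ile1 ?(ltW q0).
by move=> /andP[_ /(ler_wpM2l th0)]; lra.
Qed.

Lemma bernoulli_le m : q ^+ m * (1 + m%:R * th) <= 1.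
Proof.
elim: m => [|m ih]; first by rewrite expr0 mul0r addr0 mulr1.
apply: le_trans ih; rewrite exprSr -mulrA ler_wpM2l ?exprn_ge0 ?(ltW q0)//.
rewrite -natr1 -subr_ge0.
have -> : 1 + m%:R * th - (1 - th) * (1 + (m%:R + 1) * th) =
  (m%:R + 1) * th ^+ 2 by ring.
by rewrite mulr_ge0// ?sqr_ge0// addr_ge0.
Qed.

Lemma mul_expr_le m : m%:R * th * q ^+ m.-1 <= 1 - q ^+ m.
Proof.
have -> : 1 - q ^+ m = th * \sum_(i < m) q ^+ i.
  by rewrite -[LHS]opprB subrX1 -mulNr opprB subKr.
have -> : m%:R * th * q ^+ m.-1 = th * \sum_(i < m) q ^+ m.-1.
  by rewrite sumr_const card_ord -mulr_natl; ring.
rewrite ler_wpM2l//.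
apply: ler_sum => i _.
by rewrite ler_wiXn2l ?(ltW q0)// -ltnS prednK// (leq_ltn_trans _ (ltn_ord i)).
Qed.

Let bvac J : bmf (vac J). Proof. exact: bmf_vac. Qed.
Let bexcl k J : bmf (excl k J). Proof. exact: bmf_excl. Qed.
Let bfresh A i : bmf (fresh A i). Proof. exact: bmf_excl. Qed.
Let bgain A i : bmf (gain A i). Proof. by rewrite /gain; bmf_tac. Qed.
Let bwsum A : bmf (wsum A). Proof. by rewrite /wsum; bmf_tac. Qed.
Let bcovered : bmf covered. Proof. by rewrite /covered; bmf_tac. Qed.

Lemma mean_covered : mean Pi covered = 1 - q ^+ n.
Proof.
rewrite /covered meanB//; last exact: bmf_cst.
by rewrite mean_cst mean_vac cardsT card_ord.
Qed.

Lemma indep_fresh A i k : k \notin A -> i != k -> indep k (fresh A i).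
Proof.
move=> kA ik; apply: indep_excl; last by rewrite eq_sym.
by rewrite inE (negbTE kA).
Qed.

Lemma indep_gain A i k : k \notin A -> indep k (gain A i).
Proof.
move=> kA u y; rewrite /gain !indep_vac// !inE.
by rewrite (negbTE kA) andbF.
Qed.

Lemma indep_wsum A k : k \notin A -> indep k (wsum A).
Proof.
move=> kA u y; apply: eq_bigr => i iA.
have ik : i != k by apply: contraNneq kA => <-.
by rewrite (indep_fresh kA ik) (indep_gain _ kA).
Qed.

Lemma card_fullD1 k : #|full :\ k| = n.-1.
Proof.
have := cardsD1 k full; rewrite cardsT card_ord inE.
by move/(congr1 predn) => /= ->.
Qed.

(** Since [a] is at most [th], its square is at most [th * a]; the squared bound becomes affine in
    [a], and only the mean of [a] is required. *)
Lemma mean_sqr_wsum_removal k :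
  mean Pi (fun u => (wsum full u - wsum (full :\ k) u) ^+ 2) <=
  9 * n%:R * th ^+ 5 + 16 * n%:R ^+ 2 * th ^+ 6.
Proof.
pose a u := th - excl k (full :\ k) u.
have ba : bmf a by rewrite /a; bmf_tac.
have Ea : mean Pi a <= n%:R * th ^+ 2.
  have n0 : (0 < n)%N by exact: leq_ltn_trans (ltn_ord k).
  have -> : mean Pi a = th * (1 - q ^+ n.-1).
    transitivity (mean Pi (fun u => th - (vac (full :\ k) u - vac full u))).
      by apply: eq_mean => u; rewrite (@vacD1 full k u) ?inE// /a; ring.
    rewrite meanB; [|exact: bmf_cst|by bmf_tac].
    rewrite meanB// mean_cst !mean_vac cardsT card_ord card_fullD1.
    by rewrite -{2}(prednK n0) exprS; ring.
  have := ler_wpM2l th0 (bernoulli_ge n.-1) => /le_trans; apply.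
  rewrite (_ : th * (n.-1%:R * th) = n.-1%:R * th ^+ 2); last by ring.
  by rewrite ler_wpM2r ?sqr_ge0// ler_nat leq_pred.
apply: (@le_trans _ _ (mean Pi (fun u =>
    (9 * th ^+ 3 + 12 * n%:R * th ^+ 4) * a u + 4 * n%:R ^+ 2 * th ^+ 6))).
  apply: le_mean; [by bmf_tac..|] => u.
  have := wsum_removal k u; rewrite -/(a u) => D.
  have a0 : 0 <= a u by rewrite subr_ge0 excl_le.
  have a1 : a u <= th by rewrite gerBl excl_ge0.
  rewrite -(real_normK (num_real (_ - _))).
  apply: (@le_trans _ _ ((3 * th * a u + 2 * n%:R * th ^+ 3) ^+ 2)).
    by rewrite ler_sqr ?nnegrE ?(le_trans _ D).
  rewrite -subr_ge0.
  rewrite (_ : _ - _ = 9 * th ^+ 2 * (a u * (th - a u))); last by ring.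
  apply: mulr_ge0; first by rewrite mulr_ge0 ?sqr_ge0.
  by apply: mulr_ge0 => //; rewrite subr_ge0.
rewrite meanD; [|by bmf_tac..]; rewrite mean_cst meanZl//.
have -> : 9 * n%:R * th ^+ 5 + 16 * n%:R ^+ 2 * th ^+ 6 =
  (9 * th ^+ 3 + 12 * n%:R * th ^+ 4) * (n%:R * th ^+ 2) +
  4 * n%:R ^+ 2 * th ^+ 6 by ring.
rewrite lerD2r ler_wpM2l// addr_ge0// !mulr_ge0// exprn_ge0//.
Qed.

Lemma variance_wsum :
  mean Pi (fun u => (wsum full u - mean Pi (wsum full)) ^+ 2) <=
  n%:R * (9 * n%:R * th ^+ 5 + 16 * n%:R ^+ 2 * th ^+ 6).
Proof.
have H := efron_stein resampleE (F := wsum full)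
  (G := fun k => wsum (full :\ k)) (s := index_enum 'I_n).
apply: le_trans (H _ _ _ _) _ => //.
- by move=> k; apply: indep_wsum; rewrite setD11.
- by move=> k; rewrite mem_index_enum.
apply: (@le_trans _ _
    (\sum_(k : 'I_n) (9 * n%:R * th ^+ 5 + 16 * n%:R ^+ 2 * th ^+ 6))).
  by apply: ler_sum => k _; exact: mean_sqr_wsum_removal.
by rewrite sumr_const card_ord -[leLHS]mulr_natl.
Qed.

Lemma resample_fresh i u :
  resample nu i (fresh full i) u = th * vac (tail full i.+1) u.
Proof.
have -> : fresh full i = (fun u => vac (tail full i.+1) u - vac (tail full i) u).
  by apply/funext => v; rewrite freshE// inE.
rewrite resampleB// indep_resample_id; last by apply: indep_vac; exact: notin_tail.
by rewrite tail_recl ?inE// resample_vacU1 ?notin_tail//; ring.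
Qed.

Lemma covered_decomposition u : covered u - (1 - q ^+ n) =
  \sum_(i : 'I_n) q ^+ i * (fresh full i u - th * vac (tail full i.+1) u).
Proof.
pose g m := q ^+ m * vac (tail full m) u.
transitivity (g n - g 0).
  by rewrite /g tailn tail0 vac0 /covered expr0; ring.
rewrite -(telescope_sumr g)// big_mkord; apply: eq_bigr => i _.
by rewrite /g freshE ?inE// exprS; ring.
Qed.

(* [fresh full i - th * vac (tail full i.+1)] is [fresh full i] minus its average
   over the [i]-th point, and this centring moves to [F] by self-adjointness. *)
Lemma covariance_covered (F : conf -> R) : bmf F ->
  mean Pi (fun u => (covered u - mean Pi covered) * F u) =
  mean Pi (fun u => \sum_(i : 'I_n) q ^+ i * fresh full i u * (F u - resample nu i F u)).
Proof.
move=> bF.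
have bEF i : bmf (resample nu i F) by exact: bmf_resample.
have -> : mean Pi (fun u => (covered u - mean Pi covered) * F u) =
    mean Pi (fun u => \sum_(i : 'I_n) q ^+ i *
      (fresh full i u * F u - resample nu i (fresh full i) u * F u)).
  apply: eq_mean => u; rewrite mean_covered covered_decomposition mulr_suml.
  by apply: eq_bigr => i _; rewrite resample_fresh; ring.
have bEf i : bmf (resample nu i (fresh full i)) by exact: bmf_resample.
rewrite !mean_sum; [|by move=> i; bmf_tac..].
apply: eq_bigr => i _; rewrite meanZl; last by bmf_tac.
rewrite meanB; [|by bmf_tac..]; rewrite (resample_adjoint resampleE)//.
rewrite -meanB; [|by bmf_tac..]; rewrite -meanZl; last by bmf_tac.
by apply: eq_mean => u; ring.
Qed.

Lemma fresh_penultimate i j u : i.+1 = j -> j.+1 = n ->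
  fresh full i u = th - mean nu (fun x => c (x, tnth u i) * c (x, tnth u j)).
Proof.
move=> ij jn; rewrite /fresh ij tail_recl ?inE// jn tailn.
rewrite -(mean_cov i u) -meanB; [|exact: bcu|by apply: bmfM; exact: bcu].
by apply: eq_mean => x; rewrite prodbU1 ?inE// prodb0; ring.
Qed.

(* Were [covered] constant, it would be uncorrelated with [fresh full i], which
   only depends on the last two points, and [covariance_covered] would make the
   latter constant; but it equals [th] when these two points are far apart. *)
Lemma std_dev_covered_gt0 (far : X * X -> R) (kap : R) i j :
  i.+1 = j -> j.+1 = n -> bmf far -> (forall z, 0 <= far z <= 1) -> 0 < kap ->
  (forall z, kap <= mean nu (fun y => far (y, z))) ->
  (forall y z, far (y, z) != 0 -> mean nu (fun x => c (x, y) * c (x, z)) = 0) ->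
  0 < std_dev Pi covered.
Proof.
move=> ij jn bfar far01 kap0 far_ge far_disj.
rewrite lt_def std_dev_ge0 andbT; apply/eqP => sd0.
pose L := fresh full i; pose m := mean Pi covered.
have bL : bmf L := bfresh full i.
have tE : tail full i.+1 = j |: finset.set0.
  by rewrite ij tail_recl ?inE// jn tailn.
have cL : mean Pi (fun u => (covered u - m) * L u) = 0.
  apply/eqP; rewrite -normr_le0.
  apply: le_trans (le_mean_norm _ _) _; first by bmf_tac.
  have : mean Pi (fun u => `|covered u - m|) <= 0.
    apply: mean_norm_le => //; first by bmf_tac.
    by rewrite -std_dev_sq// sd0.
  move/(ler_wpM2l th0); rewrite mulr0; apply: le_trans.
  rewrite -meanZl; last by bmf_tac.
  apply: le_mean; [by bmf_tac..|] => u.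
  rewrite normrM mulrC ler_wpM2r// ger0_norm ?fresh_ge0//.
  exact: fresh_le.
have EiL u : resample nu i L u = th * q.
  rewrite resample_fresh tE vacU1 ?inE// vac0 excl0.
  by [].
have bEL k : bmf (resample nu k L) by exact: bmf_resample.
have EL : mean Pi L = th * q.
  by rewrite -(resampleE i)// (eq_mean Pi EiL) mean_cst.
have : mean Pi (fun u => L u * (L u - th * q)) = 0.
  (* Only the term of [i] survives: for [k = j], the last index, the fresh part is the constant [th]
     and the centred factor averages out; any other [k] does not affect [L]. *)
  move: cL; rewrite covariance_covered// mean_sum; last by move=> k; bmf_tac.
  rewrite (bigD1 i)//= big1.
    move=> /eqP; rewrite addr0 (_ : mean _ _ =
      q ^+ i * mean Pi (fun u => L u * (L u - th * q))).
      by rewrite mulf_eq0 expf_eq0 (gt_eqF q0) andbF => /eqP.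
    rewrite -meanZl; last by bmf_tac.
    by apply: eq_mean => u; rewrite -/L EiL mulrA.
  move=> k ki; have [kj|kj] := eqVneq k j.
    have -> : mean Pi (fun u => q ^+ k * fresh full k u * (L u - resample nu k L u))
        = q ^+ k * th * (mean Pi L - mean Pi (resample nu k L)).
      rewrite -meanB// -meanZl; last by bmf_tac.
      by apply: eq_mean => u; rewrite /fresh kj jn tailn excl0.
    by rewrite resampleE// subrr mulr0.
  have kL : indep k L.
    apply: indep_excl => //; rewrite tE !inE.
    by rewrite (negbTE kj).
  rewrite -[RHS](mean_cst Pi); apply: eq_mean => u.
  by rewrite indep_resample_id// subrr mulr0.
have -> : mean Pi (fun u => L u * (L u - th * q)) =
    mean Pi (fun u => (L u - th * q) ^+ 2).
  have -> : mean Pi (fun u => (L u - th * q) ^+ 2) =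
      mean Pi (fun u => L u * (L u - th * q) - th * q * (L u - th * q)).
    by apply: eq_mean => u; ring.
  rewrite meanB; [|by bmf_tac..]; rewrite [X in _ = _ - X]meanZl; last by bmf_tac.
  rewrite [X in _ = _ - _ * X]meanB; [|by []|exact: bmf_cst].
  by rewrite mean_cst EL subrr mulr0 subr0.
apply/eqP; rewrite gt_eqF//.
have bf : bmf (fun u : conf => far (tnth u i, tnth u j)).
  have [mf fM] := bfar.
  apply: (@bmf_comp _ _ _ _ _ far (fun u : conf => (tnth u i, tnth u j))) => //.
  by apply: measurable_fun_pair; exact: measurable_tnth.
apply: (@lt_le_trans _ _ (th ^+ 4 * kap)).
  by rewrite mulr_gt0// exprn_gt0.
apply: (@le_trans _ _ (mean Pi (fun u => th ^+ 4 * far (tnth u i, tnth u j)))).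
  rewrite meanZl// ler_wpM2l ?exprn_ge0// -(resampleE i)//.
  rewrite -[leLHS](mean_cst Pi); apply: le_mean; [exact: bmf_cst|exact: bmf_resample|].
  move=> u; apply: le_trans (far_ge (tnth u j)) _.
  rewrite le_eqVlt; apply/orP; left; apply/eqP; apply: eq_mean => y.
  rewrite !tnth_upd eqxx.
  have ji : j != i by rewrite -val_eqE /= -ij gtn_eqF.
  by rewrite (negbTE ji).
apply: le_mean; [by bmf_tac..|] => u.
have [->|fn0] := eqVneq (far (tnth u i, tnth u j)) 0.
  by rewrite mulr0 sqr_ge0.
rewrite /L (fresh_penultimate u ij jn) far_disj// subr0.
have -> : (th - th * q) ^+ 2 = th ^+ 4 by ring.
by rewrite ler_piMr ?exprn_ge0//; have /andP[] := far01 (tnth u i, tnth u j).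
Qed.

Lemma sum_gain_le u : \sum_(i : 'I_n) q ^+ i * fresh full i u <= covered u.
Proof.
rewrite /covered -sum_fresh; under [leRHS]eq_bigl do rewrite inE.
apply: ler_sum => i _; rewrite ler_piMl ?fresh_ge0//.
by rewrite exprn_ile1 ?(ltW q0).
Qed.

Lemma card_tail m : (m <= n)%N -> #|tail full m| = (n - m)%N.
Proof.
move=> mn; rewrite -{1}(subKn mn); elim: (n - m)%N (leq_subr m n) => [|k ih] kn.
  by rewrite subn0 tailn cards0.
have kn' : (n - k.+1 < n)%N by rewrite ltn_subrL (leq_trans _ kn).
rewrite -[(n - k.+1)%N]/(nat_of_ord (Ordinal kn')) tail_recl ?inE//.
by rewrite cardsU1 notin_tail/= subnSK// ih// ltnW.
Qed.

(** All terms have the same mean [th * q ^+ n.-1]: the weight supplies [q ^+ i] and the points after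
    [i] supply the remaining factors. *)
Lemma mean_sum_gain_le :
  mean Pi (fun u => \sum_(i : 'I_n) q ^+ i * fresh full i u) <= mean Pi covered.
Proof.
rewrite mean_sum; last by move=> i; bmf_tac.
rewrite mean_covered; apply: le_trans (mul_expr_le n).
rewrite (_ : n%:R * th * q ^+ n.-1 = \sum_(i < n) th * q ^+ n.-1); last first.
  by rewrite sumr_const card_ord -[RHS]mulr_natl mulrA.
rewrite le_eqVlt; apply/orP; left; apply/eqP; apply: eq_bigr => i _.
rewrite meanZl; last exact: bfresh.
have bE := bmf_resample nu Pi i (bfresh full i).
rewrite -(resampleE i)// (eq_mean Pi (resample_fresh i)) meanZl; last exact: bvac.
rewrite mean_vac mulrCA -exprD; congr (_ * q ^+ _).
by rewrite card_tail// subnS -[X in (i + X)%N]subn1 addnBA ?subn_gt0// subnKC ?subn1// ltnW.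
Qed.

(** With x = n th, the covered measure is at most min(1, x), which is at most 2x / (1 + x), while
    the mean is at least x / (1 + x) by [bernoulli_le]. *)
Lemma covered_le_mean u (k : 'I_n) : covered u <= 2 * mean Pi covered.
Proof.
rewrite mean_covered /covered.
have v1 : 1 - vac full u <= 1 by rewrite gerBl vac_ge0.
have vn := vac_ge k u full.
have := bernoulli_le n.
move: (1 - vac _ _) v1 vn (q ^+ n) => v v1 vn Q.
have x0 : 0 <= n%:R * th by rewrite mulr_ge0.
move: (n%:R * th) x0 vn => x x0 vn Qx.
have x1 : 0 < 1 + x by rewrite ltr_pwDl.
rewrite -(ler_pM2r x1); nra.
Qed.

Lemma covered_upd_norm u k y : `|covered (upd u k y) - covered u| <= th.
Proof.
have kf : k \in full by rewrite inE.
rewrite /covered (vacD1 (upd u k y) kf) (vacD1 u kf).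
have iv : indep k (vac (full :\ k)) by apply: indep_vac; rewrite setD11.
rewrite iv.
have := excl_ge0 k (full :\ k) u; have := excl_le k (full :\ k) u.
have := excl_ge0 k (full :\ k) (upd u k y).
have := excl_le k (full :\ k) (upd u k y).
move: (excl _ _ u) (excl _ _ _) (vac _ _) => a b v ? ? ? ?.
by rewrite ler_norml; apply/andP; split; lra.
Qed.

Lemma resample_covered k u : covered u - resample nu k covered u = gain full k u.
Proof.
have kf : k \in full by rewrite inE.
rewrite -(resample_vac _ kf) /covered resampleB//; last exact: bmf_cst.
rewrite [X in _ - (X - _)](_ : _ = 1); last exact: mean_cst.
ring.
Qed.

(** A single extra point serves all [i]: the coupling identities are sums of terms that each involve
    one resampled coordinate. *)
Let P2 := prod_prob Pi nu.

Let mean_fst (F : conf -> R) : bmf F -> mean P2 (F \o fst) = mean Pi F.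
Proof.
move=> bF; have [mF FM] := bF.
rewrite mean_prod12; last exact: (bmf_comp (@measurable_fst _ _ _ _) mF FM).
by apply: eq_mean => u; exact: (mean_cst nu (F u)).
Qed.

Let bfst (F : conf -> R) : bmf F -> bmf (fun z : conf * X => F z.1).
Proof. by move=> [mF FM]; exact: (bmf_comp (@measurable_fst _ _ _ _) mF FM). Qed.

Let bcomp (f : R -> R) (d : measure_display) (T : measurableType d)
    (F : T -> R) :
  measurable_fun setT f -> (exists M : R, forall x : R, `|f x| <= M) -> bmf F ->
  bmf (fun t => f (F t)).
Proof. by move=> mf fM [mF _]; exact: (bmf_comp mF mf fM). Qed.

Let bV' k : bmf (fun z : conf * X => covered (upd z.1 k z.2)).
Proof. exact: (bmf_upd k bcovered). Qed.

Local Notation mu := (mean Pi covered).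
Local Notation sigma := (std_dev Pi covered).

Lemma kolmogorov_dist_covered (k0 : 'I_n) (tau y : R) :
  0 < std_dev Pi covered -> 0 <= tau ->
  n%:R * (9 * n%:R * th ^+ 5 + 16 * n%:R ^+ 2 * th ^+ 6) <= tau ^+ 2 ->
  0 < y ->
  kolmogorov_dist Pi covered * y <=
    mu * th ^+ 2 / sigma ^+ 3 * y ^+ 2 / 2 +
    (tau / sigma ^+ 2 + 3 * (mu * th ^+ 2 / sigma ^+ 3)) * (y + 1).
Proof.
move=> sd0 tau0 varT y0.
have mfst : measurable_fun setT (@fst conf X) by exact: measurable_fst.
pose V : conf * X -> R := covered \o fst.
have EV : mean P2 V = mu by exact: mean_fst.
have SV : std_dev P2 V = sigma by exact: (std_dev_transfer mfst).
rewrite -(kolmogorov_dist_transfer mfst mean_fst bcovered) -/V.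
rewrite -SV -EV.
have bVV : bmf V by exact: bfst.
(* The covariance formula applied to [covered] itself. *)
have ES : mean Pi (wsum full) = sigma ^+ 2.
  rewrite std_dev_sq//.
  transitivity (mean Pi (fun u => (covered u - mean Pi covered) * covered u)).
    rewrite covariance_covered//; apply: eq_mean => u.
    rewrite /wsum; under eq_bigl do rewrite inE.
    by apply: eq_bigr => i _; rewrite resample_covered.
  transitivity (mean Pi (fun u => (covered u - mean Pi covered) ^+ 2 +
      mean Pi covered * (covered u - mean Pi covered))).
    by apply: eq_mean => u; ring.
  rewrite meanD; [|by bmf_tac..]; rewrite [X in _ + X]meanZl; last by bmf_tac.
  by rewrite [X in _ + _ * X]meanB ?mean_cst ?subrr ?mulr0 ?addr0//; exact: bmf_cst.
apply: (@kolmogorov_dist_stein _ _ _ P2 n V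
  (fun i z => q ^+ i * fresh full i z.1)
  (fun i z => covered (upd z.1 i z.2)) (fun z => wsum full z.1) th tau) => //.
- move=> i; apply: (bfst (F := fun u => q ^+ i * fresh full i u)).
  by apply: bmfM => //; exact: bmf_cst.
- exact: bfst.
- by move=> i z; rewrite mulr_ge0 ?fresh_ge0 ?exprn_ge0// ltW.
- by move=> z; rewrite EV; apply: le_trans (sum_gain_le _) (covered_le_mean _ k0).
- rewrite EV; apply: le_trans mean_sum_gain_le.
  rewrite -(mean_fst (F := fun u => \sum_(i : 'I_n) q ^+ i * fresh full i u))//.
  by bmf_tac.
- by move=> i z; exact: covered_upd_norm.
- move=> f mf fM; rewrite EV.
  have bf : bmf (fun u => f (covered u)) by exact: bcomp.
  have bfV' i : bmf (fun z : conf * X => f (covered (upd z.1 i z.2))).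
    exact: bcomp (bV' i).
  have := mean_fst (F := fun u => (covered u - mu) * f (covered u)).
  rewrite /comp /= => ->; last by bmf_tac.
  rewrite covariance_covered// mean_prod12; last first.
    apply: bmf_sum => i; apply: bmfM; last by apply: bmfB => //; exact: (bfst bf).
    by apply: bmfM; [exact: bmf_cst | exact: (bfst (bfresh full i))].
  apply: eq_mean => u; rewrite /V /=.
  rewrite mean_sum.
    apply: eq_bigr => i _.
    have bu : bmf (fun y => f (covered (upd u i y))) := bmf_pair1 u (bfV' i).
    rewrite meanZl; last by apply: bmfB; [exact: bmf_cst|exact: bu].
    by rewrite meanB; [rewrite mean_cst|exact: bmf_cst|exact: bu].
  move=> i; apply: bmfM; first exact: bmf_cst.
  by apply: bmfB; [exact: bmf_cst | exact: (bmf_pair1 u (bfV' i))].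
- move=> g mg gM.
  have bg : bmf (fun u => g (covered u)) by exact: bcomp.
  have := mean_fst (F := fun u => wsum full u * g (covered u)).
  rewrite /comp /= => ->; last by bmf_tac.
  rewrite mean_prod12; last first.
    apply: bmf_sum => i; apply: bmfM; last exact: (bfst bg).
    apply: bmfM; last by apply: bmfB.
    by apply: bmfM; [exact: bmf_cst | exact: (bfst (bfresh full i))].
  apply: eq_mean => u; rewrite /V /=.
  have bu i : bmf (fun y => covered (upd u i y)) := bmf_pair1 u (bV' i).
  rewrite mean_sum; last first.
    move=> i; apply: bmfM; last exact: bmf_cst.
    by apply: bmfM; [exact: bmf_cst|apply: bmfB; [exact: bmf_cst|exact: bu]].
  rewrite /wsum mulr_suml; under [RHS]eq_bigl do rewrite inE.
  apply: eq_bigr => i _.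
  rewrite meanZr; last by apply: bmfM; [exact: bmf_cst|apply: bmfB; [exact: bmf_cst|exact: bu]].
  rewrite meanZl; last by apply: bmfB; [exact: bmf_cst|exact: bu].
  by rewrite meanB; [rewrite mean_cst resample_covered|exact: bmf_cst|exact: bu].
- rewrite SV; apply: le_trans varT; apply: le_trans variance_wsum.
  rewrite -(mean_fst (F := fun u => (wsum full u - mean Pi (wsum full)) ^+ 2)).
    by rewrite ES.
  by bmf_tac.
- by rewrite SV.
(* The remaining condition, variance at most [mu * th], follows by bounding every gain by [th]. *)
rewrite SV EV -ES.
apply: (@le_trans _ _ (mean Pi (fun u =>
    (\sum_(i : 'I_n) q ^+ i * fresh full i u) * th))).
  apply: le_mean; [by []|by bmf_tac|] => u.
  rewrite /wsum mulr_suml; under eq_bigl do rewrite inE.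
  apply: ler_sum => i _; rewrite ler_wpM2l ?mulr_ge0 ?fresh_ge0 ?exprn_ge0 ?(ltW q0)//.
  by rewrite ler_normlW// gain_norm ?inE.
rewrite meanZr; last by bmf_tac.
by rewrite ler_wpM2r// mean_sum_gain_le.
Qed.

End fluctuations.

End coverage.

(** * The joint law of the centres *)

Section law.
Context d1 d2 (T1 : measurableType d1) (T2 : measurableType d2) (R : realType).
Variables (P : probability T1 R) (g : T1 -> T2).
Hypothesis mg : measurable_fun setT g.

Definition law : probability T2 R := distribution P (mfun_Sub (mem_set mg)).

Lemma lawE A : law A = P (g @^-1` A).
Proof. by []. Qed.

Lemma mean_law F : bmf F -> mean law F = mean P (F \o g).
Proof.
move=> bF; have [mF FM] := bF.
apply: EFin_inj; rewrite !EFin_mean//; last exact: bmf_comp.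
rewrite integral_distribution//; first exact/measurable_EFinP.
by apply: (@bmf_integrable _ _ _ P (F \o g)); exact: bmf_comp.
Qed.

End law.

Lemma mean_eq_measure d (T : measurableType d) (R : realType)
    (P1 P2 : probability T R) (F : T -> R) : bmf F ->
  (forall A, measurable A -> P1 A = P2 A) -> mean P1 F = mean P2 F.
Proof.
move=> bF P12; apply: EFin_inj; rewrite !EFin_mean//.
by apply: eq_measure_integral => A mA _; exact: P12.
Qed.

Section boxes.
Context dX (X : measurableType dX) (R : realType) (n : nat).
Local Notation conf := (n.-tuple X)%type.

Definition box (B : 'I_n -> set X) : set conf := [set u | forall i, B i (tnth u i)].

Definition boxes : set (set conf) :=
  [set A | exists B, (forall i, measurable (B i)) /\ A = box B].

Lemma boxE B : box B = \bigcap_(i in [set: 'I_n]) (@tnth n X ^~ i @^-1` B i).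
Proof. by apply/seteqP; split => u /= Bu i; [move=> _; exact: Bu|exact: Bu]. Qed.

Lemma measurable_box B : (forall i, measurable (B i)) -> measurable (box B).
Proof.
move=> mB; rewrite boxE; apply: fin_bigcap_measurable => // i _.
by rewrite -[X in measurable X]setTI; exact: measurable_tnth.
Qed.

Lemma boxesI : setI_closed boxes.
Proof.
move=> _ _ [B [mB ->]] [C [mC ->]]; exists (fun i => B i `&` C i); split.
  by move=> i; exact: measurableI.
apply/seteqP; split => u /=; first by move=> [Bu Cu] i.
by move=> BC; split=> i; have [] := BC i.
Qed.

Lemma boxes_gen : (measurable : set (set conf)) = <<s boxes >>.
Proof.
apply/seteqP; split; last first.
  apply: smallest_sub; first exact: sigma_algebra_measurable.
  by move=> _ [B [mB ->]]; exact: measurable_box.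
apply: smallest_sub; first exact: smallest_sigma_algebra.
move=> A; rewrite -bigcup_seq => -[i _] [B mB <-].
apply: sub_sigma_algebra.
exists (fun j => if j == i then B else setT); split.
  by move=> j; case: ifP.
apply/seteqP; split => u /=.
  by move=> [_ Bu] j; case: eqP => // ->.
by move=> /(_ i); rewrite eqxx.
Qed.

Lemma eq_on_boxes (P1 P2 : probability conf R) :
  (forall B, (forall i, measurable (B i)) -> P1 (box B) = P2 (box B)) ->
  forall A, measurable A -> P1 A = P2 A.
Proof.
move=> P12 A mA.
apply: (measure_unique boxes (fun=> setT)) => //.
- exact: boxes_gen.
- exact: boxesI.
- move=> _; exists (fun=> setT); split => //.
  by apply/seteqP; split.
- by rewrite bigcup_const//; exists 0%N.
- by move=> _ [B [mB ->]]; exact: P12.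
- move=> _; apply: (le_lt_trans (probability_le1 P1 measurableT)); exact: ltry.
Qed.

End boxes.

Section joint_law.
Context dT (T : measurableType dT) dX (X : measurableType dX) (R : realType).
Variables (P : probability T R) (n : nat) (U : 'I_n -> {RV P >-> X}).
Variable nu : probability X R.
Hypothesis lawU : forall i A, measurable A -> P (U i @^-1` A) = nu A.
Hypothesis indU : independent_RVs U.

Definition joint (w : T) : n.-tuple X := [tuple U i w | i < n].

Lemma measurable_joint : measurable_fun setT joint.
Proof.
apply/measurable_fun_tnthP => i.
rewrite (_ : _ \o _ = U i); first exact: measurable_funP.
by apply/funext => w /=; rewrite tnth_mktuple.
Qed.

Let Pi := law P measurable_joint.

Lemma joint_box (B : 'I_n -> set X) : (forall i, measurable (B i)) ->
  Pi (box B) = (\prod_i fine (nu (B i)))%:E.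
Proof.
move=> mB; rewrite lawE.
have -> : joint @^-1` box B = \bigcap_(i in [set` [set: 'I_n]%SET]) U i @^-1` B i.
  apply/seteqP; split => w /=.
    by move=> Bw i _; have := Bw i; rewrite tnth_mktuple.
  by move=> Bw i; rewrite tnth_mktuple; apply: Bw; rewrite /= inE.
rewrite -[LHS]fineK; last first.
  apply: fin_num_measure; apply: fin_bigcap_measurable => // i _.
  by rewrite -[X in measurable X]setTI; exact: measurable_funP.
rewrite indU//; congr EFin; under eq_bigl do rewrite inE.
by apply: eq_bigr => i _; rewrite lawU.
Qed.

(** A configuration with one fresh coordinate has the original law. On a box, the discarded
    coordinate is unconstrained and the fresh one supplies the missing factor. *)
Lemma joint_resample i (F : n.-tuple X -> R) : bmf F ->
  mean Pi (resample nu i F) = mean Pi F.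
Proof.
move=> bF; have bFu := bmf_upd i bF.
have -> : mean Pi (resample nu i F) =
    mean (law (prod_prob Pi nu) (@measurable_upd _ _ _ i)) F.
  by rewrite mean_law// mean_prod12.
apply: mean_eq_measure => //; apply: eq_on_boxes => B mB.
rewrite joint_box// lawE.
pose B' j := if j == i then setT else B j.
have mB' j : measurable (B' j) by rewrite /B'; case: ifP.
have -> : (fun z : n.-tuple X * X => upd z.1 i z.2) @^-1` box B =
    box B' `*` B i.
  apply/seteqP; split => -[u y] /=.
    move=> Bu; split; last by have := Bu i; rewrite tnth_upd eqxx.
    by move=> j; rewrite /B'; have := Bu j; rewrite tnth_upd; case: ifP.
  by move=> [Bu By] j; have := Bu j; rewrite /B' tnth_upd; case: eqP => [->|].
have -> : prod_prob Pi nu (box B' `*` B i) = (Pi (box B') * nu (B i))%E.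
  by apply: product_measure1E => //; exact: measurable_box.
rewrite joint_box// -[nu (B i)]fineK ?fin_num_measure// -EFinM; congr EFin.
rewrite (bigD1 i)//= [RHS](bigD1 i)//= /B' eqxx mulrC.
have -> : fine (nu setT) = 1 by rewrite probability_setT.
rewrite mul1r; congr (_ * _); apply: eq_bigr => j ji.
by rewrite (negbTE ji).
Qed.

End joint_law.

(** * Geometry of the torus *)

Section affine_invariance.
Variable R : realType.
Local Notation mu := (@lebesgue_measure R).

Lemma measurable_affine (a b : R) :
  measurable_fun setT (fun y : measurableTypeR R => a * y + b : measurableTypeR R).
Proof. by apply: measurable_funD => //; apply: measurable_funM. Qed.

Lemma lebesgue_measure_affine (a b : R) (A : set R) : 0 < a -> measurable A ->
  (a%:E * mu ((fun y => a * y + b)%R @^-1` A) = mu A)%E.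
Proof.
move=> a0 mA.
pose f : measurableTypeR R -> measurableTypeR R := fun y => a * y + b.
have mf : measurable_fun setT f := @measurable_affine a b.
pose m : {measure set (measurableTypeR R) -> \bar R} :=
  mscale (NngNum (ltW a0)) (measure_function_pushforward__canonical__measure_function_Measure mu mf).
rewrite -[LHS]/(m A); apply/esym; apply: lebesgue_measure_unique => // X [[u v] _ <-].
rewrite -[RHS]/(a%:E * mu (f @^-1` `]u, v]%classic))%E.
have -> : f @^-1` `]u, v]%classic = `](u - b) / a, (v - b) / a]%classic.
  apply/seteqP; split => y /=; rewrite !in_itv/= /f.
    by rewrite ltr_pdivrMr// ler_pdivlMr// [y * a]mulrC ltrBlDr lerBrDr.
  by rewrite ltr_pdivrMr// ler_pdivlMr// [y * a]mulrC ltrBlDr lerBrDr.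
rewrite !lebesgue_measure_itv/= !lte_fin ltr_pM2r ?invr_gt0// ltrD2r.
case: ifP => uv; last by rewrite mule0.
by rewrite -!EFinD -EFinM; congr EFin; field; rewrite gt_eqF.
Qed.

Lemma lebesgue_measure_reflect (b : R) (A : set R) : measurable A ->
  mu ((fun y => b - y) @^-1` A) = mu A.
Proof.
move=> mA.
have mB : measurable ((fun y : R => 1 * y + b) @^-1` A).
  by rewrite -[X in measurable X]setTI; exact: (@measurable_affine 1 b).
rewrite -[RHS](@lebesgue_measure_affine 1 b)// mul1e -(lebesgue_measureN mB).
congr (mu _); apply/seteqP; split => y /=; rewrite mul1r addrC; exact.
Qed.

End affine_invariance.

Section reduction.
Variables (R : realType) (L : R).
Hypothesis L0 : 0 < L.
Local Notation mu := (@lebesgue_measure R).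
Implicit Types t x y : R.

(* The representative of [t] modulo [L] in [[- L / 2, L / 2[]. *)
Definition red t : R := t - (Num.floor (t / L + 1 / 2))%:~R * L.

Lemma redE t (k : int) : - (L / 2) <= t - k%:~R * L < L / 2 ->
  red t = t - k%:~R * L.
Proof.
move=> /andP[tk1 tk2]; rewrite /red (@floor_def _ _ k)//; apply/andP; split.
  by rewrite -(ler_pM2r L0) mulrDl divfK ?gt_eqF//; lra.
by rewrite intrD -(ltr_pM2r L0) mulrDl divfK ?gt_eqF//; lra.
Qed.

Lemma red_bounds t : - (L / 2) <= red t < L / 2.
Proof.
have /andP[] := floor_itv (t / L + 1 / 2).
rewrite -(ler_pM2r L0) [(_ + 1 / 2) * L]mulrDl divfK ?gt_eqF// => f1.
rewrite intrD -(ltr_pM2r L0) [(_ + 1 / 2) * L]mulrDl divfK ?gt_eqF// => f2.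
by rewrite /red; apply/andP; split; lra.
Qed.

Lemma red_int t : exists k : int, red t = t + k%:~R * L.
Proof.
by exists (- Num.floor (t / L + 1 / 2)); rewrite /red mulrNz mulNr.
Qed.

Lemma red_min t (k : int) : `|red t| <= `|t + k%:~R * L|.
Proof.
have [l tl] := red_int t; have /andP[r1 r2] := red_bounds t.
have -> : t + k%:~R * L = red t + (k - l)%:~R * L.
  by rewrite tl rmorphB/=; ring.
move: (red t) r1 r2 => r r1 r2; move: (k - l) => m.
have [->|m0] := eqVneq m 0; first by rewrite mul0r addr0.
have mL : L <= `|m%:~R * L|.
  rewrite normrM (gtr0_norm L0) ler_peMl ?(ltW L0)// -intr_norm.
  by rewrite -[1]/(1%:~R) ler_int -gtz0_ge1 normr_gt0.
have : `|r| <= L / 2 by rewrite ler_norml; apply/andP; split; lra.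
by have := lerB_normD (m%:~R * L) r; rewrite [r + _]addrC; lra.
Qed.

Lemma measurable_red : measurable_fun setT red.
Proof.
apply: measurable_funB => //; apply: measurable_funM => //.
apply: nondecreasing_measurable => // x y xy.
by rewrite ler_int le_floor ?lerD2r ?ler_pM2r ?invr_gt0.
Qed.

(** Up to the cut at [red x + L / 2] the map is the reflection in [red x], beyond it the same
    reflection shifted by one period; the images [B1] and [B2] partition the target. *)
Lemma lebesgue_measure_red x (B : set R) : measurable B ->
  mu (`[0, L[ `&` (fun y => red (x - y)) @^-1` B) =
  mu (`[- (L / 2), L / 2[ `&` B).
Proof.
move=> mB.
have /andP[e1 e2] := red_bounds x; have [k ek] := red_int x.
pose B1 := `[- (L / 2), red x] `&` B; pose B2 := `]red x, L / 2[ `&` B.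
have mB1 : measurable B1 by exact: measurableI.
have mB2 : measurable B2 by exact: measurableI.
have red1 y : 0 <= y <= red x + L / 2 -> red (x - y) = red x - y.
  move=> /andP[y0 y1]; rewrite (@redE _ (- k)).
    by rewrite ek rmorphN/=; ring.
  have -> : x - y - (- k)%:~R * L = red x - y by rewrite ek rmorphN/=; ring.
  by apply/andP; split; lra.
have red2 y : red x + L / 2 < y < L -> red (x - y) = red x + L - y.
  move=> /andP[y0 y1]; rewrite (@redE _ (- k - 1)).
    by rewrite ek rmorphB/= rmorphN/=; ring.
  have -> : x - y - (- k - 1)%:~R * L = red x + L - y.
    by rewrite ek rmorphB/= rmorphN/=; ring.
  by apply/andP; split; lra.
have -> : `[0, L[ `&` (fun y => red (x - y)) @^-1` B =
    (fun y => red x - y) @^-1` B1 `|` (fun y => red x + L - y) @^-1` B2.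
  apply/seteqP; split => y; rewrite /B1 /B2 /= !in_itv/=.
    move=> [/andP[y0 yL] By].
    have [yx|yx] := leP y (red x + L / 2).
      left; rewrite red1 ?y0// in By; split => //.
      by apply/andP; split; lra.
    right; rewrite red2 ?yx// in By; split => //.
    by apply/andP; split; lra.
  move=> [[/andP[y1 y2] By]|[/andP[y1 y2] By]].
    rewrite red1; last by apply/andP; split; lra.
    by split => //; apply/andP; split; lra.
  rewrite red2; last by apply/andP; split; lra.
  by split => //; apply/andP; split; lra.
have mreflect b A : measurable A -> measurable ((fun y : R => b - y) @^-1` A).
  move=> mA; rewrite -[X in measurable X]setTI.
  by apply: measurable_funB.
rewrite measureU; [|exact: mreflect|exact: mreflect|]; last first.
  apply/seteqP; split => // y; rewrite /B1 /B2 /= !in_itv/=.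
  by move=> [[/andP[? ?] _] [/andP[? ?] _]]; lra.
transitivity (mu B1 + mu B2)%E.
  by congr (_ + _)%E; exact: lebesgue_measure_reflect.
rewrite -measureU//.
  rewrite /B1 /B2 -setIUl; congr (mu (_ `&` _)).
  apply/seteqP; split => y /=; rewrite !in_itv/=.
    by move=> [|] /andP[? ?]; apply/andP; split; lra.
  move=> /andP[y1 y2]; have [yx|yx] := leP y (red x).
    by left; apply/andP; split; lra.
  by right; apply/andP; split; lra.
apply/seteqP; split => // y; rewrite /B1 /B2 /= !in_itv/=.
by move=> [[/andP[? ?] _] [/andP[? ?] _]]; lra.
Qed.

End reduction.

Section lebesgue_tuple_affine.
Variables (R : realType) (d : nat).
Local Notation X := (d.-tuple R)%type.
Local Notation lam := (@lebesgue_tuple R d).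
Local Notation mu := (@lebesgue_measure R).

Definition taffine (a : R) (b : X) (z : X) : X :=
  [tuple a * tnth z i + tnth b i | i < d].

Lemma measurable_taffine a b : measurable_fun setT (taffine a b).
Proof.
apply/measurable_fun_tnthP => i.
rewrite (_ : _ \o _ = fun z : X => a * tnth z i + tnth b i).
  apply: measurable_funD => //; apply: measurable_funM => //.
  exact: measurable_tnth.
by apply/funext => z /=; rewrite tnth_mktuple.
Qed.

Lemma lebesgue_tuple_box_lty (a b : R) :
  (lam (box (fun _ : 'I_d => `[a, b]%classic)) < +oo)%E.
Proof.
rewrite lebesgue_tuple_box//.
have e : mu `[a, b]%classic = (fine (mu `[a, b]%classic))%:E.
  by rewrite fineK// lebesgue_measure_itv; case: ifP.
by under eq_bigr do rewrite e; rewrite prodEFin ltry.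
Qed.

(** The two measures agree on boxes, a generating pi-system with an exhaustion by cubes of finite
    measure. *)
Lemma lebesgue_tuple_affine (a : R) (b : X) (A : set X) :
  0 < a -> measurable A ->
  ((a ^+ d)%:E * lam (taffine a b @^-1` A) = lam A)%E.
Proof.
move=> a0 mA.
pose m : {measure set X -> \bar R} := mscale (NngNum (ltW (exprn_gt0 d a0)))
  (measure_function_pushforward__canonical__measure_function_Measure lam
     (@measurable_taffine a b)).
rewrite -[LHS]/(m A).
have bxE (B : 'I_d -> set R) : (forall i, measurable (B i)) ->
    m (box B) = lam (box B).
  move=> mB; rewrite -[LHS]/((a ^+ d)%:E * lam (taffine a b @^-1` box B))%E.
  pose C i := (fun y => a * y + tnth b i) @^-1` B i.
  have mC i : measurable (C i).
    by rewrite -[X in measurable X]setTI; exact: (@measurable_affine R a (tnth b i) measurableT (B i) (mB i)).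
  have -> : taffine a b @^-1` box B = box C.
    by apply/seteqP; split => z /= Bz i; have := Bz i; rewrite tnth_mktuple.
  rewrite !lebesgue_tuple_box//.
  have -> : (a ^+ d)%:E = (\prod_(i < d) a%:E)%E.
    by rewrite prodEFin prodr_const card_ord.
  rewrite -big_split/=; apply: eq_bigr => i _.
  exact: lebesgue_measure_affine.
pose lam' : {measure set X -> \bar R} := lam.
pose cover k : set X := box (fun _ : 'I_d => `[- k%:R, k%:R : R]%classic).
have H := @measure_unique _ R X (@boxes _ R d) cover _ _ _ _ m lam'.
apply: H => //.
- exact: boxes_gen.
- exact: boxesI.
- by move=> k; exists (fun _ => `[- k%:R, k%:R]%classic).
- apply/seteqP; split => // u _.
  exists (Num.bound (\sum_i `|tnth u i|)) => // i /=.
  rewrite in_itv/= -ler_norml (le_trans _ (ltW (archi_boundP _)))//.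
    by rewrite (bigD1 i)//= lerDl sumr_ge0.
  by rewrite sumr_ge0.
- by move=> _ [B [mB ->]]; exact: bxE.
- by move=> k; rewrite bxE//; exact: lebesgue_tuple_box_lty.
Qed.

Definition norm2 (v : X) : R := \sum_i tnth v i ^+ 2.

Lemma measurable_norm2 : measurable_fun setT norm2.
Proof.
apply: measurable_sum => i; apply: measurable_funX.
exact: measurable_tnth.
Qed.

Lemma measurable_norm2_le s : measurable [set v | norm2 v <= s].
Proof.
rewrite (_ : [set v | _] = norm2 @^-1` `]-oo, s]).
  by rewrite -[X in measurable X]setTI; exact: measurable_norm2.
by apply/seteqP; split => v /=; rewrite in_itv.
Qed.

Lemma euclidean_norm_le (v : 'I_d -> R) r : 0 <= r ->
  (euclidean_norm v <= r) = (\sum_i v i ^+ 2 <= r ^+ 2).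
Proof.
move=> r0; rewrite /euclidean_norm -[in LHS](ger0_norm r0) -sqrtr_sqr.
by rewrite ler_sqrt// sqr_ge0.
Qed.

Lemma measurable_euclidean_ball (b : X) s :
  measurable [set v : X | \sum_i (tnth b i - tnth v i) ^+ 2 <= s].
Proof.
rewrite (_ : [set v | _] = (fun v : X => \sum_i (tnth b i - tnth v i) ^+ 2)
  @^-1` `]-oo, s]).
  rewrite -[X in measurable X]setTI.
  suff mf : measurable_fun setT (fun v : X => \sum_i (tnth b i - tnth v i) ^+ 2).
    exact: mf.
  apply: measurable_sum => i; apply: measurable_funX.
  by apply: measurable_funB => //; exact: measurable_tnth.
by apply/seteqP; split => v /=; rewrite in_itv.
Qed.

Lemma lebesgue_ball (r : R) (b : X) : 0 < r ->
  lam [set v | \sum_i (tnth b i - tnth v i) ^+ 2 <= r ^+ 2] =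
  (unit_ball_volume R d * r ^+ d)%:E.
Proof.
move=> r0.
have mS := measurable_euclidean_ball b (r ^+ 2).
rewrite -(@lebesgue_tuple_affine r b)//.
have -> : taffine r b @^-1` [set v : X | \sum_i (tnth b i - tnth v i) ^+ 2 <= r ^+ 2] =
    [set x : X | euclidean_norm (tnth x) <= 1].
  apply/seteqP; split => z /=; rewrite euclidean_norm_le// expr1n.
    under eq_bigr => i _ do rewrite tnth_mktuple opprD addrCA subrr addr0 sqrrN exprMn.
    by rewrite -mulr_sumr ger_pMr// exprn_gt0.
  under [X in _ -> X <= _]eq_bigr => i _ do
    rewrite tnth_mktuple opprD addrCA subrr addr0 sqrrN exprMn.
  by rewrite -mulr_sumr ger_pMr// exprn_gt0.
rewrite [RHS]EFinM muleC; congr (_ * _)%E.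
(* The truncation [fine] is exact because the unit ball lies in the cube with sides [-1, 1]. *)
rewrite /unit_ball_volume fineK// ge0_fin_numE//.
apply: le_lt_trans (lebesgue_tuple_box_lty (-1) 1).
apply: le_measure; rewrite ?inE; last 2 first.
- by apply: measurable_box.
- move=> z /=; rewrite euclidean_norm_le// expr1n => z1 i /=.
  rewrite in_itv/= -ler_norml -(@ler_sqr _ _ 1) ?nnegrE// expr1n real_normK ?num_real//.
  by apply: le_trans z1; rewrite (bigD1 i)//= lerDl sumr_ge0// => j _; exact: sqr_ge0.
rewrite (_ : [set x | _] = [set v | norm2 v <= 1]); first exact: measurable_norm2_le.
by apply/seteqP; split => z /=; rewrite euclidean_norm_le// expr1n.
Qed.

End lebesgue_tuple_affine.

Section torus.
Variables (R : realType) (d n : nat).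
Hypotheses (d0 : (0 < d)%N) (n0 : (0 < n)%N).
Local Notation X := (d.-tuple R)%type.
Local Notation lam := (@lebesgue_tuple R d).
Local Notation mu := (@lebesgue_measure R).
Local Notation L := (torus_side R d n).
Local Notation C := (@torus R d n).
Implicit Types x y z : X.

Let nR : (0 : R) < n%:R. Proof. by rewrite ltr0n. Qed.

Lemma torus_side_gt0 : 0 < L.
Proof. exact: powR_gt0. Qed.

Let L0 := torus_side_gt0.

Lemma torus_side_expn : L ^+ d = n%:R.
Proof.
rewrite -powR_mulrn ?ltW// /torus_side -powRrM mulVf ?pnatr_eq0 -?lt0n//.
by rewrite powRr1// ltW.
Qed.

Lemma torusE : C = box (fun _ : 'I_d => `[0, L[%classic).
Proof. by apply/seteqP; split => x /= Cx i; have := Cx i; rewrite /= in_itv. Qed.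

Lemma measurable_torus : measurable C.
Proof. by rewrite torusE; apply: measurable_box. Qed.

Lemma lebesgue_torus : lam C = n%:R%:E.
Proof.
rewrite torusE lebesgue_tuple_box//.
under eq_bigr do rewrite lebesgue_measure_itv/= lte_fin L0 -EFinB subr0.
by rewrite prodEFin prodr_const card_ord torus_side_expn.
Qed.

Definition tdiff x y : X := [tuple red L (tnth x i - tnth y i) | i < d].

Definition tdist2 x y : R := norm2 (tdiff x y).

Lemma tdist2E x y : tdist2 x y = \sum_i red L (tnth x i - tnth y i) ^+ 2.
Proof. by apply: eq_bigr => i _; rewrite tnth_mktuple. Qed.

(** The period is chosen separately in each coordinate, so the infimum splits and is attained by the
    reduced representatives. *)
Lemma torus_distE x y : torus_dist n x y =
  euclidean_norm (fun i => red L (tnth x i - tnth y i)).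
Proof.
rewrite /torus_dist; set S := (X in inf X).
have lbS : lbound S (euclidean_norm (fun i => red L (tnth x i - tnth y i))).
  move=> _ [k _ <-]; apply: ler_wsqrtr; apply: ler_sum => i _.
  rewrite -[leLHS]real_normK ?num_real// -[leRHS]real_normK ?num_real//.
  by rewrite ler_sqr ?nnegrE// red_min.
have Sr : S (euclidean_norm (fun i => red L (tnth x i - tnth y i))).
  pose k i := xget 0%Z [set k : int | red L (tnth x i - tnth y i) =
    tnth x i - tnth y i + k%:~R * L].
  exists k => //; congr euclidean_norm; apply/funext => i.
  have [l kl] := red_int L (tnth x i - tnth y i).
  by rewrite /k; case: xgetP => [_ _ ->//|/(_ l)].
apply/eqP; rewrite eq_le; apply/andP; split.
  by apply: ge_inf => //; eexists; exact: lbS.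
by apply: lb_le_inf => //; eexists; exact: Sr.
Qed.

Lemma torus_dist_le x y r : 0 <= r -> (torus_dist n x y <= r) = (tdist2 x y <= r ^+ 2).
Proof. by move=> r0; rewrite torus_distE euclidean_norm_le// tdist2E. Qed.

Lemma tdist2C x y : tdist2 x y = tdist2 y x.
Proof.
have le a b : tdist2 a b <= tdist2 b a.
  rewrite !tdist2E; apply: ler_sum => i _.
  rewrite -[leLHS]real_normK ?num_real// -[leRHS]real_normK ?num_real//.
  rewrite ler_sqr ?nnegrE//.
  have [k ->] := red_int L (tnth b i - tnth a i).
  have := red_min L0 (tnth a i - tnth b i) (- k).
  rewrite rmorphN/= mulNr => /le_trans; apply.
  by rewrite -normrN opprD opprK opprB.
by apply/eqP; rewrite eq_le !le.
Qed.

(** Coordinatewise (b + e)^2 <= 2 b^2 + 2 e^2 suffices: for equal radii it gives exactly (2r)^2,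
    without Minkowski's inequality. *)
Lemma tdist2_triangle x y z r : tdist2 x y <= r ^+ 2 -> tdist2 x z <= r ^+ 2 ->
  tdist2 y z <= (2 * r) ^+ 2.
Proof.
rewrite (tdist2C x y) => h1 h2.
apply: (@le_trans _ _ (2 * tdist2 y x + 2 * tdist2 x z)); last first.
  by rewrite exprMn; lra.
rewrite !tdist2E !mulr_sumr -big_split/=; apply: ler_sum => i _.
have [k ek] := red_int L (tnth y i - tnth x i).
have [l el] := red_int L (tnth x i - tnth z i).
have := red_min L0 (tnth y i - tnth z i) (k + l).
have -> : tnth y i - tnth z i + (k + l)%:~R * L =
    red L (tnth y i - tnth x i) + red L (tnth x i - tnth z i).
  by rewrite ek el rmorphD/=; ring.
move: (red L (tnth y i - tnth z i)) (red L (tnth y i - tnth x i))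
  (red L (tnth x i - tnth z i)) => a b e abe.
have : a ^+ 2 <= (b + e) ^+ 2.
  by rewrite -[leLHS]real_normK ?num_real// -[leRHS]real_normK ?num_real// ler_sqr ?nnegrE.
have : 0 <= (b - e) ^+ 2 by exact: sqr_ge0.
move: (a ^+ 2) => a2; rewrite !expr2 => *; lra.
Qed.

Lemma measurable_tdist2 : measurable_fun setT (fun z : X * X => tdist2 z.1 z.2).
Proof.
under eq_fun do rewrite tdist2E.
apply: measurable_sum => i; apply: measurable_funX.
apply: (@measurableT_comp _ _ _ _ _ _ (red L)); first exact: measurable_red.
apply: measurable_funB.
  apply: (@measurableT_comp _ _ _ _ _ _ (fun u : X => tnth u i)) => //.
  exact: measurable_tnth.
apply: (@measurableT_comp _ _ _ _ _ _ (fun u : X => tnth u i)) => //.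
exact: measurable_tnth.
Qed.

Lemma measurable_tdiff x : measurable_fun setT (tdiff x).
Proof.
apply/measurable_fun_tnthP => i.
rewrite (_ : _ \o _ = (fun y : X => red L (tnth x i - tnth y i))).
  apply: (@measurableT_comp _ _ _ _ _ _ (red L)); first exact: measurable_red.
  by apply: measurable_funB => //; exact: measurable_tnth.
by apply/funext => y /=; rewrite tnth_mktuple.
Qed.

Lemma measurable_tball x s : measurable [set y | tdist2 x y <= s].
Proof.
rewrite (_ : [set y | _] = tdiff x @^-1` [set v | norm2 v <= s])//.
rewrite -[X in measurable X]setTI.
by apply: measurable_tdiff => //; exact: measurable_norm2_le.
Qed.

Section uniform.
Variable nu : probability X R.
Hypothesis nuE : forall A, measurable A ->
  nu A = ((fine (lam C))^-1%:E * lam (A `&` C))%E.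

Lemma uniformE A : measurable A -> nu A = (n%:R^-1%:E * lam (A `&` C))%E.
Proof. by move=> mA; rewrite nuE// lebesgue_torus. Qed.

(** The law of the reduced difference to [x] does not depend on [x]: on boxes it factors over the
    coordinates, each given by [lebesgue_measure_red]. *)
Lemma uniform_tball_const x x' s :
  nu [set y | tdist2 x y <= s] = nu [set y | tdist2 x' y <= s].
Proof.
apply: (@eq_on_boxes _ R R d (law nu (measurable_tdiff x))
  (law nu (measurable_tdiff x')) _ [set v | norm2 v <= s]); last first.
  exact: measurable_norm2_le.
have E (a : X) (B : 'I_d -> set R) : (forall i, measurable (B i)) ->
    law nu (measurable_tdiff a) (box B) =
    (n%:R^-1%:E * \prod_(i < d) mu (`[(- (L / 2))%R, (L / 2)%R[ `&` B i))%E.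
  move=> mB; rewrite lawE uniformE; last first.
    by rewrite -[X in measurable X]setTI; apply: measurable_tdiff => //; exact: measurable_box.
  congr (_ * _)%E.
  have -> : tdiff a @^-1` box B `&` C =
      box (fun i => `[0, L[ `&` (fun y : R => red L (tnth a i - y)) @^-1` B i).
    apply/seteqP; split => y /=.
      move=> [By Cy] i; split; first by rewrite /= in_itv; exact: Cy.
      by have := By i; rewrite tnth_mktuple.
    move=> By; split => i; have [] := By i; rewrite /= in_itv//= => _ yB.
    by rewrite tnth_mktuple.
  have mred i : measurable ((fun y : R => red L (tnth a i - y)) @^-1` B i).
    rewrite -[X in measurable X]setTI.
    apply: (@measurableT_comp _ _ _ _ _ _ (red L) _ (fun y : R => tnth a i - y)) => //.
      exact: measurable_red.
    exact: measurable_funB.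
  rewrite lebesgue_tuple_box; last by move=> i; exact: measurableI.
  by apply: eq_bigr => i _; exact: lebesgue_measure_red.
by move=> B mB; rewrite !E.
Qed.

(* The ball centred at the middle of the fundamental domain is contained in a
   Euclidean ball, with no wrapping around. *)
Lemma uniform_tball_le x r : 0 < r ->
  fine (nu [set y | tdist2 x y <= r ^+ 2]) <= unit_ball_volume R d * r ^+ d / n%:R.
Proof.
move=> r0.
pose x0 : X := [tuple L / 2 | i < d].
have x0E i : tnth x0 i = L / 2 by rewrite tnth_mktuple.
rewrite (uniform_tball_const x x0) uniformE; last exact: measurable_tball.
have sub : [set y | tdist2 x0 y <= r ^+ 2] `&` C `<=`
    [set v : X | \sum_i (tnth x0 i - tnth v i) ^+ 2 <= r ^+ 2].
  move=> y [/= yr Cy]; apply: le_trans yr; rewrite tdist2E.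
  rewrite le_eqVlt; apply/orP; left; apply/eqP; apply: eq_bigr => i _.
  rewrite x0E; have /andP[y0 yL] := Cy i.
  (* On this face the difference is L / 2, which [red] sends to -L / 2; the square is the same. *)
  have [yi0|yi0] := eqVneq (tnth y i) 0.
    rewrite yi0 subr0 (@redE _ _ L0 (L / 2) 1); first by field.
    by apply/andP; split; have := L0; lra.
  rewrite (@redE _ _ L0 _ 0) ?mul0r ?subr0//.
  have y00 : 0 < tnth y i by rewrite lt_def yi0.
  by apply/andP; split; lra.
have mball : measurable ([set y | tdist2 x0 y <= r ^+ 2] `&` C).
  by apply: measurableI; [exact: measurable_tball|exact: measurable_torus].
pose S : set X := [set y | tdist2 x0 y <= r ^+ 2] `&` C.
have le1 : (lam S <= (unit_ball_volume R d * r ^+ d)%:E)%E.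
  rewrite -(lebesgue_ball x0 r0); apply: le_measure => //; rewrite inE//.
  exact: measurable_euclidean_ball.
rewrite -/S mulrC -lee_fin EFinM fineK.
  by rewrite lee_wpmul2l// lee_fin invr_ge0 ltW.
rewrite fin_numM// ge0_fin_numE//.
by apply: le_lt_trans le1 _; rewrite ltry.
Qed.

Lemma uniform_tball_gt0 x r : 0 < r ->
  0 < fine (nu [set y | tdist2 x y <= r ^+ 2]).
Proof.
move=> r0.
pose x0 : X := [tuple 0 | i < d].
have x0E i : tnth x0 i = 0 by rewrite tnth_mktuple.
rewrite (uniform_tball_const x x0).
have dR : (0 : R) < d%:R by rewrite ltr0n.
(* A corner cube of side at most r / d fits into the ball, as d (r / d)^2 <= r^2. *)
pose e := Num.min L (r / d%:R).
have e0 : 0 < e by rewrite lt_min L0 divr_gt0.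
have eL : e <= L by rewrite ge_min lexx.
have er : e <= r / d%:R by rewrite ge_min lexx orbT.
have sub : box (fun _ : 'I_d => `[0, e[%classic) `<=`
    [set y | tdist2 x0 y <= r ^+ 2] `&` C.
  move=> y /= ye; split.
    rewrite tdist2E; apply: (@le_trans _ _ (\sum_(i < d) (r / d%:R) ^+ 2)).
      apply: ler_sum => i _; rewrite -[leLHS]real_normK ?num_real//.
      rewrite ler_sqr ?nnegrE ?divr_ge0 ?(ltW r0)//.
      have := red_min L0 (tnth x0 i - tnth y i) 0; rewrite mul0r addr0 => /le_trans.
      apply; rewrite x0E sub0r normrN.
      have := ye i; rewrite /= in_itv/= => /andP[y0 y1].
      by rewrite ger0_norm// (le_trans (ltW y1)).
    rewrite sumr_const card_ord -[leLHS]mulr_natl exprMn exprVn.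
    have -> : d%:R * (r ^+ 2 * d%:R ^- 2) = r ^+ 2 / d%:R :> R.
      by field; rewrite gt_eqF.
    by rewrite ler_pdivrMr// ler_peMr ?sqr_ge0// ler1n.
  move=> i; have := ye i; rewrite /= in_itv/= => /andP[-> y1].
  by rewrite (lt_le_trans y1).
have mball : measurable ([set y | tdist2 x0 y <= r ^+ 2] `&` C).
  by apply: measurableI; [exact: measurable_tball|exact: measurable_torus].
rewrite fine_gt0// -ge0_fin_numE// fin_num_measure ?andbT//; last exact: measurable_tball.
rewrite uniformE; last exact: measurable_tball.
rewrite mule_gt0//; first by rewrite lte_fin invr_gt0.
apply: (@lt_le_trans _ _ (lam (box (fun _ : 'I_d => `[0, e[%classic)))).
  rewrite lebesgue_tuple_box//.
  under eq_bigr do rewrite lebesgue_measure_itv/= lte_fin e0 -EFinB subr0.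
  by rewrite prodEFin prodr_const card_ord lte_fin exprn_gt0.
apply: le_measure => //; rewrite inE//.
by apply: measurable_box.
Qed.

End uniform.

End torus.

(** * The covered volume *)

Section scaling.
Context d (T : measurableType d) (R : realType) (P : probability T R).
Variables (a : R) (f : T -> R).
Hypotheses (a0 : 0 < a) (bf : bmf f).

Let baf : bmf (fun x => a * f x).
Proof. by apply: bmfM => //; exact: bmf_cst. Qed.

Lemma std_devZ : std_dev P (fun x => a * f x) = a * std_dev P f.
Proof.
apply/eqP; rewrite -(@eqrXn2 _ 2) ?std_dev_ge0// ?mulr_ge0 ?std_dev_ge0 ?ltW//.
rewrite exprMn !std_dev_sq//; apply/eqP; rewrite -meanZl; last by bmf_tac.
by apply: eq_mean => x; rewrite meanZl//; ring.
Qed.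

Lemma kolmogorov_distZ : kolmogorov_dist P (fun x => a * f x) = kolmogorov_dist P f.
Proof.
have E t : [set w | (a * f w - mean P (fun x => a * f x)) /
      std_dev P (fun x => a * f x) <= t] =
    [set w | (f w - mean P f) / std_dev P f <= t].
  apply/seteqP; split => w /=; rewrite std_devZ meanZl// -mulrBr invfM mulrACA;
  by rewrite divff ?gt_eqF// mul1r.
by rewrite /kolmogorov_dist; congr sup; apply/seteqP; split => _ [t _ <-];
  exists t; rewrite // E.
Qed.

End scaling.

(** The best [y] would make r^2 = 2 K (M + 3 K). The cross term of the theorem is slightly larger,
    since 16 / 25 * 11 >= 6 and 16 / 25 * 5 >= 2, so [y = r / K] costs at most [r]. *)
Lemma optimize_smoothing (R : realType) (D M K K' r : R) :
  0 < K -> K <= K' -> 0 <= M -> 0 <= r ->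
  r ^+ 2 = 16 / 25 * K' * (11 * K' + 5 * M) ->
  (forall y, 0 < y -> D * y <= K * y ^+ 2 / 2 + (M + 3 * K) * (y + 1)) ->
  D <= M + 3 * K' + r.
Proof.
move=> K0 KK' M0 r0 r2 Dy.
have r2_ge : 2 * K * (M + 3 * K) <= r ^+ 2 by rewrite r2; nra.
have r_gt0 : 0 < r.
  by rewrite lt_def r0 andbT; apply: contraTneq r2_ge => ->; rewrite -ltNge; nra.
have := Dy (r / K) (divr_gt0 r_gt0 K0).
rewrite -(ler_pM2r (mulr_gt0 K0 r_gt0)).
have -> : D * (r / K) * (K * r) = D * r ^+ 2 by field; rewrite gt_eqF.
have -> : (K * (r / K) ^+ 2 / 2 + (M + 3 * K) * (r / K + 1)) * (K * r) =
    r ^+ 2 * (r / 2 + (M + 3 * K)) + (M + 3 * K) * K * r.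
  by field; rewrite gt_eqF.
move=> h; have : D * r ^+ 2 <= r ^+ 2 * (r + (M + 3 * K)).
  apply: (le_trans h); have := ler_wpM2r r0 r2_ge; lra.
by rewrite mulrC ler_pM2l ?exprn_gt0//; lra.
Qed.

(** The powers are bounded below by their values at d = 1 and the first fraction by 1; the second
    summand of [eta_V] is nonnegative and dropped, its denominator being positive because
    [3 * 2 ^+ d <= 6 ^+ d]. *)
Lemma eta_V_ge (R : realType) (d n : nat) (phi : R) :
  (0 < d)%N -> 0 <= phi -> 6 ^+ d * phi < n%:R ->
  2 * phi ^+ 2 * (1 + phi) ^+ 2 * (1 + 18 * phi + 36 * phi ^+ 2) <=
  eta_V d n phi.
Proof.
case: d => // d _ phi0 phin.
have pow_ge1 m k : 1 <= m.+1%:R ^+ k :> R by rewrite exprn_ege1// ler1n.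
have e2 : 2 <= 2 ^+ d.+1 :> R by rewrite exprS ler_peMr// pow_ge1.
have e3 : 3 <= 3 ^+ d.+1 :> R by rewrite exprS ler_peMr// pow_ge1.
have e4 : 4 <= 4 ^+ d.+1 :> R by rewrite exprS ler_peMr// pow_ge1.
have e6 : 6 <= 6 ^+ d.+1 :> R by rewrite exprS ler_peMr// pow_ge1.
have e66 : 36 <= 6 ^+ (2 * d.+1) :> R.
  by rewrite mul2n -addnn exprD (_ : 36 = 6 * 6); [rewrite ler_pM|ring].
have n0 : (0 : R) < n%:R by apply: le_lt_trans phin; rewrite mulr_ge0// exprn_ge0.
have e632 : 3 * 2 ^+ d.+1 <= 6 ^+ d.+1 :> R.
  by rewrite (_ : 6 = 3 * 2); [rewrite exprMn ler_wpM2r// exprn_ge0|ring].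
have phin' : 3 * 2 ^+ d.+1 * phi < n%:R.
  by apply: le_lt_trans phin; rewrite ler_wpM2r.
rewrite /eta_V.
set r1 := (2 * n%:R - _) / _; set r2 := (2 * n%:R - _) / _.
have r1_ge1 : 1 <= r1 by rewrite ler_pdivlMr ?subr_gt0//; lra.
have r2_ge0 : 0 <= r2 by rewrite divr_ge0//; lra.
apply: (@le_trans _ _ (2 * phi ^+ 2 * ((3 ^+ d.+1 + 1) * phi + 1) ^+ 2 *
    (1 + (2 ^+ d.+1 + 1) * 6 ^+ d.+1 * phi + r1 * 6 ^+ (2 * d.+1) * phi ^+ 2))).
  have p2 : 0 <= 2 * phi ^+ 2 by rewrite mulr_ge0// sqr_ge0.
  apply: ler_pM.
  - by rewrite mulr_ge0// sqr_ge0.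
  - by rewrite !addr_ge0// !mulr_ge0// sqr_ge0.
  - by rewrite ler_wpM2l// ler_sqr ?nnegrE; nra.
  - apply: lerD.
      rewrite lerD2l ler_wpM2r//.
      by rewrite (_ : 18 = 3 * 6); [rewrite ler_pM//; lra|ring].
    rewrite ler_wpM2r ?sqr_ge0// -[leLHS]mul1r ler_pM//.
rewrite lerDl; apply: mulr_ge0; first by rewrite mulr_ge0// exprn_ge0.
apply: addr_ge0; last by rewrite divr_ge0// ltW.
apply: addr_ge0 => //; apply: addr_ge0.
  by rewrite mulr_ge0// mulr_ge0// addr_ge0// exprn_ge0.
by rewrite mulr_ge0// mulr_ge0 ?sqr_ge0// mulr_ge0// exprn_ge0.
Qed.

(** The target is proportional to the mean [m], whereas the variance bound is in terms of x = n th.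
    The inequality [x <= m * (1 + x)] trades two powers of [x] for [m ^+ 2], and the factor (1 +
    phi)^2 of the lower bound for eta pays for it. *)
Lemma coverage_variance_bound (R : realType) (m x phi N eta : R) :
  0 < N -> 0 <= x -> x <= phi -> x <= m * (1 + x) ->
  2 * phi ^+ 2 * (1 + phi) ^+ 2 * (1 + 18 * phi + 36 * phi ^+ 2) <= eta ->
  N * (9 * N * (x / N) ^+ 5 + 16 * N ^+ 2 * (x / N) ^+ 6) <=
  (m * Num.sqrt eta / (N * Num.sqrt N)) ^+ 2.
Proof.
move=> N0 x0 xphi xm eta_ge.
have eta0 : 0 <= eta.
  apply: le_trans eta_ge.
  by rewrite !mulr_ge0 ?sqr_ge0 ?addr_ge0 ?mulr_ge0 ?sqr_ge0//; lra.
have -> : (m * Num.sqrt eta / (N * Num.sqrt N)) ^+ 2 = m ^+ 2 * eta / (N ^+ 2 * N).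
  by rewrite expr_div_n !exprMn !sqr_sqrtr ?(ltW N0).
have -> : N * (9 * N * (x / N) ^+ 5 + 16 * N ^+ 2 * (x / N) ^+ 6) =
    (9 * x ^+ 5 + 16 * x ^+ 6) / (N ^+ 2 * N) by field; rewrite gt_eqF.
rewrite ler_pM2r ?invr_gt0 ?mulr_gt0 ?exprn_gt0//.
have p0 : 0 <= phi by apply: le_trans xphi.
have le1 : 2 * x ^+ 2 * (1 + x) ^+ 2 * (1 + 18 * x + 36 * x ^+ 2) <= eta.
  apply: le_trans eta_ge.
  have s1 : x ^+ 2 <= phi ^+ 2 by rewrite ler_sqr.
  have s2 : (1 + x) ^+ 2 <= (1 + phi) ^+ 2 by rewrite ler_sqr ?nnegrE; lra.
  apply: ler_pM; last by lra.
  - by rewrite mulr_ge0 ?sqr_ge0// mulr_ge0 ?sqr_ge0.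
  - by have := sqr_ge0 x; lra.
  - apply: ler_pM => //; [by rewrite mulr_ge0 ?sqr_ge0|exact: sqr_ge0|].
    by rewrite ler_wpM2l.
have s3 : x ^+ 2 <= m ^+ 2 * (1 + x) ^+ 2.
  by rewrite -exprMn ler_sqr ?nnegrE// (le_trans x0).
apply: (@le_trans _ _ (x ^+ 2 * (2 * x ^+ 2 * (1 + 18 * x + 36 * x ^+ 2)))).
  rewrite -subr_ge0.
  rewrite (_ : _ - _ = x ^+ 4 * (2 + 27 * x + 56 * x ^+ 2)); last by ring.
  by rewrite mulr_ge0 ?exprn_ge0//; have := sqr_ge0 x; lra.
apply: (@le_trans _ _ (m ^+ 2 * (2 * x ^+ 2 * (1 + x) ^+ 2 *
    (1 + 18 * x + 36 * x ^+ 2)))); last by rewrite ler_wpM2l ?sqr_ge0.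
rewrite (_ : m ^+ 2 * _ = m ^+ 2 * (1 + x) ^+ 2 *
  (2 * x ^+ 2 * (1 + 18 * x + 36 * x ^+ 2))); last by ring.
rewrite ler_wpM2r// mulr_ge0// ?mulr_ge0 ?sqr_ge0//.
by have := sqr_ge0 x; lra.
Qed.

Section main.
Variables (R : realType) (dT : measure_display) (T : measurableType dT).
Variables (P : probability T R) (d n : nat) (rho : R).
Variable U : 'I_n -> {RV P >-> (d.-tuple R)%type}.
Hypotheses (d0 : (0 < d)%N) (n4 : (3 < n)%N) (rho0 : 0 < rho).
Hypothesis unifU :
  forall i, uniform_law (lebesgue_tuple d) (@torus R d n) (U i).
Hypothesis indU : independent_RVs U.
Local Notation X := (d.-tuple R)%type.
Local Notation phi := (unit_ball_volume R d * rho ^+ d).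
Hypothesis phi_n : 6 ^+ d * phi < n%:R.

Let n0 : (0 < n)%N. Proof. exact: leq_trans n4. Qed.
Let nR : (0 : R) < n%:R. Proof. by rewrite ltr0n. Qed.
Let i0 : 'I_n := Ordinal n0.

Let nu : probability X R := distribution P (U i0).

Let lawU i (A : set X) : measurable A -> P (U i @^-1` A) = nu A.
Proof. by move=> mA; have := unifU i mA; rewrite -(unifU i0 mA). Qed.

Let Pi := law P (measurable_joint U).

Let resampleE i (F : n.-tuple X -> R) : bmf F ->
  mean Pi (resample nu i F) = mean Pi F.
Proof. exact: joint_resample. Qed.

Definition cover_ind (r : R) (z : X * X) : R := (tdist2 n z.1 z.2 <= r ^+ 2)%R%:R.

Let measurable_near r : measurable [set z : X * X | tdist2 n z.1 z.2 <= r ^+ 2].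
Proof.
rewrite (_ : [set z | _] = (fun z : X * X => tdist2 n z.1 z.2) @^-1` `]-oo, r ^+ 2]).
  by rewrite -[X in measurable X]setTI; exact: measurable_tdist2.
by apply/seteqP; split => z /=; rewrite in_itv.
Qed.

Let bcover r : bmf (cover_ind r).
Proof.
rewrite (_ : cover_ind r = \1_[set z : X * X | tdist2 n z.1 z.2 <= r ^+ 2]).
  exact: bmf_indic.
apply/funext => z; rewrite indicE /cover_ind; congr (nat_of_bool _)%:R.
by apply/idP/idP; rewrite inE.
Qed.

Let cover01 r z : 0 <= cover_ind r z <= 1.
Proof. by rewrite /cover_ind; case: (tdist2 _ _ _ <= _); rewrite ?lexx ler01. Qed.

Let coverC r x y : cover_ind r (x, y) = cover_ind r (y, x).
Proof. by rewrite /cover_ind tdist2C. Qed.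

Let mean_cover r x : mean nu (fun y => cover_ind r (x, y)) =
  fine (nu [set y | tdist2 n x y <= r ^+ 2]).
Proof.
rewrite -mean_indic; last exact: measurable_tball.
apply: eq_mean => y; rewrite indicE /cover_ind; congr (nat_of_bool _)%:R.
by apply/idP/idP; rewrite inE.
Qed.

Let origin : X := [tuple 0 | i < d].
Let th := fine (nu [set y | tdist2 n origin y <= rho ^+ 2]).

Let mean_c x : mean nu (fun y => cover_ind rho (x, y)) = th.
Proof.
by rewrite mean_cover /th (uniform_tball_const d0 n0 (unifU i0) x origin).
Qed.

Let th_gt0 : 0 < th.
Proof. exact: (uniform_tball_gt0 d0 n0 (unifU i0)). Qed.

Let th_le : n%:R * th <= phi.
Proof.
have := uniform_tball_le d0 n0 (unifU i0) origin rho0; rewrite -/th.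
by rewrite ler_pdivlMr// mulrC.
Qed.

Let phi_gt0 : 0 < phi.
Proof. by apply: lt_le_trans th_le; rewrite mulr_gt0. Qed.

Let pow_ge1 m k : 1 <= m.+1%:R ^+ k :> R.
Proof. by rewrite exprn_ege1// ler1n. Qed.

Let th_lt1 : th < 1.
Proof.
rewrite -(ltr_pM2l nR) mulr1; apply: le_lt_trans th_le _.
by apply: le_lt_trans phi_n; rewrite ler_peMl ?(ltW phi_gt0) ?pow_ge1.
Qed.

Local Notation cov := (@covered _ X R n nu (cover_ind rho)).
Let bcov : bmf cov.
Proof.
apply: bmfB; first exact: bmf_cst.
by apply: (bmf_vac _ Pi) => //; have [] := bcover rho.
Qed.

Let std_dev_cov_gt0 : 0 < std_dev Pi cov.
Proof.
have n2 : (n.-2 < n)%N by case: (n) n4 => [|[|m]] //= _; rewrite ltnS leqnSn.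
have n1 : (n.-1 < n)%N by rewrite prednK.
(* Beyond distance 2 rho the balls are disjoint, and the points within that distance have
   probability at most 2^d phi / n, which is below 1. *)
pose far (z : X * X) : R := 1 - cover_ind (2 * rho) z.
have rho2 : 0 < 2 * rho by rewrite mulr_gt0.
apply: (@std_dev_covered_gt0 _ _ _ _ nu Pi resampleE (cover_ind rho) th
  (bcover rho).1 (cover01 rho) (@coverC rho) mean_c th_gt0 th_lt1 far
  (1 - 2 ^+ d * phi / n%:R) (Ordinal n2) (Ordinal n1)) => //=.
- by case: (n) n4 => [|[|m]].
- by rewrite prednK.
- by apply: bmfB; [exact: bmf_cst | exact: bcover].
- by move=> z; rewrite /far; have /andP[? ?] := cover01 (2 * rho) z; apply/andP; split; lra.
- rewrite subr_gt0 ltr_pdivrMr// mul1r; apply: le_lt_trans phi_n.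
  by rewrite ler_pM2r// ler_pXn2r ?nnegrE// ler_nat.
- move=> z; rewrite /far meanB; last 2 first.
  + exact: bmf_cst.
  + exact: (bmf_pair2 z (bcover _)).
  rewrite mean_cst lerD2l lerN2.
  rewrite (eq_mean _ (fun y => coverC (2 * rho) y z)) mean_cover.
  have := uniform_tball_le d0 n0 (unifU i0) z rho2.
  by move=> /le_trans; apply; rewrite exprMn mulrCA.
- move=> y z; rewrite /far /cover_ind/=.
  have [|fyz _] := leP (tdist2 n y z) _; first by rewrite subrr eqxx.
  rewrite -[RHS](mean_cst nu); apply: eq_mean => x.
  have [xy|] := leP (tdist2 n x y) _; last by rewrite mul0r.
  have [xz|] := leP (tdist2 n x z) _; last by rewrite mulr0.
  by have := tdist2_triangle n0 xy xz; rewrite leNgt fyz.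
Qed.

(** Valid at every configuration, even with centres outside the fundamental domain, because the
    torus distance is periodic; no null set has to be discarded. *)
Let covered_volumeE (u : n.-tuple X) :
  covered_volume rho (fun i => tnth u i) = n%:R * cov u.
Proof.
pose D : set X := \bigcup_(i in [set: 'I_n]) [set y | tdist2 n (tnth u i) y <= rho ^+ 2].
have mD : measurable D.
  by apply: fin_bigcup_measurable => // i _; exact: measurable_tball.
rewrite /covered_volume.
have -> : \bigcup_i torus_ball n rho (tnth u i) = D `&` @torus R d n.
  apply/seteqP; split => y.
    move=> [i _ [Cy yi]]; split => //; exists i => //=.
    by rewrite -torus_dist_le// ltW.
  by move=> [[i _ /= yi] Cy]; exists i => //; split => //; rewrite torus_dist_le// ltW.
have nuD : nu D = (n%:R^-1%:E * lebesgue_tuple d (D `&` @torus R d n))%E.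
  exact: (uniformE d0 n0 (unifU i0)).
have -> : fine (lebesgue_tuple d (D `&` @torus R d n)) = n%:R * fine (nu D).
  rewrite nuD fineM//.
    by rewrite mulrA divff ?gt_eqF// mul1r.
  rewrite ge0_fin_numE//; apply: (@le_lt_trans _ _ (lebesgue_tuple d (@torus R d n))).
    apply: le_measure; rewrite ?inE//; first by apply: measurableI => //; exact: measurable_torus.
    exact: measurable_torus.
  by rewrite lebesgue_torus// ltry.
congr (_ * _); rewrite -mean_indic// /covered -(mean_cst nu 1) -meanB; last 2 first.
- exact: bmf_cst.
- exact: (bmf_pair1 u (bmf_prodb2 (bcover rho).1 (cover01 rho) _)).
apply: eq_mean => y; rewrite indicE /prodb.
have [|yD] := boolP (y \in D).
  rewrite inE => -[i _ /= yi].
  rewrite (bigD1 i) ?inE//= /cover_ind/= tdist2C//.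
  by rewrite yi subrr mul0r subr0.
rewrite big1 ?subrr// => i _; rewrite /cover_ind/= tdist2C//.
case: (boolP (_ <= _)%R) => [yi|_]; last by rewrite subr0.
by move: yD; rewrite notin_setE => /(_ (ex_intro2 _ _ i I yi)).
Qed.

Let V w := covered_volume rho (fun i => U i w).

Let mj := measurable_joint U.

Let VE : V = (fun w => n%:R * (cov \o joint U) w).
Proof.
apply/funext => w; rewrite /comp -covered_volumeE /V.
by congr covered_volume; apply/funext => i; rewrite tnth_mktuple.
Qed.

Let meanj (F : n.-tuple X -> R) : bmf F -> mean P (F \o joint U) = mean Pi F.
Proof. by move=> bF; rewrite mean_law. Qed.

Let bcovj : bmf (cov \o joint U).
Proof. by have [mc cM] := bcov; exact: bmf_comp. Qed.

Lemma kolmogorov_dist_volume :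
  kolmogorov_dist P V <=
    mean P V / (5 * std_dev P V ^+ 2) *
    (Num.sqrt (11 * phi ^+ 2 / std_dev P V
               + 5 * Num.sqrt (eta_V d n phi) / Num.sqrt n%:R)
     + 2 * phi / Num.sqrt (std_dev P V)) ^+ 2.
Proof.
have -> : kolmogorov_dist P V = kolmogorov_dist Pi cov.
  by rewrite VE kolmogorov_distZ// (kolmogorov_dist_transfer mj meanj bcov).
have -> : mean P V = n%:R * mean Pi cov by rewrite VE meanZl// meanj.
have -> : std_dev P V = n%:R * std_dev Pi cov.
  by rewrite VE std_devZ// (std_dev_transfer mj meanj bcov).
set m := mean Pi cov; set s := std_dev Pi cov; set D := kolmogorov_dist Pi cov.
set eta := eta_V d n phi; set N : R := n%:R.
have s0 : 0 < s by exact: std_dev_cov_gt0.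
have x0 : 0 <= N * th by rewrite mulr_ge0 ?ltW.
have mE : m = 1 - (1 - th) ^+ n.
  exact: (mean_covered resampleE (bcover rho).1 (cover01 rho) mean_c).
have xm : N * th <= m * (1 + N * th).
  have := bernoulli_le th_lt1 n; rewrite mE -/N; lra.
have m0 : 0 < m.
  have : 0 < m * (1 + N * th) by apply: lt_le_trans xm; rewrite mulr_gt0.
  by rewrite pmulr_lgt0// ltr_pwDl.
have eta_ge := eta_V_ge d0 (ltW phi_gt0) phi_n; rewrite -/eta in eta_ge.
have varT := coverage_variance_bound nR x0 th_le xm eta_ge.
rewrite -/N [N * th / N]mulrAC divff ?gt_eqF// mul1r in varT.
have sN0 : 0 < Num.sqrt N by rewrite sqrtr_gt0.
pose tau := m * Num.sqrt eta / (N * Num.sqrt N).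
have tau0 : 0 <= tau by rewrite divr_ge0 ?mulr_ge0 ?sqrtr_ge0 ?ltW.
pose S := N * s; pose mu := N * m.
have S0 : 0 < S by rewrite mulr_gt0.
have mu0 : 0 < mu by rewrite mulr_gt0.
have sS0 : 0 < Num.sqrt S by rewrite sqrtr_gt0.
pose E := Num.sqrt eta / Num.sqrt N.
have E0 : 0 <= E by rewrite divr_ge0 ?sqrtr_ge0.
pose a := 11 * phi ^+ 2 / S + 5 * E.
have a0 : 0 <= a.
  apply: addr_ge0; last by rewrite mulr_ge0.
  by rewrite divr_ge0 ?(ltW S0)// mulr_ge0 ?sqr_ge0.
(* The cross term of the square in the theorem; the squared terms give [M + 3 * K'], with 3 = (11 +
   4) / 5. *)
pose r := 4 * mu / (5 * S ^+ 2) * (phi / Num.sqrt S) * Num.sqrt a.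
have r0 : 0 <= r.
  apply: mulr_ge0; last exact: sqrtr_ge0.
  apply: mulr_ge0; last by rewrite divr_ge0 ?(ltW phi_gt0) ?(ltW sS0).
  by rewrite divr_ge0// mulr_ge0 ?(ltW mu0) ?sqr_ge0.
have q2 : Num.sqrt S ^+ 2 = S by rewrite sqr_sqrtr ?ltW.
have a2 : Num.sqrt a ^+ 2 = a by rewrite sqr_sqrtr.
rewrite -/S -/mu -[5 * Num.sqrt eta / _]mulrA -/E -/a.
pose K' := mu * phi ^+ 2 / S ^+ 3; pose M := mu * E / S ^+ 2.
have -> : mu / (5 * S ^+ 2) * (Num.sqrt a + 2 * phi / Num.sqrt S) ^+ 2 =
    M + 3 * K' + r.
  rewrite sqrrD a2 expr_div_n q2 /M /K' /r /a.
  by field; rewrite !gt_eqF.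
apply: (@optimize_smoothing _ _ M (m * th ^+ 2 / s ^+ 3) K' r).
- by rewrite divr_gt0 ?mulr_gt0 ?exprn_gt0.
- rewrite (_ : _ / s ^+ 3 = mu * (N * th) ^+ 2 / S ^+ 3); last first.
    by rewrite /mu /S; field; rewrite !gt_eqF.
  rewrite ler_pM2r ?invr_gt0 ?exprn_gt0// ler_pM2l// ler_sqr ?nnegrE//.
  exact: ltW phi_gt0.
- by rewrite divr_ge0 ?sqr_ge0// mulr_ge0 ?(ltW mu0).
- exact: r0.
- rewrite /r exprMn a2 exprMn [(phi / _) ^+ 2]expr_div_n q2 /a /K' /M.
  by field; rewrite gt_eqF.
move=> y y0.
have := @kolmogorov_dist_covered _ _ _ _ nu Pi resampleE (cover_ind rho) th
  (bcover rho).1 (cover01 rho) (@coverC rho) mean_c th_gt0 th_lt1 i0 tau y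
  s0 tau0 varT y0.
rewrite -/m -/s -/D (_ : tau / s ^+ 2 = M)//.
by rewrite /tau /M /mu /S /E; field; rewrite !gt_eqF.
Qed.

End main.

Theorem theorem2p1 (R : realType) (dT : measure_display)
    (T : measurableType dT) (P : probability T R)
    (d n : nat) (rho : R) (U : 'I_n -> {RV P >-> (d.-tuple R)%type}) :
  (1 <= d)%N -> (4 <= n)%N -> 0 < rho ->
  (forall i, uniform_law (lebesgue_tuple d) (torus d n) (U i)) ->
  independent_RVs U ->
  let phi : R := unit_ball_volume R d * rho ^+ d in
  let V : T -> R := fun w => covered_volume rho (fun i => U i w) in
  let mu : R := mean P V in
  let sigma : R := std_dev P V in
  6 ^+ d * phi < n%:R ->
  kolmogorov_dist P V <=
    mu / (5 * sigma ^+ 2) *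
    (Num.sqrt (11 * phi ^+ 2 / sigma
               + 5 * Num.sqrt (eta_V d n phi) / Num.sqrt n%:R)
     + 2 * phi / Num.sqrt sigma) ^+ 2.
Proof.
move=> d1 n4 rho0 unifU indU phi V mu sigma phi_n.
exact: kolmogorov_dist_volume.
Qed.
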